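(* Consider the pressureless Euler system $$\partial_tu+\partial_x(u^2/2)=0,\qquad\partial_tv+u\,\partial_xv=0$$ on the half-line $[0,+\infty)$ with the random stationary boundary conditions $u(t,0)=\phi(t)$, $v(t,0)=\psi(t)$. 1. (Existence.) The formulas $$u_\omega(t,x)=\frac{x}{t-t_*(t,x)},\qquad v_\omega(t,x)=\psi(t_*(t,x)),\qquad(t,x)\in\mathbb{R}\times(0,+\infty),$$ define a global stationary solution $(u_\omega,v_\omega)$ of the system with these boundary conditions, where $t_*(t,x)$ is the smallest of the points $s<t$ at which the minimum over $s\in(-\infty,t)$ of $F(t,x,s)=\frac{x^2}{2(t-s)}+\frac12\int_s^t\phi_+^2(r)\,dr$ is attained. 2. (Uniqueness.) Every stationary global solution $(\tilde u_\omega,\tilde v_\omega)$ of the system with these boundary conditions such that $\tilde u_\omega(t,\cdot)\in\mathbb{U}_{-q}$ coincides with $(u_\omega,v_\omega)$ with probability $1$. 3. (Pullback attraction.) The solution $(u_\omega,v_\omega)$ is a random one-point pullback attractor: with probability $1$, for every pair $(w,w')$ with $w\in\mathbb{U}_{-q}$ and every $r>0$ there is $t_0<0$ such that for every $t<t_0$ the solution of the pressureless Euler system with initial condition $(w,w')$ assigned at time $t$ coincides with $(u_\omega,v_\omega)$ on $\{0\}\times(0,r]$.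
   Context: Random boundary conditions: $(\Omega,\mathcal{F},\mathsf{P})$ is a probability space with an ergodic flow $(\theta^t)_{t\in\mathbb{R}}$ of $\mathsf{P}$-preserving measurable transformations; $\phi,\psi:\Omega\to\mathbb{R}$ are random variables such that for all $\omega$ the processes $\phi(t)=\phi(\theta^t\omega)$ and $\psi(t)=\psi(\theta^t\omega)$ are bounded on every finite time interval. With $\phi_+=\max(\phi,0)$, assume $q^2:=\mathsf{E}\phi_+^2<+\infty$, $q\ge0$. Function spaces: $\mathbb{R}_+=[0,+\infty)$; for $p\in\mathbb{R}\cup\{-\infty\}$, $\mathbb{U}_p=\{u\in L^1_{\mathrm{loc}}(\mathbb{R}_+):\liminf_{x\to+\infty}\frac1x\int_0^xu(y)\,dy>p\}$, and $\mathbb{U}=\mathbb{U}_{-\infty}$. Solution of the initial-boundary value problem with initial conditions $u(t_0,\cdot)=u_0\in\mathbb{U}$, $v(t_0,\cdot)=v_0$: let $$U(t,x)=\inf_{\gamma:\gamma(t)=x}\Big\{\int_0^{\gamma(t_0)}u_0(z)\,dz+\frac12\int_{t_0}^t\dot\gamma^2(s)\mathbf{1}_{\gamma(s)>0}\,ds-\frac12\int_{t_0}^t\phi_+^2(s)\mathbf{1}_{\gamma(s)=0}\,ds\Big\},$$ over absolutely continuous $\gamma:[t_0,t]\to\mathbb{R}_+$ with $\gamma(t)=x$. For each $t>t_0$, outside an at most countable set $B(t)$ of $x$, the minimizer $\gamma$ is unique and $u(t,x)=\partial_xU(t,x)=\dot\gamma(t)$; $u(t,\cdot)$ is extended to $B(t)$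 by right-continuity. For $x\notin B(t)$: if $\gamma$ does not visit $0$, it is a straight segment and $v(t,x)=v_0(\gamma(t_0))$; otherwise the set of times when $\gamma=0$ is a segment $[a,b]$ and $v(t,x)=\psi(b)$. Global solution: a process $(u_\omega(t,\cdot),v_\omega(t,\cdot))$, $t\in\mathbb{R}$, with $u_\omega(t,\cdot)\in\mathbb{U}$, such that for $\mathsf{P}$-a.e. $\omega$ and all $t_0<t_1$ the solution at time $t_1$ with initial condition $(u_\omega(t_0,\cdot),v_\omega(t_0,\cdot))$ at time $t_0$ is $(u_\omega(t_1,\cdot),v_\omega(t_1,\cdot))$. It is stationary if its value at $(t,\omega)$ equals its value at $(0,\theta^t\omega)$.
   Formalization: The theorem assumes q>0: for q=0 the minimum of F over s<t is a.s. not attained, so t_* is undefined. Outside B(t) the minimizer need not be unique (uniqueness can fail); instead all minimizers must give the same u and v. *)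

(* Defs.v *)
From HB Require Import structures.
From mathcomp Require Import all_boot all_order all_algebra.
From mathcomp Require Import all_classical all_reals all_analysis.

Set Implicit Arguments.
Unset Strict Implicit.
Unset Printing Implicit Defensive.

Import Order.TTheory GRing.Theory Num.Theory.
Import numFieldNormedType.Exports.

Local Open Scope classical_set_scope.
Local Open Scope ring_scope.

(* As usual for flows, the map (t, w) |-> theta t w is jointly measurable, so
   that the paths t |-> X (theta t w) of a random variable X are Borel and can
   be integrated in time. *)
Definition ergodic_flow (R : realType) (d : measure_display)
    (Omega : measurableType d) (P : probability Omega R)
    (theta : R -> Omega -> Omega) : Prop :=
  [/\ measurable_fun [set: measurableTypeR R * Omega]
        (fun p : measurableTypeR R * Omega => theta p.1 p.2),
      theta 0 = id /\ (forall s t, theta (s + t) = theta s \o theta t),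
      forall t (A : set Omega), measurable A -> P (theta t @^-1` A) = P A &
      forall A : set Omega, measurable A ->
        (forall t, theta t @^-1` A = A) -> P A = 0%E \/ P A = 1%E].

Definition trajectory (R : realType) (Omega : Type) (theta : R -> Omega -> Omega)
    (X : Omega -> R) (w : Omega) : R -> R := fun t => X (theta t w).

(* A function on the half-line [0, +oo[ is represented by a function on R
   whose values at negative points are irrelevant. *)

Definition L1loc_halfline (R : realType) (u : R -> R) : Prop :=
  forall x : R, 0 <= x ->
    (@lebesgue_measure R).-integrable `[0, x] (EFin \o u).

Definition Uspace (R : realType) (p : \bar R) (u : R -> R) : Prop :=
  L1loc_halfline u /\
  (p < limf_einf
         (fun x : R => (x^-1 * \int[lebesgue_measure]_(y in `[0%R, x]) u y)%:E)
         (pinfty_nbhs R))%E.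

Definition absolutely_continuous (R : realType) (a b : R) (f : R -> R) : Prop :=
  forall e : R, 0 < e -> exists2 dlt : R, 0 < dlt &
    forall (n : nat) (l r : 'I_n -> R),
      (forall i, [/\ a <= l i, l i <= r i & r i <= b]) ->
      trivIset setT (fun i => `]l i, r i[%classic) ->
      \sum_i (r i - l i) < dlt -> \sum_i `|f (r i) - f (l i)| < e.

Section initial_boundary_value_problem.
(* phi and psi are the boundary values as functions of time. *)
Context (R : realType) (phi psi : R -> R) (t0 : R) (u0 v0 : R -> R).
Implicit Types (t x : R) (g u v : R -> R).

Definition admissible t x g : Prop :=
  [/\ absolutely_continuous t0 t g,
      forall s, t0 <= s <= t -> 0 <= g s & g t = x].

(* The kinetic energy of an absolutely continuous path may be infinite, hence
   the extended real value. *)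
Definition action t g : \bar R :=
  ((\int[lebesgue_measure]_(z in `[0%R, g t0]) u0 z)%:E
   + (2^-1)%:E *
       \int[lebesgue_measure]_(s in `[t0, t])
          (derive1 g s ^+ 2 * \1_[set r | 0 < g r] s)%:E
   - (2^-1 * \int[lebesgue_measure]_(s in `[t0, t])
          (phi^\+ s ^+ 2 * \1_[set r | g r = 0] s))%:E)%E.

Definition value t x : R := fine (ereal_inf (action t @` admissible t x)).

Definition minimizer t x g : Prop :=
  admissible t x g /\ action t g = (value t x)%:E.

Definition shocks t : set R :=
  [set x | 0 < x /\ ~ derivable (value t) x 1].

Definition transported t g (z : R) : Prop :=
  ((forall s, t0 <= s <= t -> g s != 0) /\ z = v0 (g t0)) \/
  (exists a b : R, [/\ a <= b,
     [set s | t0 <= s <= t /\ g s = 0] = `[a, b]%classic & z = psi b]).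

(* (u, v) coincides on D with the solution at time t of the problem with data
   (u0, v0) at time t0. On the exceptional set of shocks, u is given by
   right-continuity and v is not specified. Off that set there may still be
   several minimizers, but only because a path can reach 0 in several equally
   good ways (for example, with two first hitting times of 0). The terminal
   velocity and the last visit to 0, hence u and v, are the same for all of
   them. *)
Definition solution_on (D : set R) t u v : Prop :=
  [/\ countable (D `&` shocks t),
      forall x, D x -> ~ shocks t x ->
        [/\ u x = derive1 (value t) x,
            exists g, minimizer t x g &
            forall g, minimizer t x g ->
              (g t - g s) / (t - s) @[s --> t^'-] --> u x /\
              transported t g (v x)] &
      forall x, D x -> shocks t x ->
        derive1 (value t) y @[y --> within (~` shocks t) x^'+] --> u x].

End initial_boundary_value_problem.

Section global_solutions.
Context (R : realType) (d : measure_display) (Omega : measurableType d)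
  (P : probability Omega R) (theta : R -> Omega -> Omega)
  (phi psi : Omega -> R).

(* u w t x and v w t x are defined for x > 0. *)
Implicit Types u v : Omega -> R -> R -> R.

Definition is_process u : Prop :=
  forall t x : R, 0 < x -> measurable_fun setT (fun w => u w t x).

Definition global_solution u v : Prop :=
  [/\ is_process u, is_process v &
      {ae P, forall w,
        (forall t, Uspace -oo%E (u w t)) /\
        (forall t0 t1, t0 < t1 ->
           solution_on (trajectory theta phi w) (trajectory theta psi w) t0
             (u w t0) (v w t0) `]0, +oo[ t1 (u w t1) (v w t1))}].

Definition stationary u v : Prop :=
  forall t w x, 0 < x ->
    u w t x = u (theta t w) 0 x /\ v w t x = v (theta t w) 0 x.

End global_solutions.

Section explicit_solution.
Context (R : realType).
Implicit Types (phi psi : R -> R) (t x s : R).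

Definition Faction phi t x s : R :=
  x ^+ 2 / (2 * (t - s))
  + 2^-1 * \int[lebesgue_measure]_(r in `[s, t]) (phi^\+ r ^+ 2).

Definition argmins phi t x : set R :=
  [set s | s < t /\ forall r, r < t -> Faction phi t x s <= Faction phi t x r].

Definition smallest_argmin phi t x s : Prop :=
  argmins phi t x s /\ lbound (argmins phi t x) s.

(* The default value t, used when there is no smallest minimum point, commutes
   with time shifts. *)
Definition tstar phi t x : R := xget t (smallest_argmin phi t x).

Definition usol phi t x : R := x / (t - tstar phi t x).

Definition vsol phi psi t x : R := psi (tstar phi t x).

End explicit_solution.

(* Main.v *)
Require Import Defs.
From HB Require Import structures.
From mathcomp Require Import all_boot all_order all_algebra.
From mathcomp Require Import all_classical all_reals all_analysis measurable_realfun.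
From mathcomp Require Import lra ring.

Import Order.TTheory GRing.Theory Num.Theory.
Import numFieldNormedType.Exports.

Local Open Scope classical_set_scope.
Local Open Scope ring_scope.


(** An optimal path is straight off the boundary, by strict convexity of the
    kinetic energy, and it stays at the boundary from its first to its last visit,
    since time spent there costs nothing and may yield. The variational problem
    thus reduces to two explicit costs: that of a segment from a point y of the
    initial line to x, and that of a path that arrives at the boundary at time a
    and leaves it at time b (path_classification, value_eq, minimizer_cases). For
    absolutely continuous paths this rests on two facts: such a path is the
    integral of its derivative (absolutely_continuous_derive, by the Radon-Nikodym
    theorem), and the Cauchy-Schwarz inequality (kinetic_energy).

    What a path pays after its last visit b of the boundary is F(t, x, b), up to
    terms that do not depend on b. Hence, wherever paths that visit the boundary are
    optimal, the value function is the minimum of F plus a constant, optimal paths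
    leave the boundary at minimum points of F, and the solution is the explicit one
    (explicit_solution_on). As a function of x^2 this minimum is concave; it is
    differentiable off a countable set, and precisely where F has only one minimum
    point.

    The explicit solution is global because its velocity at time t0 has the minimum
    of F(t0, y, s) over s as a primitive in y (potential_usol), so that solving from
    time t0 on amounts to minimizing F in two steps (explicit_solution_global).

    Attraction comes from a competition. If the primitive of the initial velocity is
    at least - p y - C with p < q, then a path gains at most p^2/2 per unit of time
    from coming straight from far away, whereas the boundary yields q^2/2 per unit
    of time on average. Over a long time all optimal paths visit the boundary, and
    the data only influence their way up to it (pullback_attraction).

    For uniqueness, a particle of a global solution with a velocity u <= 0 has been
    moving straight for ever. Coming from far away was at least as good as waiting at
    the boundary, so u <= - q; and no particle to its right is faster, which is
    impossible in U_(-q). So velocities are positive (global_velocity_gt0), the bound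
    above holds at all times with p = C = 0, and attraction applies from initial
    times that recede to -oo (global_solution_uniq).

    Probability enters through the average yield of the boundary in the past, which
    is almost surely at least q^2/2 (inflow_growth_ae), by ergodicity and a maximal
    inequality (maximal_ergodic). *)

(** * Variation of absolutely continuous functions *)

Section variation.
Context {R : realType}.
Implicit Types (x y z : R) (p : R * R) (s : seq (R * R)) (g : R -> R).

Definition separated p p' : bool := (p.2 <= p'.1) || (p'.2 <= p.1).

Definition nested_in x y p : bool := [&& x <= p.1, p.1 <= p.2 & p.2 <= y].

(** Families of intervals are lists of pairs of endpoints. The intervals of a
    family may leave gaps, so that both cutting a family at a point and
    concatenating two families are list operations. *)
Definition sepfamily x y s : bool := all (nested_in x y) s && pairwise separated s.

Definition total_length s : R := \sum_(p <- s) (p.2 - p.1).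

Definition variation_on g s : R := \sum_(p <- s) `|g p.2 - g p.1|.

Definition variation g x y : R :=
  sup [set variation_on g s | s in [set s | sepfamily x y s]].

Lemma sepfamilyW x y x' y' s : x' <= x -> y <= y' -> sepfamily x y s ->
  sepfamily x' y' s.
Proof.
move=> xx yy /andP[/allP sa sp]; rewrite /sepfamily sp andbT; apply/allP => p /sa.
by rewrite /nested_in => /and3P[? -> ?]; rewrite (le_trans xx)// (le_trans _ yy).
Qed.

Lemma sepfamily_nil x y : sepfamily x y [::].
Proof. by []. Qed.

Lemma sepfamily_cut x y z s : x <= z -> z <= y -> sepfamily x y s ->
  [/\ sepfamily x z [seq (Num.min p.1 z, Num.min p.2 z) | p <- s],
      sepfamily z y [seq (Num.max p.1 z, Num.max p.2 z) | p <- s] &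
      forall g, variation_on g s <=
        variation_on g [seq (Num.min p.1 z, Num.min p.2 z) | p <- s] +
        variation_on g [seq (Num.max p.1 z, Num.max p.2 z) | p <- s]].
Proof.
move=> xz zy /andP[/allP sa sp]; split.
- rewrite /sepfamily all_map pairwise_map; apply/andP; split.
    apply/allP => p /sa /and3P[p1 p2 p3]; apply/and3P; split => /=.
    + by rewrite le_min p1.
    + by rewrite le_min !ge_min p2 lexx orbT.
    + by rewrite ge_min lexx orbT.
  apply: sub_pairwise sp => p q /orP[h|h]; apply/orP; [left|right] => /=;
    by rewrite le_min !ge_min h lexx orbT.
- rewrite /sepfamily all_map pairwise_map; apply/andP; split.
    apply/allP => p /sa /and3P[p1 p2 p3]; apply/and3P; split => /=.
    + by rewrite le_max lexx orbT.
    + by rewrite ge_max !le_max p2 lexx orbT.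
    + by rewrite ge_max p3.
  apply: sub_pairwise sp => p q /orP[h|h]; apply/orP; [left|right] => /=;
    by rewrite ge_max !le_max h lexx orbT.
- move=> g; rewrite /variation_on !big_map -big_split/= big_seq [leRHS]big_seq.
  apply: ler_sum => p /sa /and3P[_ p12 _].
  have [p2z|zp2] := leP p.2 z; first by rewrite (min_l (le_trans p12 p2z)) lerDl.
  have [p1z|zp1] := leP p.1 z; last by rewrite subrr normr0 add0r.
  by rewrite addrC (le_trans _ (ler_normD _ _))// addrA subrK.
Qed.

Lemma variation_on_cat g s s' :
  variation_on g (s ++ s') = variation_on g s + variation_on g s'.
Proof. exact: big_cat. Qed.

Lemma total_length_cat s s' :
  total_length (s ++ s') = total_length s + total_length s'.
Proof. exact: big_cat. Qed.

Lemma sepfamily_cat x y z s s' : x <= z -> z <= y ->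
  sepfamily x z s -> sepfamily z y s' -> sepfamily x y (s ++ s').
Proof.
move=> xz zy hs hs'.
have /andP[sa sp] := sepfamilyW _ _ _ _ _ (lexx x) zy hs.
have /andP[sa' sp'] := sepfamilyW _ _ _ _ _ xz (lexx y) hs'.
rewrite /sepfamily all_cat sa sa' pairwise_cat sp sp' !andbT /=.
apply/allrelP => p q ps qs.
have /andP[/allP/(_ _ ps)/and3P[_ _ p2 _]] := hs.
have /andP[/allP/(_ _ qs)/and3P[q1 _ _ _]] := hs'.
by rewrite /separated (le_trans p2 q1).
Qed.

Lemma total_length_le x y s : x <= y -> sepfamily x y s ->
  total_length s <= y - x.
Proof.
have [n sn] := ubnP (size s); elim: n s x y sn => // n IH [|p s] x y.
  by move=> _ xy _; rewrite /total_length big_nil subr_ge0.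
rewrite /= ltnS => sn xy /andP[/= /andP[/and3P[xp p12 py] sa] /andP[psep sp]].
rewrite /total_length big_cons.
rewrite (bigID (fun q : R * R => q.2 <= p.1))/=.
have hl : \sum_(q <- s | q.2 <= p.1) (q.2 - q.1) <= p.1 - x.
  rewrite -big_filter; apply: (IH [seq q <- s | q.2 <= p.1]) => //.
    by rewrite (leq_ltn_trans _ sn)// size_filter count_size.
  rewrite /sepfamily pairwise_filter// andbT; apply/allP => q.
  rewrite mem_filter => /andP[qp /(allP sa)/and3P[? ? ?]].
  exact/and3P.
have hr : \sum_(q <- s | ~~ (q.2 <= p.1)) (q.2 - q.1) <= y - p.2.
  rewrite -big_filter; apply: (IH [seq q <- s | ~~ (q.2 <= p.1)]) => //.
    by rewrite (leq_ltn_trans _ sn)// size_filter count_size.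
  rewrite /sepfamily pairwise_filter// andbT; apply/allP => q.
  rewrite mem_filter => /andP[qp qs]; have /and3P[? ? ?] := allP sa _ qs.
  have /orP[h|h] := allP psep _ qs; last by rewrite h in qp.
  exact/and3P.
lra.
Qed.

(** Merging overlapping intervals of a finite family does not increase the
    total length; this replaces a finite cover by a separated one. *)
Lemma separated_insert s p : p.1 <= p.2 -> all (fun q => q.1 <= q.2) s ->
  pairwise separated s ->
  exists s', [/\ all (fun q => q.1 <= q.2) s', pairwise separated s',
    forall q, q \in p :: s -> exists2 q', q' \in s' & q'.1 <= q.1 /\ q.2 <= q'.2 &
    total_length s' <= p.2 - p.1 + total_length s].
Proof.
have [n sn] := ubnP (size s); elim: n s p sn => // n IH s p.
rewrite ltnS => sn p12 sa sp.
have [/allP h|/allPn[q qs qp]] := boolP (all (separated p) s).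
  exists (p :: s); split => //=.
  - by rewrite p12.
  - by rewrite sp andbT; apply/allP.
  - by move=> q qs; exists q.
  - by rewrite /total_length big_cons.
have q12 : q.1 <= q.2 by exact: (allP sa).
have [s1 [s2 se]] : exists s1 s2, s = s1 ++ q :: s2.
  by case/splitPr: qs => s1 s2; exists s1, s2.
pose p' := (Num.min p.1 q.1, Num.max p.2 q.2).
have subs : subseq (s1 ++ s2) s.
  by rewrite se cat_subseq// subseq_cons.
have [||||s' [sa' sp' scov slen]] := IH (s1 ++ s2) p'.
- by rewrite (leq_trans _ sn)// se !size_cat/= addnS.
- by rewrite /p'/= ge_min le_max p12.
- by apply/allP => r rs; apply: (allP sa); exact: (mem_subseq subs).
- exact: subseq_pairwise subs sp.
exists s'; split => //.
  move=> r; have [q' q's' [/= q'1 q'2]] := scov p' (mem_head _ _).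
  rewrite inE se mem_cat inE => /orP[/eqP ->|/or3P[rs|/eqP ->|rs]].
  - by exists q' => //; move: q'1 q'2; rewrite le_min ge_max => /andP[-> _] /andP[->].
  - by apply: scov; rewrite inE mem_cat rs orbT.
  - by exists q' => //; move: q'1 q'2; rewrite le_min ge_max => /andP[_ ->] /andP[_ ->].
  - by apply: scov; rewrite inE mem_cat rs !orbT.
rewrite (le_trans slen)// se !total_length_cat /total_length big_cons /=.
move: qp; rewrite /separated negb_or -!ltNge => /andP[pq qp].
by case: (leP p.1 q.1); case: (leP p.2 q.2); lra.
Qed.

Lemma separated_cover s : all (fun q => q.1 <= q.2) s ->
  exists s', [/\ all (fun q => q.1 <= q.2) s', pairwise separated s',
    forall q, q \in s -> exists2 q', q' \in s' & q'.1 <= q.1 /\ q.2 <= q'.2 &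
    total_length s' <= total_length s].
Proof.
elim: s => [|p s IH] /=; first by move=> _; exists [::].
move=> /andP[p12 /IH[s1 [s1a s1p s1c s1l]]].
have [s2 [s2a s2p s2c s2l]] := separated_insert _ _ p12 s1a s1p.
exists s2; split => //.
  move=> q; rewrite inE => /orP[/eqP ->|/s1c[q' q's [q1 q2]]].
    by apply: s2c; rewrite inE eqxx.
  have [|q'' q''s [q1' q2']] := s2c q'; first by rewrite inE q's orbT.
  by exists q'' => //; rewrite (le_trans q1')// (le_trans q2).
by rewrite (le_trans s2l)// /total_length [leRHS]big_cons lerD2l.
Qed.

End variation.

Section variation_of_absolutely_continuous.
Context {R : realType} {a b : R} {g : R -> R} (ab : a <= b).
Hypothesis acg : absolutely_continuous a b g.

Lemma absolutely_continuous_family (e : R) : 0 < e -> exists2 d : R, 0 < d &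
  forall s, sepfamily a b s -> total_length s < d -> variation_on g s < e.
Proof.
move=> /acg[d d0 h]; exists d => // s /andP[/allP sa sp].
pose l (i : 'I_(size s)) := (nth (a, a) s i).1.
pose r (i : 'I_(size s)) := (nth (a, a) s i).2.
rewrite /total_length /variation_on !(big_nth (a, a)) !big_mkord.
apply: (h _ l r) => [i|].
  by have /sa/and3P[] := mem_nth (a, a) (ltn_ord i).
apply/trivIsetP => i j _ _ ij; apply/seteqP; split => // x.
wlog ij' : i j ij / (i < j)%N.
  move=> wh; have := ij; rewrite neq_lt => /orP[/wh|/wh H [? ?]]; first exact.
  by apply: H => //; rewrite eq_sym.
move/(pairwiseP (a, a))/(_ i j (ltn_ord i) (ltn_ord j) ij'): sp.
move=> /orP[h1|h1] /= []; rewrite /= !in_itv/= /l /r => /andP[? ?] /andP[? ?]; lra.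
Qed.

(** Absolute continuity bounds the variation by 1 on intervals shorter than
    some d, and finitely many of them fill [a, b]. *)
Lemma variation_on_bounded : exists K, forall s, sepfamily a b s ->
  variation_on g s <= K.
Proof.
have [d d0 hd] := absolutely_continuous_family _ (ltr01).
have [n hn] : exists n : nat, b <= a + n%:R * (d / 2).
  exists (Num.bound ((b - a) / (d / 2))); rewrite -lerBlDl -ler_pdivrMr ?divr_gt0//.
  by rewrite ltW// archi_boundP// divr_ge0 ?subr_ge0// ltW// divr_gt0.
suff : forall n x, a <= x -> x <= b -> x <= a + n%:R * (d / 2) ->
    forall s, sepfamily a x s -> variation_on g s <= n%:R.
  by move=> /(_ n b ab (lexx b) hn) h; exists n%:R.
elim=> [|m IH] x ax xb xm s ss.
  have xa : x = a by lra.
  subst x; have /andP[/allP sa _] := ss.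
  rewrite /variation_on big_seq big1// => p /sa/and3P[h1 h2 h3].
  by have -> : p.1 = p.2; [lra|rewrite subrr normr0].
pose x' := Num.max a (x - d / 2).
have ax' : a <= x' by rewrite le_max lexx.
have x'x : x' <= x by rewrite ge_max ax/=; lra.
have [s1 s2 /(_ g) sv] := sepfamily_cut _ _ _ _ ax' x'x ss.
rewrite (le_trans sv)// -natr1 lerD//.
  apply: (IH x') => //; first exact: le_trans xb.
  rewrite ge_max; apply/andP; split.
    by rewrite lerDl mulr_ge0// divr_ge0// ltW.
  by move: xm; rewrite -natr1; lra.
apply/ltW/hd; first exact: sepfamilyW s2.
apply: (le_lt_trans (total_length_le _ _ _ x'x s2)).
have : x - d / 2 <= x' by rewrite le_max lexx orbT.
lra.
Qed.

Lemma variation_ub x y s : a <= x -> y <= b -> sepfamily x y s ->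
  variation_on g s <= variation g x y.
Proof.
move=> ax yb ss; apply: ub_le_sup; last by exists s.
have [K hK] := variation_on_bounded.
by exists K => _ [s' /= s's <-]; apply: hK; exact: sepfamilyW s's.
Qed.

Lemma variation_approx x y (e : R) : a <= x -> y <= b -> 0 < e ->
  exists2 s, sepfamily x y s & variation g x y - e < variation_on g s.
Proof.
move=> ax yb e0.
have hs : has_sup [set variation_on g s | s in [set s | sepfamily x y s]].
  split; first by exists (variation_on g [::]), [::].
  have [K hK] := variation_on_bounded.
  by exists K => _ [s' /= s's <-]; apply: hK; exact: sepfamilyW s's.
by have [_ [s ss <-]] := sup_adherent e0 hs; exists s.
Qed.

Lemma variation_ge0 x y : a <= x -> y <= b -> 0 <= variation g x y.
Proof.
move=> ax yb; have := variation_ub x y [::] ax yb (sepfamily_nil _ _).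
by rewrite /variation_on big_nil.
Qed.

Lemma variation_increment x y : a <= x -> x <= y -> y <= b ->
  `|g y - g x| <= variation g x y.
Proof.
move=> ax xy yb; have := variation_ub x y [:: (x, y)] ax yb.
by rewrite /variation_on big_seq1; apply; rewrite /sepfamily/= /nested_in/= xy !lexx.
Qed.

Lemma variationD x y z : a <= x -> x <= y -> y <= z -> z <= b ->
  variation g x z = variation g x y + variation g y z.
Proof.
move=> ax xy yz zb; have yb := le_trans yz zb; have ay := le_trans ax xy.
apply/eqP; rewrite eq_le; apply/andP; split; apply/ler_addgt0Pl => e e0.
  have [s ss hs] := variation_approx _ _ _ ax zb e0.
  have [s1 s2 /(_ g) sv] := sepfamily_cut _ _ _ _ xy yz ss.
  have := variation_ub _ _ _ ax yb s1; have := variation_ub _ _ _ ay zb s2; lra.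
have e2 : 0 < e / 2 by rewrite divr_gt0.
have [s1 ss1 hs1] := variation_approx _ _ _ ax yb e2.
have [s2 ss2 hs2] := variation_approx _ _ _ ay zb e2.
have := variation_ub _ _ _ ax zb (sepfamily_cat _ _ _ _ _ xy yz ss1 ss2).
rewrite variation_on_cat; lra.
Qed.

(** The variation is itself absolutely continuous: refining each interval of a
    separated family gives a separated family that is not longer. *)
Lemma variation_absolutely_continuous (e : R) : 0 < e -> exists2 d : R, 0 < d &
  forall s, sepfamily a b s -> total_length s < d ->
    \sum_(p <- s) variation g p.1 p.2 <= e.
Proof.
move=> /absolutely_continuous_family[d d0 hd]; exists d => // s ss sd.
suff : forall eta : R, 0 < eta -> exists s', [/\ sepfamily a b s',
    forall q, q \in s' -> exists2 p, p \in s & p.1 <= q.1 /\ q.2 <= p.2,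
    total_length s' <= total_length s &
    \sum_(p <- s) variation g p.1 p.2 <= variation_on g s' + eta].
  move=> h; apply/ler_addgt0Pr => eta /h[s' [s's _ s'l s'v]].
  apply: (le_trans s'v); rewrite lerD2r ltW//; apply: hd => //.
  exact: le_lt_trans sd.
elim: s ss {sd} => [|p s IH] ss eta eta0.
  by exists [::]; split; rewrite ?big_nil /variation_on ?big_nil ?add0r// ltW.
have /andP[/= /andP[pw sa] /andP[psep sp]] := ss.
have eta2 : 0 < eta / 2 by rewrite divr_gt0.
have [|s1 [s1s s1c s1l s1v]] := IH _ _ eta2; first by rewrite /sepfamily sa sp.
have /and3P[p1 p12 p2] := pw.
have [s2 s2s s2v] := variation_approx _ _ _ p1 p2 eta2.
exists (s2 ++ s1); split.
- have /andP[s2a s2p] := sepfamilyW _ _ _ _ _ p1 p2 s2s.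
  have /andP[s1a s1p] := s1s.
  rewrite /sepfamily all_cat s2a s1a pairwise_cat s2p s1p !andbT/=.
  apply/allrelP => q q' /= qs q's.
  have /andP[/allP/(_ _ qs)/and3P[q1 _ q2] _] := s2s.
  have [r rs [r1 r2]] := s1c _ q's.
  have /orP[h|h] := allP psep _ rs; apply/orP; [left|right]; lra.
- move=> q; rewrite mem_cat => /orP[qs|/s1c[r rs r12]].
    exists p; first exact: mem_head.
    by have /andP[/allP/(_ _ qs)/and3P[]] := s2s.
  by exists r => //; rewrite inE rs orbT.
- rewrite total_length_cat [leRHS]big_cons lerD//.
  exact: total_length_le.
- rewrite big_cons variation_on_cat; lra.
Qed.

End variation_of_absolutely_continuous.

(** * Densities of absolutely continuous monotone functions *)

Section clamp.
Context {R : realType} {a b : R} (ab : a <= b).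

(** Functions of interest are known on a segment only. Composition with clamp
    extends them by constants, which turns properties on the segment into
    global ones. *)
Definition clamp (x : R) : R := Num.max a (Num.min x b).

Lemma clamp_in x : a <= clamp x <= b.
Proof. by rewrite /clamp le_max lexx/= ge_max ab/= ge_min lexx orbT. Qed.

Lemma clamp_le x y : x <= y -> clamp x <= clamp y.
Proof.
move=> xy; rewrite /clamp ge_max le_max lexx/= le_max; apply/orP; right.
by rewrite le_min !ge_min xy lexx orbT.
Qed.

Lemma clamp_lip x y : x <= y -> clamp y - clamp x <= y - x.
Proof.
move=> xy; rewrite lerBlDr ge_max.
have h1 : a <= clamp x by rewrite le_max lexx.
have h2 : Num.min x b <= clamp x by rewrite le_max lexx orbT.
have h3 : Num.min y b <= y by rewrite ge_min lexx.
have h4 : Num.min y b <= b by rewrite ge_min lexx orbT.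
by apply/andP; split; [lra|move: h2; case: (leP x b) => ? ?; lra].
Qed.

Lemma clamp_id x : a <= x -> x <= b -> clamp x = x.
Proof. by move=> ax xb; rewrite /clamp (min_l xb) max_r. Qed.

End clamp.
Arguments clamp {R} a b x.

Section stieltjes_density.
Context {R : realType}.
Notation mu := (@lebesgue_measure R).

Lemma stieltjes_cover (H : cumulative R R) (s : seq (R * R)) (A : set R) :
  measurable A -> all (fun p => p.1 <= p.2) s ->
  (forall x, A x -> exists2 p, p \in s & p.1 < x <= p.2) ->
  (lebesgue_stieltjes_measure H A <= (\sum_(p <- s) (H p.2 - H p.1))%:E)%E.
Proof.
elim: s A => [|p s IH] A mA /=.
  move=> _ h; rewrite big_nil (_ : A = set0) ?measure0//.
  by apply/seteqP; split => // x /h[].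
move=> /andP[p12 sa] h; rewrite big_cons EFinD.
have mp : measurable (`]p.1, p.2]%classic : set R) by exact: measurable_itv.
rewrite -(setUIDK A `]p.1, p.2]%classic).
have U2 := @measureU2 _ (measurableTypeR R) R (lebesgue_stieltjes_measure H)
  _ _ (measurableI _ _ mA mp) (measurableD mA mp).
apply: (le_trans U2) => {U2}.
rewrite leeD//.
  rewrite (@le_trans _ _ (lebesgue_stieltjes_measure H `]p.1, p.2]%classic))//.
    by rewrite le_measure// ?inE//; exact: measurableI.
  rewrite /lebesgue_stieltjes_measure /measure_extension measurable_mu_extE/=; last exact: is_ocitv.
  by rewrite wlength_itv_bnd.
apply: IH => //; first exact: measurableD.
move=> x [/h[q]]; rewrite inE => /orP[/eqP ->|qs] qx; last by exists q.
by move=> []; rewrite /= in_itv.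
Qed.

Lemma stieltjes_ocitv (H : cumulative R R) (x y : R) : x <= y ->
  lebesgue_stieltjes_measure H `]x, y]%classic = (H y - H x)%:E.
Proof.
move=> xy.
rewrite /lebesgue_stieltjes_measure /measure_extension measurable_mu_extE/=; last exact: is_ocitv.
by rewrite wlength_itv_bnd.
Qed.

Context {a b : R} {h : R -> R} (ab : a <= b).
Hypothesis h_nd : forall x y, a <= x -> x <= y -> y <= b -> h x <= h y.
Hypothesis h_ac : forall e : R, 0 < e -> exists2 d : R, 0 < d &
  forall s, sepfamily a b s -> total_length s < d ->
    \sum_(p <- s) (h p.2 - h p.1) <= e.

Let H x := h (clamp a b x).

Let H_nd : nondecreasing H.
Proof.
move=> x y xy; have /andP[? ?] := clamp_in ab x; have /andP[? ?] := clamp_in ab y.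
by apply: h_nd => //; exact: clamp_le.
Qed.

Let H_ac (e : R) : 0 < e -> exists2 d : R, 0 < d &
  forall s, all (fun p => p.1 <= p.2) s -> pairwise separated s ->
    total_length s < d -> \sum_(p <- s) (H p.2 - H p.1) <= e.
Proof.
move=> /h_ac[d d0 hd]; exists d => // s /allP sa sp sl.
have := hd [seq (clamp a b p.1, clamp a b p.2) | p <- s].
rewrite /total_length !big_map /=; apply.
  rewrite /sepfamily all_map pairwise_map; apply/andP; split.
    apply/allP => p /sa p12; have /andP[? _] := clamp_in ab p.1.
    by have /andP[_ ?] := clamp_in ab p.2; apply/and3P; split => //; exact: clamp_le.
  apply: sub_pairwise sp => p q /orP[hh|hh]; apply/orP; [left|right];
    exact: clamp_le.
apply: le_lt_trans sl; rewrite big_seq [leRHS]big_seq; apply: ler_sum => p /sa.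
exact: clamp_lip.
Qed.

Let H_rc : right_continuous H.
Proof.
move=> x; apply/cvgrPdist_le => e /H_ac[d d0 hd].
near=> y.
have xy : x <= y by near: y; exact: nbhs_right_ge.
have yd : y - x < d by rewrite ltrBlDl; near: y; apply: nbhs_right_lt; rewrite ltrDl.
rewrite distrC ger0_norm ?subr_ge0; last exact: H_nd.
have := hd [:: (x, y)]; rewrite /total_length !big_seq1/= xy.
by apply.
Unshelve. all: by end_near. Qed.

Let cH : cumulative R R := HB.pack H (isCumulative.Build R _ R H H_nd H_rc).

Let nu0 := lebesgue_stieltjes_measure cH.

Let mab : measurable (`]a, b]%classic : set R).
Proof. exact: measurable_itv. Qed.

Let nu0_fin : (nu0 `]a, b]%classic < +oo)%E.
Proof. by rewrite /nu0 stieltjes_ocitv// ltry. Qed.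

Let nu : {finite_measure set (measurableTypeR R) -> \bar R} :=
  @mfrestr _ (measurableTypeR R) R _ nu0 mab nu0_fin.

(** Lebesgue measure and the Stieltjes measure extend two interval functions
    from the same semiring, so a cover by short intervals serves for both. *)
Let nu_dominated : nu `<< mu.
Proof.
apply/null_content_dominatesP => A mA A0.
apply/eqP; rewrite eq_le measure_ge0 andbT; apply/lee_addgt0Pr => e e0.
rewrite add0e; have [d d0 hd] := H_ac _ e0.
(* A has a cover by intervals F k of total length less than d *)
have : (mu A < d%:E)%E by rewrite [X in (X < _)%E]A0 lte_fin.
move=> /ereal_inf_lt[_ [F [mF AF] <-] Fd].
have /choice[lr hlr] : forall k, exists p : R * R, p.1 <= p.2 /\ F k = `]p.1, p.2]%classic.
  move=> k; have /ocitvP[->|[p p12 ->]] := mF k; last by exists p; split; [exact: ltW|].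
  by exists (0, 0); split => //; rewrite set_itvoc0.
have Fk0 k : (0 <= wlength idfun (F k))%E.
  by have [h1 h2] := hlr k; rewrite h2 wlength_itv_bnd// lee_fin subr_ge0.
pose G n := \big[setU/set0]_(k < n) F k.
have mF' k : measurable (F k : set R) by have [_ ->] := hlr k; exact: measurable_itv.
have mG n : measurable (G n : set R) by exact: bigsetU_measurable.
have mUF : measurable (\bigcup_k F k : set R) by exact: bigcup_measurable.
have GU : \bigcup_n G n = \bigcup_k F k.
  apply/seteqP; split => x [n _].
    by rewrite /G -bigcup_mkord => -[k _ Fkx]; exists k.
  by move=> Fnx; exists n.+1 => //; rewrite /G -bigcup_mkord; exists n => //=.
(* the F k may overlap, whereas absolute continuity needs a separated family *)
have nuG n : (nu0 (G n) <= e%:E)%E.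
  pose s := [seq lr k | k <- iota 0 n].
  have sa : all (fun q : R * R => q.1 <= q.2) s.
    by apply/allP => q /mapP[k _ ->]; have [] := hlr k.
  have [s' [s'a s's s'c s'l]] := separated_cover _ sa.
  apply: (@le_trans _ _ (\sum_(p <- s') (cH p.2 - cH p.1))%:E).
    apply: (stieltjes_cover cH s' (G n) (mG n) s'a) => x.
     rewrite /G -bigcup_mkord => -[k /= kn]; have [_ ->] := hlr k.
    rewrite /= in_itv/= => /andP[x1 x2].
    have [|q q1 [q2 q3]] := s'c (lr k).
      by apply/mapP; exists k => //; rewrite mem_iota.
    by exists q => //; rewrite (le_lt_trans q2)// (le_trans x2).
  rewrite lee_fin; apply: hd => //; apply: (le_lt_trans s'l).
  rewrite -lte_fin; apply: le_lt_trans Fd.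
  apply: (@le_trans _ _ (\sum_(0 <= k < n) wlength idfun (F k))%E); last first.
    exact: nneseries_lim_ge.
  rewrite /total_length big_map -/(index_iota 0 n) -sumEFin /index_iota subn0.
  rewrite le_eqVlt; apply/orP; left; apply/eqP.
  apply: eq_bigr => k _.
  by have [h1 {1}->] := hlr k; rewrite wlength_itv_bnd.
have : (nu0 (\bigcup_k F k) <= e%:E)%E.
  have := @nondecreasing_cvg_mu _ _ _ nu0 G mG; rewrite GU => /(_ mUF) hc.
  have {}hc : nu0 \o G @ \oo --> nu0 (\bigcup_k F k).
    apply: hc => m n mn; apply/subsetPset => x.
    rewrite /G -!bigcup_mkord => -[k /= km Fkx]; exists k => //=.
    exact: leq_trans mn.
  rewrite -(cvg_lim _ hc)//; apply: lime_le; first by apply/cvg_ex; eexists; exact: hc.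
  exact: nearW.
apply: le_trans; apply: le_measure; rewrite ?inE//.
  exact: measurableI.
by move=> x [/AF].
Qed.

(** By domination the Stieltjes measure of h has a Radon-Nikodym derivative. *)
Lemma monotone_density : exists f : R -> R,
  mu.-integrable setT (EFin \o f) /\
  forall x, a <= x -> x <= b -> h x - h a = \int[mu]_(t in `[a, x]) f t.
Proof.
have [f [f0 ffin fint fE]] := radon_nikodym_sigma_finite nu_dominated.
pose f' : R -> R := fun x => fine (f x).
have fEF : f = EFin \o f' by apply/funext => x /=; rewrite fineK.
have fi : mu.-integrable (setT : set R) (EFin \o f') by rewrite -fEF.
have mf' : measurable_fun (setT : set R) f' by move/integrableP: fi => [/measurable_EFinP].
exists f'; split => //.
move=> x ax xb.
have := fE `]a, x]%classic (measurable_itv _).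
rewrite /nu/= /mfrestr /mrestr.
have -> : `]a, x]%classic `&` `]a, b]%classic = `]a, x]%classic :> set R.
  apply/seteqP; split => [y []//|y]; rewrite /= !in_itv/= => /andP[-> h2].
  by rewrite h2 (le_trans h2).
rewrite /nu0 stieltjes_ocitv//= /H !clamp_id// => hh.
rewrite -Rintegral_itv_obnd_cbnd; last first.
  exact: (integrableS measurableT).
rewrite /Rintegral -[LHS]/(fine (h x - h a)%:E) hh; congr fine.
by apply: eq_integral => t _ /=; rewrite fineK.
Qed.

End stieltjes_density.

(** * Absolutely continuous functions as integrals of their derivatives *)

Section derivative_of_absolutely_continuous.
Context {R : realType}.
Notation mu := (@lebesgue_measure R).

(** Radon-Nikodym densities of the variation of g and of the variation minus g,
    both nondecreasing, represent g as an indefinite integral. *)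
Lemma absolutely_continuous_density (a b : R) (g : R -> R) : a <= b ->
  absolutely_continuous a b g ->
  exists f : R -> R, mu.-integrable setT (EFin \o f) /\
  forall x, a <= x -> x <= b -> g x - g a = \int[mu]_(t in `[a, x]) f t.
Proof.
move=> ab acg.
pose W x := variation g a x.
have Winc x y : a <= x -> x <= y -> y <= b -> W y - W x = variation g x y.
  by move=> ax xy yb; rewrite /W (variationD ab acg _ _ _ (lexx a) ax xy yb) [X in X - _]addrC addrK.
have dW (h : R -> R) :
    (forall x y, a <= x -> x <= y -> y <= b -> 0 <= h y - h x <= 2 * variation g x y) ->
    exists f : R -> R, mu.-integrable setT (EFin \o f) /\
      forall x, a <= x -> x <= b -> h x - h a = \int[mu]_(t in `[a, x]) f t.
  move=> hh; apply: (monotone_density ab).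
    by move=> x y ax xy yb; rewrite -subr_ge0; have /andP[] := hh _ _ ax xy yb.
  move=> e e0; have e2 : 0 < e / 2 by rewrite divr_gt0.
  have [d d0 hd] := variation_absolutely_continuous ab acg _ e2.
  exists d => // s ss /(hd _ ss) hs.
  apply: (@le_trans _ _ (\sum_(p <- s) 2 * variation g p.1 p.2)); last first.
    by rewrite -mulr_sumr; lra.
  rewrite big_seq [leRHS]big_seq; apply: ler_sum => p ps.
  have /andP[/allP/(_ _ ps)/and3P[p1 p12 p2] _] := ss.
  by have /andP[] := hh _ _ p1 p12 p2.
have [|f1 [f1i f1E]] := dW W.
  move=> x y ax xy yb; rewrite Winc//.
  by have := variation_ge0 ab acg _ _ ax yb; lra.
have [|f2 [f2i f2E]] := dW (fun x => W x - g x).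
  move=> x y ax xy yb.
  have := variation_increment ab acg _ _ ax xy yb; have := Winc _ _ ax xy yb.
  by rewrite ler_norml => ? /andP[? ?]; apply/andP; split; lra.
exists (fun x => f1 x - f2 x); split.
  have := integrableB measurableT f1i f2i.
  by under eq_fun do rewrite -EFinB.
move=> x ax xb.
have mx : measurable (`[a, x]%classic : set R) by exact: measurable_itv.
rewrite RintegralB//; [|exact: (integrableS measurableT)..].
have := f1E _ ax xb; have := f2E _ ax xb; lra.
Qed.

(** The density is the derivative almost everywhere by the Lebesgue
    differentiation theorem. *)
Lemma absolutely_continuous_derive (a b : R) (g : R -> R) : a <= b ->
  absolutely_continuous a b g ->
  exists f : R -> R, [/\ mu.-integrable setT (EFin \o f),
    forall x y, a <= x -> x <= y -> y <= b ->
      g y - g x = \int[mu]_(t in `[x, y]) f t &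
    {ae mu, forall x, x \in `]a, b[ -> derive1 g x = f x}].
Proof.
move=> ab acg; have [f [fi fE]] := absolutely_continuous_density _ _ _ ab acg.
have fi' (A : set R) : measurable A -> mu.-integrable A (EFin \o f).
  by move=> mA; exact: (integrableS measurableT).
exists f; split => //.
  move=> x y ax xy yb; have -> : g y - g x = (g y - g a) - (g x - g a) by ring.
  rewrite (fE y)// ?(le_trans ax)//.
  rewrite (fE x)// ?(le_trans xy)//.
  rewrite -(@Rintegral_itv_obnd_cbnd _ x); last by apply: fi'; exact: measurable_itv.
  apply: (@Rintegral_itvB _ f (BLeft a) (BRight y) x).
  - by apply: fi'; exact: measurable_itv.
  - by rewrite bnd_simp.
  - by rewrite bnd_simp.
have := lebesgue_differentiation (open_integrable_locally openT fi).
apply: filterS; first exact: (ae_filter_ringOfSetsType mu).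
move=> x xf; rewrite in_itv/= => /andP[ax xb].
pose F y := \int[mu]_(t in `[a, y]) f t.
have [dF <-] := @FTC1_lebesgue_pt _ f (BLeft a) x b xb (fi' _ (measurable_itv _)) ax xf.
rewrite !derive1E; transitivity ('D_1 (F + cst (g a)) x).
  apply: near_eq_derive.
  near=> y; rewrite /GRing.add/= /F -fE ?subrK//; apply/ltW; near: y.
    exact: lt_nbhsr.
  exact: lt_nbhsl.
by rewrite deriveD ?derive_cst ?addr0//; exact: derivable_cst.
Unshelve. all: by end_near. Qed.

End derivative_of_absolutely_continuous.

(** * Kinetic energy *)

Section energy.
Context {R : realType}.
Notation mu := (@lebesgue_measure R).

(** The integral of a nonnegative function is a supremum over simple functions
    below it, hence monotone even if the larger function is not measurable. *)
Lemma ge0_le_integral_nonmeasurable (D : set R) (f1 f2 : R -> \bar R) :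
  (forall x, D x -> 0 <= f1 x)%E -> (forall x, D x -> f1 x <= f2 x)%E ->
  (\int[mu]_(x in D) f1 x <= \int[mu]_(x in D) f2 x)%E.
Proof.
move=> f10 f12; rewrite integral_mkcond [leRHS]integral_mkcond.
have g1 x : (0 <= (f1 \_ D) x)%E by apply: erestrict_ge0.
have g12 x : ((f1 \_ D) x <= (f2 \_ D) x)%E.
  by rewrite !patchE; case: ifPn => // /set_mem; exact: f12.
rewrite !ge0_integralTE//; last by move=> x; exact: le_trans (g12 x).
apply: le_ereal_sup => _ /= [h hf <-]; exists h => // x.
exact: le_trans (g12 x).
Qed.

Lemma absolutely_continuous_modulus (a b : R) (g : R -> R) (e : R) :
  absolutely_continuous a b g -> 0 < e -> exists2 d : R, 0 < d &
  forall x y, a <= x -> x <= y -> y <= b -> y - x < d -> `|g y - g x| < e.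
Proof.
move=> acg /(absolutely_continuous_family acg)[d d0 hd]; exists d => // x y ax xy yb yx.
have := hd [:: (x, y)]; rewrite /total_length /variation_on !big_seq1; apply => //.
by rewrite /sepfamily/= /nested_in/= ax xy yb.
Qed.

Lemma absolutely_continuous_continuous (a b : R) (g : R -> R) : a <= b ->
  absolutely_continuous a b g ->
  continuous (fun x => g (clamp a b x)).
Proof.
move=> ab acg x; apply/cvgrPdist_lt => e /(absolutely_continuous_modulus _ _ _ _ acg)[d d0 hd].
have key y z : y <= z -> z - y < d -> `|g (clamp a b z) - g (clamp a b y)| < e.
  move=> yz yzd; have /andP[h1 h2] := clamp_in ab y; have /andP[h3 h4] := clamp_in ab z.
  apply: hd => //; first exact: clamp_le.
  exact: le_lt_trans (clamp_lip _ _ yz) _.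
near=> y.
have yx : `|x - y| < d by near: y; apply: cvgr_dist_lt.
have [xy|/ltW xy] := leP x y.
  by rewrite distrC; apply: key => //; move: yx; rewrite distrC ger0_norm// subr_ge0.
by apply: key => //; move: yx; rewrite ger0_norm// subr_ge0.
Unshelve. all: by end_near. Qed.

Lemma itv_bounded_integrable (f : R -> R) (x y C : R) :
  measurable_fun `[x, y] f -> (forall t, x <= t <= y -> `|f t| <= C) ->
  mu.-integrable `[x, y] (EFin \o f).
Proof.
move=> mf fC; apply: measurable_bounded_integrable => //.
  by rewrite /= lebesgue_measure_itv/=; case: ifP; rewrite ?ltry.
exists C; split; first exact: num_real.
by move=> M CM t; rewrite /= in_itv/= => /fC h; exact: le_trans (ltW CM).
Qed.

(** Cauchy-Schwarz on [x, y], in the form obtained by integrating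
    0 <= (f - c)^2 for the mean value c of f. *)
Lemma square_integral_ge (f : R -> R) (x y : R) : x < y ->
  mu.-integrable `[x, y] (EFin \o f) ->
  (((\int[mu]_(t in `[x, y]) f t) ^+ 2 / (y - x))%:E <=
    \int[mu]_(t in `[x, y]) (f t ^+ 2)%:E)%E.
Proof.
move=> xy fi.
have mD : measurable (`[x, y]%classic : set (measurableTypeR R)) by exact: measurable_itv.
have mf : measurable_fun `[x, y] f by case/integrableP: fi => /measurable_EFinP.
have mf2 : measurable_fun `[x, y] (fun t => (f t ^+ 2)%:E).
  exact/measurable_EFinP/measurable_funX.
have [foo|fy] := ltP (\int[mu]_(t in `[x, y]) (f t ^+ 2)%:E)%E +oo%E; last first.
  by rewrite (le_trans _ fy)// leey.
have fi2 : mu.-integrable `[x, y] (fun t => (f t ^+ 2)%:E).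
  apply/integrableP; split => //; under eq_integral do rewrite gee0_abs ?lee_fin ?sqr_ge0//.
  exact: foo.
have ci (c : R) : mu.-integrable `[x, y] (fun t : R => c%:E).
  by apply: (itv_bounded_integrable (cst c) _ _ `|c|).
set I := \int[mu]_(t in `[x, y]) f t; pose c := I / (y - x).
have -> : I ^+ 2 / (y - x) = 2 * c * I - c ^+ 2 * (y - x).
  by rewrite /c; field; rewrite gt_eqF// subr_gt0.
have fci : mu.-integrable `[x, y] (EFin \o (fun t => 2 * c * f t)).
  have := integrableZl mD (2 * c) fi.
  by apply: eq_integrable => // t _ /=; rewrite EFinM.
have i2 : mu.-integrable `[x, y] (EFin \o (fun t => c ^+ 2)) by exact: ci.
have i3 : mu.-integrable `[x, y] (EFin \o (fun t => 2 * c * f t - c ^+ 2)).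
  by have := integrableB mD fci i2; apply: eq_integrable.
have -> : 2 * c * I - c ^+ 2 * (y - x) = \int[mu]_(t in `[x, y]) (2 * c * f t - c ^+ 2).
  rewrite RintegralB// RintegralZl// Rintegral_cst//= lebesgue_measure_itv/= lte_fin xy.
  by rewrite -EFinD.
rewrite /Rintegral fineK; last exact: integrable_fin_num.
apply: le_integral => //.
by move=> t _; rewrite lee_fin -subr_ge0 (_ : _ - _ = (f t - c) ^+ 2) ?sqr_ge0//; ring.
Qed.

(** Either the energy K is infinite, or it dominates an additive function E of
    intervals that obeys the Cauchy-Schwarz bound wherever g is positive. E is
    the integral of a measurable function, whereas the integrand of K is only
    known to agree with one almost everywhere. *)
Lemma kinetic_energy (a b : R) (g : R -> R) : a <= b ->
  absolutely_continuous a b g ->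
  let K := (\int[mu]_(s in `[a, b])
          (derive1 g s ^+ 2 * \1_[set r | (0 < g r)%R] s)%:E)%E in
  K = +oo%E \/ exists E : R -> R -> R, [/\ ((E a b)%:E <= K)%E,
    forall x y, a <= x -> x <= y -> y <= b -> 0 <= E x y,
    forall x y z, a <= x -> x <= y -> y <= z -> z <= b -> E x z = E x y + E y z &
    forall x y, a <= x -> x < y -> y <= b -> (forall s, x < s < y -> 0 < g s) ->
      (g y - g x) ^+ 2 / (y - x) <= E x y].
Proof.
move=> ab acg K.
have [Koo|] := ltP K +oo%E; last by rewrite leye_eq => /eqP; left.
right.
have [f [fi fE [N [mN N0 hN]]]] := absolutely_continuous_derive _ _ _ ab acg.
have fi' (A : set R) : measurable A -> mu.-integrable A (EFin \o f).
  by move=> mA; exact: (integrableS measurableT).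
have mf : measurable_fun setT f by case/integrableP: fi => /measurable_EFinP.
pose G x := g (clamp a b x).
have cG : continuous G by exact: absolutely_continuous_continuous.
pose P := [set s | 0 < G s].
have mP : measurable P.
  have -> : P = setT `&` G @^-1` `]0, +oo[%classic.
    by apply/seteqP; split => s /=; rewrite in_itv/= ?andbT//; case.
  exact: (continuous_measurable_fun cG measurableT).
pose B := ~` N `&` `]a, b[%classic.
have mB : measurable B by apply: measurableI; [exact: measurableC|exact: measurable_itv].
(* h agrees with the integrand of K off a null set and is measurable *)
pose h s : \bar R := (f s ^+ 2 * \1_(B `&` P) s)%:E.
have h0 s : (0 <= h s)%E by rewrite lee_fin mulr_ge0// sqr_ge0.
have mh : measurable_fun setT h.
  apply/measurable_EFinP; apply: measurable_funM; first exact: measurable_funX.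
  by apply: measurable_indic; exact: measurableI.
have hK : (\int[mu]_(s in `[a, b]) h s <= K)%E.
  apply: ge0_le_integral_nonmeasurable => // s; rewrite /= in_itv/= => /andP[as_ sb].
  rewrite lee_fin !indicE; case: (boolP (s \in B `&` P)) => [|_]; last first.
    by rewrite mulr0 mulr_ge0// sqr_ge0.
  rewrite inE => -[[Ns sab] Ps]; have Gs : G s = g s by rewrite /G clamp_id.
  have -> : (s \in [set r | 0 < g r]) = true by apply/mem_set; rewrite /= -Gs.
  by rewrite !mulr1 (_ : derive1 g s = f s)//; apply: contrapT => hs; apply/Ns/hN => /(_ sab).
have hfin x y : a <= x -> y <= b -> (\int[mu]_(s in `[x, y]) h s)%E \is a fin_num.
  move=> ax yb; rewrite ge0_fin_numE; last exact: integral_ge0.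
  apply: le_lt_trans Koo; apply: le_trans hK; apply: ge0_subset_integral => //.
    exact: measurable_funTS.
  by move=> s; rewrite /= !in_itv/= => /andP[? ?]; apply/andP; split; lra.
exists (fun x y => fine (\int[mu]_(s in `[x, y]) h s)%E); split.
- by rewrite fineK// hfin.
- by move=> x y _ _ _; rewrite fine_ge0// integral_ge0.
- move=> x y z ax xy yz zb.
  rewrite -fineD ?hfin//; [|lra|lra]; congr fine.
  rewrite -(@integral_itv_obnd_cbnd _ y); last exact: measurable_funTS.
  rewrite -ge0_integral_setU//=; [|exact: measurable_funTS|]; last first.
    apply/disj_setPRL => s /=; rewrite !in_itv/= => /andP[ys _] /andP[_ sy].
    by move: ys; rewrite ltNge sy.
  by rewrite (@itv_bndbnd_setU _ _ _ (BRight y)) ?bnd_simp.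
- move=> x y ax xy yb gpos.
  rewrite (fE x y)// ?(ltW xy)// -lee_fin fineK ?hfin//.
  rewrite (le_trans (square_integral_ge _ _ _ xy (fi' _ (measurable_itv _))))//.
  apply: ae_ge0_le_integral => //.
  + by move=> s _; rewrite lee_fin sqr_ge0.
  + by apply: measurable_funTS; apply/measurable_EFinP; exact: measurable_funX.
  + exact: measurable_funTS.
  exists (N `|` [set x; y]); split.
  + by apply: measurableU => //; apply: measurableU; exact: measurable_set1.
  + have m1 (z : R) : measurable ([set z] : set (measurableTypeR R)) by exact: measurable_set1.
    have mU : measurable ([set x] `|` [set y] : set (measurableTypeR R)) by exact: measurableU.
    have U0 : mu ([set x] `|` [set y]) = 0%E.
      by transitivity (mu [set x]); [apply: (measureU0 (m1 x) (m1 y)); exact: lebesgue_measure_set1|exact: lebesgue_measure_set1].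
    by transitivity (mu N); [apply: (measureU0 mN mU)|].
  + move=> s /= hs; apply: contrapT => /not_orP[Ns /not_orP[/eqP sx /eqP sy]].
    apply: hs; rewrite in_itv/= => /andP[xs sy']; rewrite lee_fin.
    have xs' : x < s by rewrite lt_neqAle eq_sym sx.
    have sy'' : s < y by rewrite lt_neqAle sy.
    rewrite indicE mem_set ?mulr1//; split.
      by split => //; rewrite /= in_itv/=; apply/andP; split; lra.
    by rewrite /P/= /G clamp_id; [apply: gpos; rewrite xs'|lra|lra].
Qed.

End energy.

(** * Integrals of the boundary rate *)

Section inflow.
Context {R : realType}.
Notation mu := (@lebesgue_measure R).

Definition regular_boundary (phi : R -> R) : Prop :=
  measurable_fun setT phi /\ forall a b : R, [bounded phi t | t in `[a, b]].

Definition inflow_rate (phi : R -> R) (t : R) : R := phi^\+ t ^+ 2.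

(** The primitive of phi_+^2 that vanishes at 0. A path that waits at the
    boundary gains half of the increment of this primitive. *)
Definition inflow (phi : R -> R) (t : R) : R :=
  if 0 <= t then \int[mu]_(r in `[0%R, t]) inflow_rate phi r
  else - \int[mu]_(r in `[t, 0%R]) inflow_rate phi r.

Context {phi : R -> R} (rphi : regular_boundary phi).
Notation f := (inflow_rate phi).

Lemma inflow_rate_ge0 t : 0 <= f t.
Proof. exact: sqr_ge0. Qed.

Lemma measurable_inflow_rate (D : set R) : measurable_fun D f.
Proof.
apply: measurable_funTS; apply: measurable_funX.
by apply: measurable_funrpos; case: rphi.
Qed.

Lemma inflow_rate_bounded (a b : R) :
  exists2 C, 0 <= C & forall t, a <= t <= b -> f t <= C.
Proof.
have [_ /(_ a b)[M [_ hM]]] := rphi.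
have M1 : M < `|M| + 1 by rewrite (le_lt_trans (ler_norm _))// ltrDl.
exists ((`|M| + 1) ^+ 2) => [|t tab]; first exact: sqr_ge0.
have := hM _ M1 t; rewrite /= in_itv/= => /(_ tab) h.
rewrite /inflow_rate ler_sqr ?nnegrE//.
by rewrite /funrpos ge_max (le_trans (ler_norm _) h)/= (le_trans _ h).
Qed.

Lemma inflow_rate_integrable (a b : R) :
  mu.-integrable `[a, b] (EFin \o f).
Proof.
have [C C0 hC] := inflow_rate_bounded a b.
apply: (itv_bounded_integrable _ _ _ C); first exact: measurable_inflow_rate.
by move=> t tab; rewrite ger0_norm ?inflow_rate_ge0// hC.
Qed.

Let split_inflow (a b c : R) : a <= b -> b <= c ->
  \int[mu]_(r in `[a, c]) f r =
  \int[mu]_(r in `[a, b]) f r + \int[mu]_(r in `[b, c]) f r.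
Proof.
move=> ab bc.
rewrite -(@Rintegral_itv_obnd_cbnd _ b (BRight c)); last first.
  apply: (integrableS _ _ _ (inflow_rate_integrable b c)); try exact: measurable_itv.
  by apply: subset_itvr; rewrite bnd_simp.
rewrite -(@Rintegral_itvB _ f (BLeft a) (BRight c) b) ?bnd_simp//.
  by rewrite addrC subrK.
exact: inflow_rate_integrable.
Qed.

Lemma inflowB (s t : R) : s <= t ->
  \int[mu]_(r in `[s, t]) f r = inflow phi t - inflow phi s.
Proof.
move=> st; rewrite /inflow; case: (leP 0 t) => t0; case: (leP 0 s) => s0.
- by rewrite (split_inflow _ _ _ s0 st) [X in X - _]addrC addrK.
- by rewrite (split_inflow _ _ _ (ltW s0) t0) opprK addrC.
- by have := lt_le_trans t0 (le_trans s0 st); rewrite ltxx.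
- by rewrite (split_inflow _ _ _ st (ltW t0)) opprK addrC addrK.
Qed.

Lemma inflow_le (s t : R) : s <= t -> inflow phi s <= inflow phi t.
Proof.
move=> st; rewrite -subr_ge0 -inflowB// Rintegral_ge0// => r _.
exact: inflow_rate_ge0.
Qed.

Lemma inflow_lipschitz (a b : R) : exists2 C, 0 <= C &
  forall s t, a <= s -> s <= t -> t <= b ->
    inflow phi t - inflow phi s <= C * (t - s).
Proof.
have [C C0 hC] := inflow_rate_bounded a b; exists C => // s t as_ st tb.
have mst : measurable (`[s, t]%classic : set (measurableTypeR R)) by exact: measurable_itv.
have Ci : mu.-integrable `[s, t] (EFin \o cst C).
  by apply: (itv_bounded_integrable (cst C) _ _ `|C|).
rewrite -inflowB//; apply: (@le_trans _ _ (\int[mu]_(r in `[s, t]) cst C r)).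
  apply: le_Rintegral => //; first exact: inflow_rate_integrable.
  by move=> r; rewrite /= in_itv/= => /andP[? ?]; apply: hC; apply/andP; split; lra.
rewrite Rintegral_cst//= lebesgue_measure_itv/= lte_fin.
by move: st; rewrite le_eqVlt => /predU1P[->|->//]; rewrite ltxx subrr mulr0.
Qed.

Lemma inflow_continuous : continuous (inflow phi).
Proof.
move=> x; apply/cvgrPdist_lt => e e0.
have [C C0 hC] := inflow_lipschitz (x - 1) (x + 1).
near=> y.
have y1 : `|x - y| < 1 by near: y; apply: cvgr_dist_lt.
have y2 : `|x - y| < e / (C + 1).
  by near: y; apply: cvgr_dist_lt => //; rewrite divr_gt0// ltr_wpDl.
have Ce : C * `|x - y| < e.
  have : (C + 1) * `|x - y| < e by rewrite mulrC -ltr_pdivlMr// ltr_wpDl.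
  have := normr_ge0 (x - y); nra.
move: y1; rewrite ltr_norml => /andP[y1 y1'].
apply: le_lt_trans Ce; have [xy|/ltW yx] := leP x y.
  rewrite distrC [X in _ * X]distrC !ger0_norm ?subr_ge0 ?inflow_le//.
  by apply: hC; lra.
by rewrite !ger0_norm ?subr_ge0 ?inflow_le//; apply: hC; lra.
Unshelve. all: by end_near. Qed.

Section indicators.
Context {t0 t : R}.

Lemma indicE_if (S : set R) s : \1_S s = if s \in S then 1 else 0 :> R.
Proof. by rewrite indicE; case: ifP. Qed.

Lemma inflow_indic_integrable (S : set R) : measurable S ->
  mu.-integrable `[t0, t] (EFin \o (fun s => f s * \1_S s)).
Proof.
move=> mS; have [C C0 hC] := inflow_rate_bounded t0 t.
apply: (itv_bounded_integrable _ _ _ C).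
  by apply: measurable_funM; [exact: measurable_inflow_rate|exact: measurable_indic].
move=> s st; rewrite indicE_if; case: ifP => _; last by rewrite mulr0 normr0.
by rewrite mulr1 ger0_norm ?inflow_rate_ge0// hC.
Qed.

Lemma inflow_indic_itv a b : t0 <= a -> a <= b -> b <= t ->
  \int[mu]_(s in `[t0, t]) (f s * \1_`[a, b] s) = inflow phi b - inflow phi a.
Proof.
move=> ta ab bt; rewrite -inflowB// [LHS]Rintegral_mkcond [RHS]Rintegral_mkcond.
apply: eq_Rintegral => s _; rewrite !patchE indicE_if.
case: (boolP (s \in `[a, b]%classic)) => sab; last by rewrite mulr0 if_same.
rewrite mulr1 mem_set//; move: sab; rewrite inE/= !in_itv/= => /andP[? ?].
by apply/andP; split; lra.
Qed.

Lemma le_inflow_indic (S S' : set R) : measurable S -> measurable S' ->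
  (forall s, t0 <= s <= t -> S s -> S' s) ->
  \int[mu]_(s in `[t0, t]) (f s * \1_S s) <=
  \int[mu]_(s in `[t0, t]) (f s * \1_S' s).
Proof.
move=> mS mS' SS'; apply: le_Rintegral; [exact: measurable_itv|
  exact: inflow_indic_integrable|exact: inflow_indic_integrable|].
move=> s; rewrite /= in_itv/= => st; rewrite ler_wpM2l ?inflow_rate_ge0// !indicE_if.
case: ifPn => [/set_mem/(SS' _ st)/mem_set ->//|_]; by case: ifP.
Qed.

End indicators.

End inflow.

(** * The shape of optimal paths *)

Section path_classification.
Context {R : realType}.
Notation mu := (@lebesgue_measure R).

Definition potential (u0 : R -> R) (y : R) : R := \int[mu]_(z in `[0%R, y]) u0 z.

(** The action of the straight path from y at time t0 to x at time t. *)
Definition direct_cost (u0 : R -> R) (t0 t x y : R) : R :=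
  potential u0 y + (x - y) ^+ 2 / (2 * (t - t0)).

(** The action of the path that goes straight from y at time t0 to the boundary,
    stays there between the times a and b, and goes straight to x. *)
Definition boundary_cost (phi u0 : R -> R) (t0 t x y a b : R) : R :=
  potential u0 y + y ^+ 2 / (2 * (a - t0))
  - (inflow phi b - inflow phi a) / 2 + x ^+ 2 / (2 * (t - b)).

(** Half of this integral is what the path g gains at the boundary. *)
Definition boundary_gain (phi : R -> R) (t0 t : R) (g : R -> R) : R :=
  \int[mu]_(s in `[t0, t]) (inflow_rate phi s * \1_[set r | g r = 0] s).

(** The two sides of the hypothesis differ by a positive multiple of (A v - B u)^2. *)
Lemma parallel_slopes (u v A B : R) : 0 < u -> 0 < v ->
  A ^+ 2 / u + B ^+ 2 / v <= (A + B) ^+ 2 / (u + v) -> A * v = B * u.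
Proof.
move=> u0 v0 h.
have uv0 : 0 < u + v by rewrite addr_gt0.
have e : A ^+ 2 / u + B ^+ 2 / v - (A + B) ^+ 2 / (u + v) =
    (A * v - B * u) ^+ 2 / (u * v * (u + v)).
  by field; rewrite !gt_eqF.
have : (A * v - B * u) ^+ 2 / (u * v * (u + v)) <= 0 by rewrite -e subr_le0.
rewrite pmulr_lle0; last by rewrite invr_gt0 !mulr_gt0.
by move=> h2; apply/eqP; rewrite -subr_eq0 -sqrf_eq0 eq_le h2 sqr_ge0.
Qed.

(** A path that spends no more energy than the straight one is straight, since
    otherwise two of its chords have different slopes. *)
Lemma straight_path (g : R -> R) (E : R -> R -> R) (p q : R) : p < q ->
  (forall s, p < s < q -> 0 < g s) ->
  (forall r s, p <= r -> r < s -> s <= q -> (forall z, r < z < s -> 0 < g z) ->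
    (g s - g r) ^+ 2 / (s - r) <= E r s) ->
  (forall s, p <= s <= q -> E p q = E p s + E s q) ->
  E p q <= (g q - g p) ^+ 2 / (q - p) ->
  forall s, p <= s <= q -> g s = g q - (g q - g p) / (q - p) * (q - s).
Proof.
move=> pq gpos Eg Eadd Epq s /andP[ps sq].
have qp0 : q - p != 0 by rewrite subr_eq0 gt_eqF.
have [->|sp] := eqVneq s p; first by rewrite divfK//; ring.
have [->|sq'] := eqVneq s q; first by ring.
have {}ps : p < s by rewrite lt_neqAle eq_sym sp.
have {}sq : s < q by rewrite lt_neqAle sq'.
have e1 := Eg p s (lexx _) ps (ltW sq).
have e2 := Eg s q (ltW ps) sq (lexx _).
have := Eadd s; rewrite !ltW// => /(_ isT) e3.
have h : (g s - g p) * (q - s) = (g q - g s) * (s - p).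
  apply: parallel_slopes; rewrite ?subr_gt0//.
  rewrite (_ : g s - g p + (g q - g s) = g q - g p); last by ring.
  rewrite (_ : s - p + (q - s) = q - p); last by ring.
  apply: le_trans Epq; rewrite e3; apply: lerD.
    by apply: e1 => z /andP[? ?]; apply: gpos; lra.
  by apply: e2 => z /andP[? ?]; apply: gpos; lra.
have : g q * (s - p) + g p * (q - s) = g s * (q - p) by lra.
move=> h2; apply: (mulIf qp0); rewrite -h2; field.
exact: qp0.
Qed.

Lemma closed_inf (A : set R) : A !=set0 -> has_lbound A -> closed A -> A (inf A).
Proof.
move=> [x Ax] [m Am] cA.
have cN : closed (-%R @` A).
  rewrite (_ : _ @` A = -%R @^-1` A).
    by apply: preimage_closed => // y _; exact: opp_continuous.
  by apply/seteqP; split => [_ [y Ay <-]|y Ay] /=; [rewrite opprK|exists (- y); rewrite ?opprK].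
have := @closure_sup _ (-%R @` A).
rewrite -(closure_id _).1// => h; have [||y Ay yE] := h.
- by exists (- x), x.
- by exists (- m) => _ [y Ay <-]; rewrite lerN2 Am.
by rewrite /inf -yE opprK.
Qed.

Section zeros.
Context {t0 t : R} {g : R -> R} (t0t : t0 <= t).
Hypothesis acg : absolutely_continuous t0 t g.

Let Z (a b : R) := [set s | a <= s <= b /\ g s = 0].

Let zeros_closed a b : t0 <= a -> b <= t -> closed (Z a b).
Proof.
move=> ta bt; pose G x := g (clamp t0 t x).
have cG : continuous G by exact: absolutely_continuous_continuous.
have -> : Z a b = `[a, b] `&` G @^-1` [set 0].
  apply/seteqP; split => s /=; rewrite in_itv/= => -[/andP[as_ sb]].
    by move=> gs; split; [rewrite as_|rewrite /G clamp_id//; lra].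
  by rewrite /G clamp_id; [move=> gs; split; rewrite ?as_|lra|lra].
apply: closedI; first exact: interval_closed.
by apply: preimage_closed => // y _; exact: cG.
Qed.

Lemma last_zero a b : t0 <= a -> b <= t -> (exists2 s, a <= s <= b & g s = 0) ->
  exists l, [/\ a <= l <= b, g l = 0 & forall s, l < s <= b -> g s != 0].
Proof.
move=> ta bt [s0 s0ab gs0].
have Zne : Z a b !=set0 by exists s0.
have Zub : has_ubound (Z a b) by exists b => s [/andP[]].
have := closure_sup Zne Zub.
rewrite -(closure_id _).1; last exact: zeros_closed.
move=> [lab gl]; exists (sup (Z a b)); split => // s /andP[ls sb].
apply/negP => /eqP gs; have : s <= sup (Z a b).
  apply: ub_le_sup => //; split => //; rewrite sb andbT.
  by apply: le_trans (ltW ls); case/andP: lab.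
by rewrite leNgt ls.
Qed.

Lemma first_zero a b : t0 <= a -> b <= t -> (exists2 s, a <= s <= b & g s = 0) ->
  exists l, [/\ a <= l <= b, g l = 0 & forall s, a <= s < l -> g s != 0].
Proof.
move=> ta bt [s0 s0ab gs0].
have Zne : Z a b !=set0 by exists s0.
have Zlb : has_lbound (Z a b) by exists a => s [/andP[]].
have [lab gl] := closed_inf _ Zne Zlb (zeros_closed _ _ ta bt); exists (inf (Z a b)); split => // s /andP[as_ sl].
apply/negP => /eqP gs; have : inf (Z a b) <= s.
  apply: ge_inf => //; split => //; rewrite as_/=.
  by apply: le_trans (ltW sl) _; case/andP: lab.
by rewrite leNgt sl.
Qed.

End zeros.

End path_classification.

Section classify_paths.
Context {R : realType}.
Notation mu := (@lebesgue_measure R).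
Context {phi : R -> R} (rphi : regular_boundary phi) (u0 : R -> R).
Context {t0 t x : R} (t0t : t0 < t) (x0 : 0 < x).
Notation Phi := (inflow phi).

Notation wait := (boundary_gain phi t0 t).

Let wait_eq0 (g : R -> R) : (forall s, t0 <= s <= t -> g s != 0) -> wait g = 0.
Proof.
move=> h; rewrite /boundary_gain (_ : Rintegral _ _ _ = \int[mu]_(s in `[t0, t]) 0).
  by rewrite Rintegral_cst ?mul0r//; exact: measurable_itv.
apply: eq_Rintegral => s; rewrite inE/= in_itv/= => /h gs.
rewrite indicE memNset ?mulr0//=; exact/eqP.
Qed.

Let wait_le (g : R -> R) a b : absolutely_continuous t0 t g ->
  t0 <= a -> a <= b -> b <= t ->
  (forall s, t0 <= s <= t -> g s = 0 -> a <= s <= b) ->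
  wait g <= Phi b - Phi a.
Proof.
move=> acg ta ab bt h.
have mG : measurable [set s | g (clamp t0 t s) = 0].
  have cG := absolutely_continuous_continuous _ _ _ (ltW t0t) acg.
  have -> : [set s | g (clamp t0 t s) = 0] =
      setT `&` (fun s => g (clamp t0 t s)) @^-1` [set 0].
    by apply/seteqP; split => s //= -[].
  apply: (continuous_measurable_fun cG measurableT); exact: measurable_set1.
rewrite (_ : wait g = \int[mu]_(s in `[t0, t])
    (inflow_rate phi s * \1_[set r | g (clamp t0 t r) = 0] s)); last first.
  apply: eq_Rintegral => s; rewrite inE/= in_itv/= => /andP[h1 h2].
  congr (_ * _); rewrite !indicE_if; congr (if _ then _ else _).
  by apply/idP/idP => /set_mem/= gs; apply/mem_set => /=; move: gs; rewrite clamp_id.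
rewrite -(inflow_indic_itv rphi _ _ ta ab bt); apply: le_inflow_indic => //.
move=> s /andP[h1 h2]; rewrite /= clamp_id// in_itv/=; apply: h.
by rewrite h1.
Qed.

Let actionE (g : R -> R) : action phi t0 u0 t g =
  ((potential u0 (g t0))%:E + (2^-1)%:E * (\int[mu]_(s in `[t0, t])
      (derive1 g s ^+ 2 * \1_[set r | (0 < g r)%R] s)%:E)
    - (2^-1 * wait g)%:E)%E.
Proof. by []. Qed.

Let action_cases (g : R -> R) : absolutely_continuous t0 t g ->
  action phi t0 u0 t g = +oo%E \/
  exists E : R -> R -> R, [/\
    ((potential u0 (g t0) + E t0 t / 2 - wait g / 2)%:E <= action phi t0 u0 t g)%E,
    forall p q, t0 <= p -> p <= q -> q <= t -> 0 <= E p q,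
    forall p q r, t0 <= p -> p <= q -> q <= r -> r <= t -> E p r = E p q + E q r &
    forall p q, t0 <= p -> p < q -> q <= t -> (forall s, p < s < q -> 0 < g s) ->
      (g q - g p) ^+ 2 / (q - p) <= E p q].
Proof.
move=> acg; rewrite actionE.
have [->|[E [EK E0 Eadd Eg]]] := kinetic_energy _ _ _ (ltW t0t) acg.
  by left; rewrite gt0_muley ?lte_fin ?invr_gt0// addey// addye.
right; exists E; split => //; rewrite EFinB EFinD leeB// ?lee_fin; last by lra.
rewrite leeD// (_ : E t0 t / 2 = 2^-1 * E t0 t); last by lra.
by rewrite EFinM lee_pmul2l.
Qed.

(** Only the first and the last visits of the boundary, at times a and b,
    matter. In between the path gains at most what the boundary yields from a to
    b; outside, the energy of a chord is a lower bound. The bound is attained only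
    by a path that spends no energy between a and b, hence stays at the boundary,
    and that is straight after b. *)
Lemma path_classification (g : R -> R) : admissible t0 t x g ->
  [/\ forall s, t0 <= s <= t -> g s != 0,
      ((direct_cost u0 t0 t x (g t0))%:E <= action phi t0 u0 t g)%E &
      (action phi t0 u0 t g <= (direct_cost u0 t0 t x (g t0))%:E)%E ->
        forall s, t0 <= s <= t -> g s = x - (x - g t0) / (t - t0) * (t - s)] \/
  exists a b, [/\ [/\ t0 <= a, a <= b & b < t], a = t0 -> g t0 = 0,
      ((boundary_cost phi u0 t0 t x (g t0) a b)%:E <= action phi t0 u0 t g)%E &
      (action phi t0 u0 t g <= (boundary_cost phi u0 t0 t x (g t0) a b)%:E)%E ->
        [set s | t0 <= s <= t /\ g s = 0] = `[a, b]%classic /\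
        forall s, b <= s <= t -> g s = x - x / (t - b) * (t - s)].
Proof.
move=> [acg g0 gt].
have gpos s : t0 <= s <= t -> g s != 0 -> 0 < g s.
  by move=> st gs; rewrite lt_neqAle eq_sym gs g0.
have [[s0 s0t gs0]|nz] := pselect (exists2 s, t0 <= s <= t & g s = 0); last first.
  left; have gn s : t0 <= s <= t -> g s != 0.
    by move=> st; apply/eqP => gs; apply: nz; exists s.
  split => //; have [->|[E [EK E0 Eadd Eg]]] := action_cases _ acg.
  - by rewrite leey.
  - apply: le_trans EK; rewrite lee_fin wait_eq0// /direct_cost.
    have := Eg t0 t (lexx _) t0t (lexx _); rewrite gt.
    have -> : (x - g t0) ^+ 2 / (2 * (t - t0)) = (x - g t0) ^+ 2 / (t - t0) / 2.
      by field; rewrite gt_eqF// subr_gt0.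
    move=> h.
    suff : (x - g t0) ^+ 2 / (t - t0) <= E t0 t by lra.
    by apply: h => s /andP[? ?]; apply: gpos; [lra|apply: gn; lra].
  - by rewrite leye_eq.
  - move=> le; have {le}:= le_trans EK le; rewrite lee_fin wait_eq0// /direct_cost.
    have -> : (x - g t0) ^+ 2 / (2 * (t - t0)) = (x - g t0) ^+ 2 / (t - t0) / 2.
      by field; rewrite gt_eqF// subr_gt0.
    move=> Ele s st; rewrite -gt; apply: (straight_path g E t0 t t0t _ _ _ _ _ st) => //.
    + by move=> z /andP[? ?]; apply: gpos; [lra|apply: gn; lra].
    + by move=> z /andP[? ?]; exact: Eadd.
    + by rewrite gt; lra.
right.
have ttl := lexx t; have t0l := lexx t0.
have [a [/andP[ta at_] ga afirst]] := first_zero (ltW t0t) acg _ _ t0l ttl (ex_intro2 _ _ s0 s0t gs0).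
have [b [/andP[tb bt] gb blast]] := last_zero (ltW t0t) acg _ _ t0l ttl (ex_intro2 _ _ s0 s0t gs0).
have ab : a <= b.
  by rewrite leNgt; apply/negP => ba; have := blast a; rewrite ba at_ ga eqxx => /(_ isT).
have {}bt : b < t.
  by rewrite lt_neqAle bt andbT; apply/eqP => bt'; move: gt x0; rewrite -bt' gb => <-; rewrite ltxx.
have zab s : t0 <= s <= t -> g s = 0 -> a <= s <= b.
  move=> /andP[ts st] gs; apply/andP; split; rewrite leNgt; apply/negP => ls.
    by have := afirst s; rewrite ts ls gs eqxx => /(_ isT).
  by have := blast s; rewrite ls st gs eqxx => /(_ isT).
exists a, b; have w := wait_le _ _ _ acg ta ab (ltW bt) zab.
have [aoo|[E [EK E0 Eadd Eg]]] := action_cases _ acg.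
  by split => //; [move=> at0; rewrite -at0|rewrite aoo leey|rewrite aoo leye_eq].
have half (A c : R) : A / (2 * c) = A / c / 2 by rewrite invfM mulrA mulrAC.
have e1 : g t0 ^+ 2 / (2 * (a - t0)) <= E t0 a / 2.
  have [->|at0] := eqVneq a t0; first by rewrite subrr mulr0 invr0 mulr0 divr_ge0// E0// ltW.
  have ta' : t0 < a by rewrite lt_neqAle eq_sym at0.
  have := Eg t0 a t0l ta' at_; rewrite ga sub0r sqrrN => h.
  rewrite half ler_pM2r ?invr_gt0//; apply: h => s /andP[? ?].
  by apply: gpos; [lra|apply: afirst; lra].
have gbt s : b < s < t -> 0 < g s.
  by move=> /andP[? ?]; apply: gpos; [lra|apply: blast; lra].
have e2 : x ^+ 2 / (t - b) <= E b t.
  by have := Eg b t tb bt ttl gbt; rewrite gt gb subr0.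
have e3 := half (x ^+ 2) (t - b).
have e4 := Eadd t0 a t t0l ta at_ ttl; have e5 := Eadd a b t ta ab (ltW bt) ttl.
have e6 := E0 _ _ ta ab (ltW bt).
split => //.
- by move=> at0; rewrite -at0.
- by apply: le_trans EK; rewrite lee_fin /boundary_cost; lra.
move=> le; have {le EK}:= le_trans EK le; rewrite lee_fin /boundary_cost => le.
(* equality leaves no energy for the time from a to b *)
have Eab0 : E a b <= 0 by lra.
split.
  apply/seteqP; split => [s [st gs]|s]; first by rewrite /= in_itv/= zab.
  rewrite /= in_itv/= => /andP[as_ sb]; split; first by apply/andP; split; lra.
  (* otherwise an excursion from the boundary spends energy between a and b *)
  apply: contrapT => /eqP gs.
  have sa : s != a by apply: contraNneq gs => ->; rewrite ga.
  have {}as_ : a < s by rewrite lt_neqAle eq_sym sa.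
  have bt' := ltW bt.
  have st : s <= t by lra.
  have ex : exists2 z, a <= z <= s & g z = 0 by exists a; rewrite ?lexx ?(ltW as_).
  have [c [/andP[ac cs] gc clast]] := last_zero (ltW t0t) acg a s ta st ex.
  have {}cs : c < s.
    by rewrite lt_neqAle cs andbT; apply: contraNneq gs => <-; rewrite gc.
  have tc : t0 <= c by lra.
  have := Eg c s tc cs st; rewrite gc subr0 => h.
  have : 0 < g s ^+ 2 / (s - c).
    by rewrite divr_gt0 ?subr_gt0// exprn_gt0// gpos//; lra.
  move=> pos; have {h}: g s ^+ 2 / (s - c) <= E c s.
    by apply: h => z /andP[? ?]; apply: gpos; [lra|apply: clast; lra].
  have := Eadd a c b ta ac _ bt'; have := Eadd c s b tc (ltW cs) sb bt'.
  have := E0 a c ta ac; have := E0 s b _ sb bt'; lra.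
move=> s sbt; rewrite -[X in X / _](subr0 x) -gb -gt; apply: (straight_path g E b t bt _ _ _ _ _ sbt) => //.
- by move=> p q bp pq qt; apply: Eg => //; lra.
- by move=> z /andP[? ?]; apply: Eadd => //; lra.
- rewrite gt gb subr0; lra.
Qed.

End classify_paths.

(** * Paths of least cost *)

Section realize_paths.
Context {R : realType}.
Notation mu := (@lebesgue_measure R).

Lemma lipschitz_absolutely_continuous (a b L : R) (g : R -> R) : 0 <= L ->
  (forall x y, a <= x -> x <= y -> y <= b -> `|g y - g x| <= L * (y - x)) ->
  absolutely_continuous a b g.
Proof.
move=> L0 gL e e0; exists (e / (L + 1)); first by rewrite divr_gt0// ltr_wpDl.
move=> n l r lr _ h; have L1 : 0 < L + 1 by rewrite ltr_wpDl.
apply: (@le_lt_trans _ _ (\sum_(i < n) L * (r i - l i))).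
  by apply: ler_sum => i _; have [? ? ?] := lr i; exact: gL.
rewrite -mulr_sumr; set S := \sum_(i < n) (r i - l i) in h *.
have S0 : 0 <= S by apply: sumr_ge0 => i _; have [? ? ?] := lr i; rewrite subr_ge0.
have : S * (L + 1) < e by rewrite -ltr_pdivlMr.
nra.
Qed.

Lemma derive1_affine (c d s : R) (g : R -> R) :
  (\forall z \near s, g z = c * z + d) -> derive1 g s = c.
Proof.
move=> h; rewrite derive1E (near_eq_derive _ h).
have d1 : is_derive s (1 : R) ((c *: (id : R -> R)) + cst d) (c *: (1 : R) + 0).
  by apply: is_deriveD; apply: is_deriveZ.
rewrite (_ : (fun z : R => c * z + d) = (c *: (id : R -> R)) + cst d)//.
by rewrite derive_val addr0 /GRing.scale/= mulr1.
Qed.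

Lemma lipschitz_continuous (L : R) (g : R -> R) : 0 <= L ->
  (forall x y, x <= y -> `|g y - g x| <= L * (y - x)) -> continuous g.
Proof.
move=> L0 gL x; apply/cvgrPdist_lt => e e0; have L1 : 0 < L + 1 by rewrite ltr_wpDl.
near=> y.
have yx : `|x - y| < e / (L + 1).
  by near: y; apply: cvgr_dist_lt => //; rewrite divr_gt0.
have Le : L * `|x - y| < e.
  have : (L + 1) * `|x - y| < e by rewrite mulrC -ltr_pdivlMr.
  have := normr_ge0 (x - y); nra.
apply: le_lt_trans Le; have [xy|/ltW xy] := leP x y.
  by rewrite distrC [X in _ * X]distrC (@ger0_norm _ (y - x)) ?subr_ge0// gL.
by rewrite (@ger0_norm _ (x - y)) ?subr_ge0// gL.
Unshelve. all: by end_near. Qed.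

Context {phi : R -> R} (rphi : regular_boundary phi) (u0 : R -> R).
Context {t0 t x : R} (t0t : t0 < t) (x0 : 0 < x).

Notation wait := (boundary_gain phi t0 t).

Let action_le (g : R -> R) (K : R) (h : R -> R) :
  (\int[mu]_(s in `[t0, t]) (h s)%:E = K%:E)%E ->
  (forall s, t0 <= s <= t -> derive1 g s ^+ 2 * \1_[set r | 0 < g r] s <= h s) ->
  (action phi t0 u0 t g <= (potential u0 (g t0) + K / 2 - wait g / 2)%:E)%E.
Proof.
move=> hK hle; rewrite EFinB EFinD leeB// ?lee_fin; last by rewrite /boundary_gain mulrC.
rewrite leeD// (_ : K / 2 = 2^-1 * K); last by rewrite mulrC.
rewrite EFinM lee_pmul2l// -hK; apply: ge0_le_integral_nonmeasurable => s; rewrite /= in_itv/=.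
  by move=> _; rewrite lee_fin mulr_ge0// ?sqr_ge0// indicE_if; case: ifP.
by rewrite lee_fin; exact: hle.
Qed.

Lemma direct_path_exists y : 0 <= y -> exists g, [/\ admissible t0 t x g, g t0 = y &
  (action phi t0 u0 t g <= (direct_cost u0 t0 t x y)%:E)%E].
Proof.
move=> y0; pose c := (x - y) / (t - t0).
have tt0 : 0 < t - t0 by rewrite subr_gt0.
pose g s := c * s + (y - c * t0).
have gt0 : g t0 = y by rewrite /g; ring.
have gt : g t = x by rewrite /g /c; field; rewrite gt_eqF.
exists g; split => //.
  split => //.
    apply: (lipschitz_absolutely_continuous _ _ `|c|) => // r s _ rs _.
    rewrite (_ : g s - g r = c * (s - r)); last by rewrite /g; ring.
    by rewrite normrM (@ger0_norm _ (s - r)) ?subr_ge0.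
  move=> s /andP[ts st].
  have -> : g s = (y * (t - s) + x * (s - t0)) / (t - t0).
    by rewrite /g /c; field; rewrite gt_eqF.
  apply: divr_ge0; last exact: ltW.
  by apply: addr_ge0; apply: mulr_ge0; rewrite ?subr_ge0// ltW.
apply: le_trans (action_le g (c ^+ 2 * (t - t0)) (cst (c ^+ 2)) _ _) _.
- rewrite -[LHS]/(\int[mu]_(s in `[t0, t]) cst (c ^+ 2)%:E s)%E integral_cst//=.
  by rewrite lebesgue_measure_itv/= lte_fin t0t -EFinD -EFinM.
- move=> s _; rewrite (derive1_affine c (y - c * t0)); last by near=> z.
  by rewrite indicE_if /=; case: ifP => _; rewrite ?mulr1// mulr0 sqr_ge0.
rewrite lee_fin gt0 /direct_cost.
have -> : (x - y) ^+ 2 / (2 * (t - t0)) = c ^+ 2 * (t - t0) / 2.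
  by rewrite /c; field; rewrite gt_eqF.
have : 0 <= wait g.
  by apply: Rintegral_ge0 => s _; rewrite mulr_ge0 ?inflow_rate_ge0// indicE_if; case: ifP.
lra.
Unshelve. all: by end_near. Qed.

(** The path is a sum of two positive parts of affine functions, the first of
    which ends at time a and the second of which starts at time b. If a = t0
    then y = 0, and division by zero makes the first one vanish. *)
Lemma boundary_path_exists y a b : t0 <= a -> a <= b -> b < t -> 0 <= y ->
  (a = t0 -> y = 0) -> exists g, admissible t0 t x g /\
  (action phi t0 u0 t g <= (boundary_cost phi u0 t0 t x y a b)%:E)%E.
Proof.
move=> ta ab bt y0 ya; pose c := y / (a - t0); pose d := x / (t - b).
have at0 : 0 <= a - t0 by rewrite subr_ge0.
have tb0 : 0 < t - b by rewrite subr_gt0.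
have c0 : 0 <= c by rewrite divr_ge0.
have d0 : 0 <= d by rewrite divr_ge0 ?ltW.
pose g s := Num.max 0 (c * (a - s)) + Num.max 0 (d * (s - b)).
have gl s : s <= a -> g s = c * (a - s).
  move=> sa; have h1 : 0 <= c * (a - s) by rewrite mulr_ge0 ?subr_ge0.
  have h2 : d * (s - b) <= 0 by rewrite mulr_ge0_le0// subr_le0 (le_trans sa).
  by rewrite /g (max_r h1) (max_l h2) addr0.
have gr s : b <= s -> g s = d * (s - b).
  move=> bs; have h1 : 0 <= d * (s - b) by rewrite mulr_ge0 ?subr_ge0.
  have h2 : c * (a - s) <= 0 by rewrite mulr_ge0_le0// subr_le0 (le_trans ab).
  by rewrite /g (max_r h1) (max_l h2) add0r.
have gm s : a <= s -> s <= b -> g s = 0.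
  move=> as_ sb; have h1 : c * (a - s) <= 0 by rewrite mulr_ge0_le0// subr_le0.
  have h2 : d * (s - b) <= 0 by rewrite mulr_ge0_le0// subr_le0.
  by rewrite /g (max_l h1) (max_l h2) addr0.
have gt0 : g t0 = y.
  rewrite gl// /c; have [e|ne] := eqVneq a t0; first by rewrite e subrr mulr0 ya.
  by rewrite divfK// subr_eq0.
have gt : g t = x by rewrite gr ?ltW// /d divfK// gt_eqF.
have maxlip (k u v : R) : 0 <= k -> `|Num.max 0 (k * u) - Num.max 0 (k * v)| <= k * `|u - v|.
  move=> k0; have -> : k * `|u - v| = `|k * u - k * v|.
    by rewrite -mulrBr normrM (ger0_norm k0).
  have n1 := ler_norm (k * u - k * v); have n2 := ler_norm (k * v - k * u).
  rewrite distrC in n2.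
  case: (leP 0 (k * u)) => h1; case: (leP 0 (k * v)) => h2 //.
  - by rewrite subr0 ger0_norm//; lra.
  - by rewrite sub0r normrN ger0_norm//; lra.
  - by rewrite subrr normr0.
have glip r s : r <= s -> `|g s - g r| <= (c + d) * (s - r).
  move=> rs; rewrite /g opprD addrACA mulrDl (le_trans (ler_normD _ _))// lerD//.
    apply: (le_trans (maxlip _ _ _ c0)); rewrite ler_wpM2l//.
    by rewrite (_ : a - s - (a - r) = r - s) 1?distrC ?ger0_norm ?subr_ge0//; ring.
  apply: (le_trans (maxlip _ _ _ d0)); rewrite ler_wpM2l//.
  by rewrite (_ : s - b - (r - b) = s - r) ?ger0_norm ?subr_ge0//; ring.
have cd0 : 0 <= c + d by exact: addr_ge0.
exists g; split.
  split => //.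
    by apply: (lipschitz_absolutely_continuous _ _ (c + d)) => // r s _ rs _; exact: glip.
  by move=> s _; rewrite addr_ge0// le_max lexx.
pose h s := c ^+ 2 * \1_`[t0, a] s + d ^+ 2 * \1_`[b, t] s.
apply: le_trans (action_le g (c ^+ 2 * (a - t0) + d ^+ 2 * (t - b)) h _ _) _.
- have ind (k p q : R) : 0 <= k -> t0 <= p -> p <= q -> q <= t ->
      (\int[mu]_(s in `[t0, t]) (k * \1_`[p, q] s)%:E = (k * (q - p))%:E)%E.
    move=> k0 tp pq qt; under eq_integral do rewrite EFinM.
    have mI : measurable_fun `[t0, t] (fun s => (\1_`[p, q] s)%:E : \bar R).
      by apply/measurable_EFinP; apply: measurable_indic; exact: measurable_itv.
    rewrite ge0_integralZl_EFin; [|exact: measurable_itv|by move=> s _; rewrite lee_fin|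
      exact: mI|by []].
    rewrite integral_indic; [|exact: measurable_itv|exact: measurable_itv].
    rewrite setIidl; last by apply: subset_itv; rewrite bnd_simp.
    rewrite /= lebesgue_measure_itv/= lte_fin -EFinB EFinM.
    by move: pq; rewrite le_eqVlt => /predU1P[->|->//]; rewrite ltxx subrr.
  under eq_integral do rewrite EFinD.
  rewrite ge0_integralD//.
  + by rewrite !ind ?sqr_ge0// ?(le_trans ta)// ?(le_trans ab)// ltW.
  + by move=> s _; rewrite lee_fin mulr_ge0// sqr_ge0.
  + by apply/measurable_EFinP; apply: measurable_funM => //; apply: measurable_indic; exact: measurable_itv.
  + by move=> s _; rewrite lee_fin mulr_ge0// sqr_ge0.
  + by apply/measurable_EFinP; apply: measurable_funM => //; apply: measurable_indic; exact: measurable_itv.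
- move=> s /andP[ts st].
  have hs0 : 0 <= h s.
    by rewrite /h !indicE_if addr_ge0// mulr_ge0 ?sqr_ge0//; case: ifP.
  rewrite [X in _ * X]indicE_if; case: ifPn => [/set_mem/= gs|]; last by rewrite mulr0.
  rewrite mulr1; have [sa|as_] := ltP s a.
    rewrite (derive1_affine (- c) (c * a)); last first.
      near=> z; rewrite gl; first by ring.
      by apply/ltW; near: z; exact: lt_nbhsl.
    rewrite /h indicE_if mem_set/=; last by rewrite in_itv/= ts ltW.
    by rewrite sqrrN mulr1 lerDl mulr_ge0// ?sqr_ge0// indicE_if; case: ifP.
  have [bs|sb] := ltP b s; last by move: gs; rewrite gm// ltxx.
  rewrite (derive1_affine d (- d * b)); last first.
    near=> z; rewrite gr; first by ring.
    by apply/ltW; near: z; exact: lt_nbhsr.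
  rewrite /h [X in _ <= _ + _ * X]indicE_if mem_set/=; last by rewrite in_itv/= st andbT ltW.
  by rewrite mulr1 lerDr mulr_ge0// ?sqr_ge0// indicE_if; case: ifP.
rewrite lee_fin gt0 /boundary_cost.
have -> : x ^+ 2 / (2 * (t - b)) = d ^+ 2 * (t - b) / 2.
  by rewrite /d; field; rewrite gt_eqF.
have -> : y ^+ 2 / (2 * (a - t0)) = c ^+ 2 * (a - t0) / 2.
  have [e|ne] := eqVneq a t0; first by rewrite /c ya// !mul0r expr0n/= !mul0r.
  by rewrite /c; field; rewrite subr_eq0.
suff : inflow phi b - inflow phi a <= wait g by lra.
rewrite -(inflow_indic_itv rphi _ _ ta ab (ltW bt)); apply: le_inflow_indic => //.
  have cg : continuous g by exact: lipschitz_continuous glip.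
  have -> : [set r | g r = 0] = setT `&` g @^-1` [set 0] by rewrite setTI.
  apply: (continuous_measurable_fun cg measurableT); exact: measurable_set1.
by move=> s _; rewrite /= in_itv/= => /andP[? ?]; exact: gm.
Unshelve. all: by end_near. Qed.

End realize_paths.

(** * The reduced variational problem *)

Section reduced_problem.
Context {R : realType}.
Context {phi : R -> R} (rphi : regular_boundary phi) (u0 : R -> R).
Context {t0 t : R} (t0t : t0 < t).
Notation Phi := (inflow phi).

(** A path that starts at y and is at the boundary from a to b. The last
    condition matters because y ^+ 2 / (2 * (a - t0)) is 0 for a = t0. *)
Definition boundary_visit (t0 t y a b : R) : Prop :=
  [/\ t0 <= a, a <= b, b < t, 0 <= y & a = t0 -> y = 0].

Definition cost_lower_bound (phi u0 : R -> R) (t0 t x m : R) : Prop :=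
  (forall y, 0 <= y -> m <= direct_cost u0 t0 t x y) /\
  (forall y a b, boundary_visit t0 t y a b ->
     m <= boundary_cost phi u0 t0 t x y a b).

Lemma action_lower_bound x m : 0 < x -> cost_lower_bound phi u0 t0 t x m ->
  forall g, admissible t0 t x g -> (m%:E <= action phi t0 u0 t g)%E.
Proof.
move=> x0 [md mb] g ag; have [_ g0 _] := ag.
have gt0 : 0 <= g t0 by apply: g0; rewrite lexx ltW.
have [[_ le _]|[a [b [[ta ab bt] ga le _]]]] := path_classification rphi u0 t0t x0 _ ag.
  by apply: le_trans le; rewrite lee_fin md.
by apply: le_trans le; rewrite lee_fin mb.
Qed.

(** Reduced costs bound all actions from below and are attained, so their
    minimum is the value function. *)
Lemma value_eq x m : 0 < x -> cost_lower_bound phi u0 t0 t x m ->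
  (exists2 y, 0 <= y & direct_cost u0 t0 t x y <= m) \/
  (exists y a b, boundary_visit t0 t y a b /\ boundary_cost phi u0 t0 t x y a b <= m) ->
  value phi t0 u0 t x = m /\ exists g, minimizer phi t0 u0 t x g.
Proof.
move=> x0 mlb att; have lb := action_lower_bound _ _ x0 mlb.
have [g ag gm] : exists2 g, admissible t0 t x g & (action phi t0 u0 t g <= m%:E)%E.
  case: att => [[y y0 ym]|[y [a [b [[ta ab bt y0 ya] ym]]]]].
    have [g [ag _ le]] := direct_path_exists (phi := phi) u0 t0t x0 y y0.
    by exists g => //; rewrite (le_trans le)// lee_fin.
  have [g [ag le]] := boundary_path_exists rphi u0 x0 y a b ta ab bt y0 ya.
  by exists g => //; rewrite (le_trans le)// lee_fin.
have gE : action phi t0 u0 t g = m%:E by apply/eqP; rewrite eq_le gm lb.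
have vE : value phi t0 u0 t x = m.
  rewrite /value (_ : ereal_inf _ = m%:E)//; apply/eqP; rewrite eq_le; apply/andP; split.
    by apply: ereal_inf_lbound; exists g.
  by apply: le_ereal_inf_tmp => _ [h ah <-]; exact: lb.
by split => //; exists g; split => //; rewrite vE.
Qed.

Context {p C : R} (p0 : 0 <= p).
Hypothesis u0_ge : forall y, 0 <= y -> - p * y - C <= potential u0 y.

(** If the potential may decrease with slope p, then it is best to come from
    afar with speed p, which gains p^2/2 per unit of time. *)
Lemma direct_cost_ge x y : 0 <= y ->
  - C - p * x - p ^+ 2 * (t - t0) / 2 <= direct_cost u0 t0 t x y.
Proof.
move=> y0; have := u0_ge _ y0; rewrite /direct_cost => h.
have tt0 : 0 < t - t0 by rewrite subr_gt0.
suff : 0 <= (x - y) ^+ 2 / (2 * (t - t0)) + p ^+ 2 * (t - t0) / 2 - p * (y - x) by lra.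
have -> : (x - y) ^+ 2 / (2 * (t - t0)) + p ^+ 2 * (t - t0) / 2 - p * (y - x) =
    (y - x - p * (t - t0)) ^+ 2 / (2 * (t - t0)) by field; rewrite gt_eqF.
by rewrite divr_ge0 ?sqr_ge0// mulr_ge0// ltW.
Qed.

Lemma arrival_cost_ge y a : 0 <= y -> t0 <= a -> (a = t0 -> y = 0) ->
  - C - p ^+ 2 * (a - t0) / 2 <= potential u0 y + y ^+ 2 / (2 * (a - t0)).
Proof.
move=> y0 ta ya; have := u0_ge _ y0 => h.
have [at0|at0] := eqVneq a t0.
  move: h; rewrite (ya at0) at0 subrr !mulr0 sub0r mul0r subr0.
  by rewrite expr0n/= mul0r addr0.
have a0 : 0 < a - t0 by rewrite subr_gt0 lt_neqAle eq_sym at0.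
suff : 0 <= y ^+ 2 / (2 * (a - t0)) + p ^+ 2 * (a - t0) / 2 - p * y by lra.
have -> : y ^+ 2 / (2 * (a - t0)) + p ^+ 2 * (a - t0) / 2 - p * y =
    (y - p * (a - t0)) ^+ 2 / (2 * (a - t0)) by field; rewrite gt_eqF.
by rewrite divr_ge0 ?sqr_ge0// mulr_ge0// ltW.
Qed.

Lemma cost_lower_bound_exists x : 0 < x ->
  exists m, cost_lower_bound phi u0 t0 t x m.
Proof.
move=> x0; have tt0 : 0 < t - t0 by rewrite subr_gt0.
exists (- C - p * x - p ^+ 2 * (t - t0) / 2 - (Phi t - Phi t0) / 2).
have P0 : Phi t0 <= Phi t by apply: inflow_le => //; exact: ltW.
have px : 0 <= p * x by rewrite mulr_ge0// ltW.
split=> [y y0|y a b [ta ab bt y0 ya]].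
  by have := direct_cost_ge x _ y0; lra.
rewrite /boundary_cost; have := arrival_cost_ge _ _ y0 ta ya.
have : 0 <= x ^+ 2 / (2 * (t - b)).
  by rewrite divr_ge0 ?sqr_ge0// mulr_ge0// subr_ge0 ltW.
have P1 := inflow_le rphi _ _ ta; have P2 := inflow_le rphi _ _ (ltW bt).
have : p ^+ 2 * (a - t0) <= p ^+ 2 * (t - t0).
  by rewrite ler_wpM2l ?sqr_ge0//; lra.
lra.
Qed.

(** A minimizer realizes the smallest of the reduced costs, and the equality
    cases of the energy bounds determine it up to its way to the boundary. *)
Lemma minimizer_cases x g : 0 < x -> minimizer phi t0 u0 t x g ->
  [/\ forall s, t0 <= s <= t -> g s != 0,
      forall s, t0 <= s <= t -> g s = x - (x - g t0) / (t - t0) * (t - s),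
      value phi t0 u0 t x = direct_cost u0 t0 t x (g t0) &
      cost_lower_bound phi u0 t0 t x (value phi t0 u0 t x)] \/
  exists a b, [/\ boundary_visit t0 t (g t0) a b,
      [set s | t0 <= s <= t /\ g s = 0] = `[a, b]%classic,
      forall s, b <= s <= t -> g s = x - x / (t - b) * (t - s),
      value phi t0 u0 t x = boundary_cost phi u0 t0 t x (g t0) a b &
      cost_lower_bound phi u0 t0 t x (value phi t0 u0 t x)].
Proof.
move=> x0 [ag gE]; have [_ g0 _] := ag.
have gt0 : 0 <= g t0 by apply: g0; rewrite lexx ltW.
have [m0 m0lb] := cost_lower_bound_exists _ x0.
have lb0 := action_lower_bound _ _ x0 m0lb.
set v := value phi t0 u0 t x.
have vinf : v%:E = ereal_inf (action phi t0 u0 t @` admissible t0 t x).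
  rewrite /v /value fineK// fin_numE; apply/andP; split.
    rewrite gt_eqF// (lt_le_trans (ltNyr m0))//.
    by apply: le_ereal_inf_tmp => _ [h ah <-]; exact: lb0.
  rewrite lt_eqF// (le_lt_trans _ (ltry v))// -gE; apply: ereal_inf_lbound.
  by exists g.
have vle h : admissible t0 t x h -> (v%:E <= action phi t0 u0 t h)%E.
  by move=> ah; rewrite vinf; apply: ereal_inf_lbound; exists h.
have vlb : cost_lower_bound phi u0 t0 t x v.
  split=> [y y0|y a b [ta ab bt y0 ya]]; rewrite -lee_fin.
    have [h [ah _ le]] := direct_path_exists (phi := phi) u0 t0t x0 y y0.
    exact: le_trans (vle _ ah) le.
  have [h [ah le]] := boundary_path_exists rphi u0 x0 y a b ta ab bt y0 ya.
  exact: le_trans (vle _ ah) le.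
have [[nz le eq]|[a [b [[ta ab bt] ga le eq]]]] := path_classification rphi u0 t0t x0 _ ag.
  left; have vd : v = direct_cost u0 t0 t x (g t0).
    apply/eqP; rewrite eq_le; apply/andP; split; first by case: vlb => h _; exact: h.
    by rewrite -lee_fin -/v -gE.
  by split => //; apply: eq; rewrite gE -/v vd.
have vis : boundary_visit t0 t (g t0) a b by split.
right; exists a, b.
have vd : v = boundary_cost phi u0 t0 t x (g t0) a b.
  apply/eqP; rewrite eq_le; apply/andP; split; first by case: vlb => _ h; exact: h.
  by rewrite -lee_fin -/v -gE.
by have [|zE gl] := eq; [rewrite gE -/v vd|split].
Qed.

End reduced_problem.

(** * Minimum points of F *)

Section boundary_action.
Context {R : realType}.
Context {phi : R -> R} (rphi : regular_boundary phi).
Hypothesis inflow_diverges : forall K, exists S, forall s, s <= S -> inflow phi s <= K.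
Notation Phi := (inflow phi).
Notation F := (Faction phi).
Implicit Types (t x y s r : R).

(** The minimum of F is encoded as its value at tstar, which is a minimum point
    as soon as x > 0 and the boundary integral diverges. *)
Definition minF t x : R := F t x (tstar phi t x).

Lemma FactionE t x s : s <= t ->
  F t x s = x ^+ 2 / (2 * (t - s)) + (Phi t - Phi s) / 2.
Proof.
by move=> st; rewrite /Faction (inflowB rphi)//; congr (_ + _); exact: mulrC.
Qed.

Lemma FactionB t x y s : F t y s = F t x s + (y ^+ 2 - x ^+ 2) / (2 * (t - s)).
Proof. by rewrite /Faction mulrBl; ring. Qed.

Lemma Faction_ge0 t x s : s <= t -> 0 <= F t x s.
Proof.
move=> st; rewrite FactionE// addr_ge0//.
  by rewrite divr_ge0 ?sqr_ge0// mulr_ge0// subr_ge0.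
by rewrite divr_ge0// subr_ge0 inflow_le.
Qed.

Lemma Faction_continuous t x (a b : R) : a <= b -> b < t ->
  continuous (fun s => F t x (clamp a b s)).
Proof.
move=> ab bt s.
have cc : continuous (clamp a b).
  apply: (lipschitz_continuous 1) => // y z yz.
  by rewrite mul1r ger0_norm ?subr_ge0 ?clamp_le// clamp_lip.
have cb z : clamp a b z < t by have /andP[_ h] := clamp_in ab z; lra.
rewrite (_ : (fun s => _) = (fun s => x ^+ 2 / (2 * (t - clamp a b s)) +
    (Phi t - Phi (clamp a b s)) / 2)); last first.
  by apply/funext => z; rewrite FactionE// ltW.
apply: cvgD.
  apply: cvgM; first exact: cvg_cst.
  apply: cvgV; first by rewrite mulf_neq0// subr_eq0 gt_eqF.
  by apply: cvgM; [exact: cvg_cst|apply: cvgB; [exact: cvg_cst|exact: cc]].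
apply: cvgM; last exact: cvg_cst.
apply: cvgB; first exact: cvg_cst.
by apply: (continuous_comp (cc s)); exact: inflow_continuous.
Qed.

Lemma Faction_min t x (a b : R) : a <= b -> b < t ->
  exists2 c, a <= c <= b & forall s, a <= s <= b -> F t x c <= F t x s.
Proof.
move=> ab bt; have [c|c cab hc] := @EVT_min _ (fun s => F t x (clamp a b s)) a b ab.
  by apply: continuous_subspaceT; exact: Faction_continuous.
move: cab; rewrite in_itv/= => /andP[ac cb]; exists c; first by rewrite ac.
move=> s /andP[as_ sb]; have := hc s; rewrite in_itv/= as_ sb => /(_ isT).
by rewrite !clamp_id.
Qed.

(** F blows up at s = t because x > 0, and at s = -oo because of the inflow. *)
Lemma Faction_coercive t x (K : R) : 0 < x -> exists a b, [/\ a < b, b < t &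
  forall s, s < t -> s < a \/ b < s -> K < F t x s].
Proof.
move=> x0; have [S hS] := inflow_diverges (Phi t - 2 * (`|K| + 1)).
have K1 : 0 < `|K| + 1 by rewrite ltr_wpDl.
pose d := x ^+ 2 / (2 * (`|K| + 1)).
have d0 : 0 < d by rewrite divr_gt0 ?exprn_gt0// mulr_gt0.
have KK := ler_norm K.
exists (Num.min S (t - d - 1)), (t - d); split.
- by rewrite gt_min; apply/orP; right; lra.
- lra.
move=> s st [|sb].
  rewrite lt_min => /andP[sS _]; rewrite FactionE ?ltW//.
  have := hS s (ltW sS); have : 0 <= x ^+ 2 / (2 * (t - s)).
    by rewrite divr_ge0 ?sqr_ge0// mulr_ge0// subr_ge0 ltW.
  lra.
rewrite FactionE ?ltW//.
have : 0 <= Phi t - Phi s by rewrite subr_ge0 inflow_le// ltW.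
have ts : 0 < t - s by rewrite subr_gt0.
suff : `|K| + 1 < x ^+ 2 / (2 * (t - s)) by lra.
rewrite ltr_pdivlMr ?mulr_gt0//.
have : t - s < d by lra.
rewrite /d ltr_pdivlMr ?mulr_gt0//; lra.
Qed.

(** Minimum points form a closed set away from t, so their infimum is one of
    them. *)
Lemma smallest_argmin_of_lbound t x a c : argmins phi t x c ->
  lbound (argmins phi t x) a -> exists s, smallest_argmin phi t x s.
Proof.
move=> hc ha; have ac := ha _ hc; have [ct cmin] := hc.
pose A := [set s | a <= s <= c /\ F t x s <= F t x c].
have cA : closed A.
  have -> : A = `[a, c] `&` (fun s => F t x (clamp a c s)) @^-1` [set z | z <= F t x c].
    apply/seteqP; split => s /= [].
      by move=> /andP[h1 h2] h3; split; [rewrite in_itv/= h1|rewrite clamp_id// h1].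
    by rewrite in_itv/= => /andP[h1 h2]; rewrite clamp_id ?h1// => h3; split; rewrite ?h1.
  apply: closedI; first exact: interval_closed.
  apply: preimage_closed; last exact: closed_le.
  by move=> s _; apply: Faction_continuous.
have [||/andP[h1 h2] h3] := closed_inf A _ _ cA.
- by exists c; split; rewrite ?ac ?lexx.
- by exists a => s [/andP[]].
exists (inf A); split; first split.
- exact: le_lt_trans ct.
- by move=> r rt; rewrite (le_trans h3)// cmin.
move=> s hs; rewrite leNgt; apply/negP => sa; have [st sm] := hs.
suff : inf A <= s by rewrite leNgt sa.
apply: ge_inf; first by exists a => z [/andP[]].
by split; [rewrite ha// (le_trans (ltW sa))|exact: sm].
Qed.

Lemma smallest_argmin_exists t x : 0 < x -> exists s, smallest_argmin phi t x s.
Proof.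
move=> x0; have [a [b [ab bt hab]]] := Faction_coercive t x (F t x (t - 1)) x0.
have t1t : t - 1 < t by rewrite ltrBlDr ltrDl.
have t1 : a <= t - 1 <= b.
  rewrite !leNgt; apply/andP; split; apply/negP => h.
    by have := hab (t - 1) t1t (or_introl h); rewrite ltxx.
  by have := hab (t - 1) t1t (or_intror h); rewrite ltxx.
have [c cab hc] := Faction_min t x a b (ltW ab) bt.
apply: (smallest_argmin_of_lbound t x a c).
  split=> [|s st]; first by case/andP: cab => _ cb; exact: le_lt_trans bt.
  have [sab|] := boolP (a <= s <= b); first exact: hc.
  rewrite negb_and -!ltNge => /orP h; apply: (le_trans (hc _ t1)).
  by apply: ltW; apply: hab => //.
move=> s [st hs]; rewrite leNgt; apply/negP => sa.
by have := hab s st (or_introl sa); rewrite ltNge hs.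
Qed.

Lemma tstarP t x : 0 < x -> smallest_argmin phi t x (tstar phi t x).
Proof.
move=> x0; have [s hs] := smallest_argmin_exists t x x0.
by rewrite /tstar; apply: (xgetPex t) ; exists s.
Qed.

Lemma tstar_lt t x : 0 < x -> tstar phi t x < t.
Proof. by move=> /(tstarP t)[[]]. Qed.

Lemma minF_le t x s : 0 < x -> s < t -> minF t x <= F t x s.
Proof. by move=> /(tstarP t)[[_ h] _]; exact: h. Qed.

Lemma argmins_minF t x s : 0 < x -> argmins phi t x s -> F t x s = minF t x.
Proof.
move=> x0 [st hs]; apply/eqP; rewrite eq_le minF_le// andbT hs//.
exact: tstar_lt.
Qed.

Lemma argminsP t x s : 0 < x -> s < t -> F t x s <= minF t x -> argmins phi t x s.
Proof. by move=> x0 st h; split => // r rt; rewrite (le_trans h) ?minF_le. Qed.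

Lemma minF_ge0 t x : 0 < x -> 0 <= minF t x.
Proof. by move=> x0; rewrite Faction_ge0// ltW// tstar_lt. Qed.

(** minF is an infimum of affine functions of x ^ 2 with slopes 1 / (2 (t - s)),
    hence a concave function of x ^ 2. *)
Lemma minF_increment t x y s : 0 < x -> 0 < y -> argmins phi t x s ->
  minF t y <= minF t x + (y ^+ 2 - x ^+ 2) / (2 * (t - s)).
Proof.
move=> x0 y0 hs; rewrite -(argmins_minF _ _ _ x0 hs) -FactionB.
by apply: minF_le => //; case: hs.
Qed.

(** The slopes of a concave function of x ^ 2 decrease; they increase with the
    minimum point. *)
Lemma argmins_antitone t x y s r : 0 < x -> x < y ->
  argmins phi t x s -> argmins phi t y r -> r <= s.
Proof.
move=> x0 xy hs hr; have y0 := lt_trans x0 xy.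
have [st _] := hs; have [rt _] := hr.
have h1 := minF_increment _ _ _ _ x0 y0 hs; have h2 := minF_increment _ _ _ _ y0 x0 hr.
have d0 : 0 < y ^+ 2 - x ^+ 2 by rewrite subr_gt0 ltr_sqr ?nnegrE// ltW.
have : (y ^+ 2 - x ^+ 2) / (2 * (t - r)) <= (y ^+ 2 - x ^+ 2) / (2 * (t - s)).
  move: h2; rewrite -(opprB (y ^+ 2)) mulNr => h2.
  by rewrite -(lerD2l (minF t x)) (le_trans _ h1)// -lerBrDr.
by rewrite ler_pM2l// lef_pV2 ?posrE ?mulr_gt0 ?subr_gt0// ler_pM2l// lerD2l lerN2.
Qed.

Lemma minF_le_minF t x y : 0 < x -> x <= y -> minF t x <= minF t y.
Proof.
move=> x0 xy; have y0 := lt_le_trans x0 xy; have st := tstar_lt t y y0.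
apply: (le_trans (minF_le _ _ _ x0 st)); rewrite /minF (FactionB t x y) lerDl.
rewrite divr_ge0//; last by rewrite mulr_ge0// subr_ge0 ltW.
by rewrite subr_ge0 ler_sqr ?nnegrE ?(ltW x0) ?(ltW y0).
Qed.

Lemma Faction_gap t x a b : 0 < x -> a <= b -> b < t ->
  (forall s, a <= s <= b -> ~ argmins phi t x s) ->
  exists2 e, 0 < e & forall s, a <= s <= b -> minF t x + e <= F t x s.
Proof.
move=> x0 ab bt h; have [c /andP[ac cb] hc] := Faction_min t x a b ab bt.
exists (F t x c - minF t x) => [|s sab]; last by rewrite addrC subrK hc.
rewrite subr_gt0 ltNge; apply/negP => Fc; apply: (h c); first by rewrite ac.
exact: argminsP (le_lt_trans cb bt) Fc.
Qed.

(** On the left of l, F stays above its minimum by a margin, which small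
    increments of x do not exhaust, as F increases with x. *)
Lemma argmins_stable_left t x l : 0 < x -> l < t ->
  (forall s, argmins phi t x s -> l < s) ->
  exists2 d, 0 < d & forall y s, 0 < y -> y < x + d -> argmins phi t y s -> l < s.
Proof.
move=> x0 lt hl; have [hs0 _] := tstarP t x x0; have [st _] := hs0.
set s0 := tstar phi t x in hs0 st; have ts : 0 < t - s0 by rewrite subr_gt0.
have [a [b [_ _ hab]]] := Faction_coercive t x (minF t x + 1) x0.
have al : Num.min a l <= l by rewrite ge_min lexx orbT.
have [|e1 e10 he1] := Faction_gap t x _ _ x0 al lt.
  by move=> s /andP[_ sl] /hl; rewrite ltNge sl.
have [e e0 he] : exists2 e, 0 < e & forall s, s <= l -> minF t x + e <= F t x s.
  exists (Num.min 1 e1) => [|s sl]; first by rewrite lt_min ltr01.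
  have [as_|sa] := leP a s.
    by rewrite (le_trans _ (he1 s _)) ?ge_min ?as_ ?sl// lerD2l ge_min lexx orbT.
  apply: (le_trans _ (ltW (hab s (le_lt_trans sl lt) (or_introl sa)))).
  by rewrite lerD2l ge_min lexx.
have [d d0 [dx de]] : exists2 d, 0 < d & d <= x /\ d * (2 * x) <= e * (t - s0).
  exists (Num.min x (e * (t - s0) / (2 * x))); first by rewrite lt_min x0 divr_gt0 ?mulr_gt0.
  by rewrite -ler_pdivlMr ?mulr_gt0// !ge_min !lexx orbT.
exists d => //.
move=> y s y0 yd hs; rewrite ltNge; apply/negP => sl.
have [yx|xy] := leP y x.
  have := hl _ hs0; rewrite ltNge; apply/negP; rewrite negbK.
  move: yx; rewrite le_eqVlt => /predU1P[yx|yx]; last first.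
    exact: le_trans (argmins_antitone _ _ _ _ _ y0 yx hs hs0) sl.
  by have := hl s; rewrite -yx => /(_ hs); rewrite ltNge sl.
have [st' _] := hs; have h1 := he s sl; have h2 := minF_increment t x y s0 x0 y0 hs0.
have : F t x s <= minF t y.
  rewrite -(argmins_minF _ _ _ y0 hs) (FactionB t x y) lerDl divr_ge0//.
    by rewrite subr_ge0 ler_sqr ?nnegrE ltW.
  by rewrite mulr_ge0// subr_ge0 ltW.
apply/negP; rewrite -ltNge; apply: lt_le_trans h1; apply: (le_lt_trans h2).
rewrite ltrD2l ltr_pdivrMr ?mulr_gt0//.
have xy0 : 0 <= y - x by rewrite subr_ge0 ltW.
have : (y - x) * (y + x) < d * (3 * x).
  apply: ltr_pM => //; first by rewrite addr_ge0 ?ltW.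
    by rewrite ltrBlDl.
  by move: yd dx; clear; lra.
have : 0 < e * (t - s0) by rewrite mulr_gt0.
by move: de; clear; lra.
Qed.

(** Minimum points for y > x / 2 are at most the one for x / 2, hence bounded away
    from t. There, F depends on x in a Lipschitz way. *)
Lemma argmins_stable_right t x r : 0 < x -> r < t ->
  (forall s, argmins phi t x s -> s < r) ->
  exists2 d, 0 < d & forall y s, 0 < y -> x - d < y -> argmins phi t y s -> s < r.
Proof.
move=> x0 rt hr; have x20 : 0 < x / 2 by rewrite divr_gt0.
have [hs2 _] := tstarP t _ x20; have [st2 _] := hs2.
pose b := Num.max r (tstar phi t (x / 2)).
have bt : b < t by rewrite gt_max rt.
have [||e e0 he] := Faction_gap t x r b x0 _ bt; first by rewrite le_max lexx.
  by move=> s /andP[rs _] /hr; rewrite ltNge rs.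
have tb : 0 < t - b by rewrite subr_gt0.
have [d d0 [dx de]] : exists2 d, 0 < d & d <= x / 2 /\ d * x <= e * (t - b).
  exists (Num.min (x / 2) (e * (t - b) / x)); first by rewrite lt_min x20 divr_gt0 ?mulr_gt0.
  by rewrite -ler_pdivlMr// !ge_min !lexx orbT.
exists d => //.
move=> y s y0 yd hs; rewrite ltNge; apply/negP => rs; have [st _] := hs.
have [xy|yx] := leP x y.
  have [hs0 _] := tstarP t x x0.
  move: xy; rewrite le_eqVlt => /predU1P[xy|xy].
    by have := hr s; rewrite xy => /(_ hs); rewrite ltNge rs.
  have := le_trans rs (argmins_antitone _ _ _ _ _ x0 xy hs0 hs).
  by rewrite leNgt hr.
have sb : s <= b.
  rewrite le_max; apply/orP; right.
  by apply: argmins_antitone hs2 hs => //; lra.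
have := he s; rewrite rs sb => /(_ isT); apply/negP; rewrite -ltNge.
rewrite (FactionB t y x s) (argmins_minF _ _ _ y0 hs).
apply: ler_ltD; first exact: minF_le_minF y0 (ltW yx).
have yx2 : 0 <= x ^+ 2 - y ^+ 2 by rewrite subr_ge0 ler_sqr ?nnegrE ltW.
apply: (@le_lt_trans _ _ ((x ^+ 2 - y ^+ 2) / (2 * (t - b)))).
  by rewrite ler_wpM2l// lef_pV2 ?posrE ?mulr_gt0 ?subr_gt0// ler_pM2l// lerD2l lerN2.
rewrite ltr_pdivrMr ?mulr_gt0//.
have : (x - y) * (x + y) < d * (2 * x).
  apply: ltr_pM; rewrite ?subr_ge0 ?(ltW yx) ?addr_ge0 ?ltW//.
    by rewrite ltrBlDr -ltrBlDl.
  by move: yx; clear; lra.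
by move: de; clear; lra.
Qed.

End boundary_action.

(** * The derivative of the minimum of F *)

Section first_order_expansion.
Context {R : realType}.

Lemma derivable_expansion (f : R -> R) (x : R) : derivable f x 1 ->
  forall e, 0 < e -> exists2 d, 0 < d & forall y, `|y - x| < d ->
    `|f y - f x - derive1 f x * (y - x)| <= e * `|y - x|.
Proof.
move=> df e e0; have /cvgrPdist_le/(_ e e0) : (fun h : R => h^-1 *: ((f \o shift x) (h *: (1 : R)) - f x)) @ 0^' --> derive1 f x.
  by rewrite derive1E.
move=> /nbhs_ballP[d d0 hd]; exists d => // y yx.
have [->|xy] := eqVneq y x; first by rewrite !subrr mulr0 subrr normr0 mulr0.
have yx0 : y - x != 0 by rewrite subr_eq0.
have := hd (y - x); rewrite -ball_normE/= sub0r normrN => /(_ yx yx0).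
rewrite /GRing.scale/= mulr1 subrK => h.
rewrite (_ : f y - f x - _ = - (derive1 f x - (y - x)^-1 * (f y - f x)) * (y - x)); last by field.
by rewrite normrM normrN ler_wpM2r.
Qed.

Lemma derivable_of_expansion (f : R -> R) (x l : R) :
  (forall e, 0 < e -> exists2 d, 0 < d & forall y, `|y - x| < d ->
    `|f y - f x - l * (y - x)| <= e * `|y - x|) ->
  derivable f x 1 /\ derive1 f x = l.
Proof.
move=> h.
have c : (fun h : R => h^-1 *: ((f \o shift x) (h *: (1 : R)) - f x)) @ 0^' --> l.
  apply/cvgrPdist_le => e /h[d d0 hd]; apply/nbhs_ballP; exists d => // z.
  rewrite -ball_normE/= sub0r normrN /GRing.scale/= mulr1 => zd z0.
  have := hd (z + x); rewrite addrK => /(_ zd) h1.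
  rewrite -(ler_pM2r (_ : 0 < `|z|)) ?normr_gt0// -normrM.
  rewrite (_ : (l - _) * z = - (f (z + x) - f x - l * z)) ?normrN//.
  by field.
split; first by apply/cvg_ex; exists l.
by rewrite derive1E; apply/cvg_lim.
Qed.

Lemma inv_measurable : measurable_fun setT (fun x : R => x^-1).
Proof.
have -> : [set: R] = [set x | x != 0] `|` [set 0].
  by apply/seteqP; split => // x _ /=; case: (eqVneq x 0) => [->|]; [right|left].
have o0 : open [set x : R | x != 0] by exact: open_neq.
apply/measurable_funU; [exact: open_measurable|exact: measurable_set1|split].
  apply: open_continuous_measurable_fun => // x; rewrite inE => x0.
  exact: inv_continuous.
exact: measurable_fun_set1.
Qed.

End first_order_expansion.

Section boundary_action_derivative.
Context {R : realType}.
Notation mu := (@lebesgue_measure R).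
Context {phi : R -> R} (rphi : regular_boundary phi).
Hypothesis inflow_diverges : forall K, exists S, forall s, s <= S -> inflow phi s <= K.
Implicit Types (t x y s r : R).
Notation M := (minF (phi := phi)).

Lemma inv_sub_close (c e : R) : 0 < c -> 0 < e -> exists2 d, 0 < d & forall z,
  `|z - c| < d -> 0 < z /\ `|z^-1 - c^-1| <= e.
Proof.
move=> c0 e0; pose d := Num.min (c / 2) (e * c ^+ 2 / 2).
have d0 : 0 < d by rewrite lt_min !divr_gt0 ?mulr_gt0 ?exprn_gt0.
have d1 : d <= c / 2 by rewrite ge_min lexx.
have d2 : d <= e * c ^+ 2 / 2 by rewrite ge_min lexx orbT.
exists d => // z zc; have zc2 : c / 2 < z.
  by move: zc; rewrite ltr_norml => /andP[h1 h2]; clear -h1 d1; lra.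
have z0 : 0 < z by apply: lt_trans zc2; rewrite divr_gt0.
split => //; rewrite (_ : z^-1 - c^-1 = - (z - c) / (z * c)); last by field; rewrite !gt_eqF.
rewrite normrM normrN (gtr0_norm (_ : 0 < (z * c)^-1)) ?invr_gt0 ?mulr_gt0//.
rewrite ler_pdivrMr ?mulr_gt0// (le_trans (ltW zc))// (le_trans d2)//.
have : c / 2 * c * e <= z * c * e by rewrite !ler_pM2r// ltW.
clear; lra.
Qed.

(** The increments of minF at x lie between those of two parabolas, given by the
    minimum points for x and for a nearby point, which are close. *)
Lemma minF_derive t x s : 0 < x -> argmins phi t x s ->
  (forall r, argmins phi t x r -> r = s) ->
  derivable (M t) x 1 /\ derive1 (M t) x = x / (t - s).
Proof.
move=> x0 hs uniq; apply: derivable_of_expansion => e e0.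
have [st _] := hs; have ts : 0 < t - s by rewrite subr_gt0.
have e1 : 0 < e / (2 * x) by rewrite divr_gt0// mulr_gt0.
have [d1 d10 hd1] := inv_sub_close _ _ ts e1.
pose d1' := Num.min (d1 / 2) ((t - s) / 2).
have d1'0 : 0 < d1' by rewrite lt_min !divr_gt0.
have d11 : d1' <= d1 / 2 by rewrite ge_min lexx.
have d12 : d1' <= (t - s) / 2 by rewrite ge_min lexx orbT.
have [d2 d20 hd2] : exists2 d, 0 < d & forall y r, 0 < y -> y < x + d ->
    argmins phi t y r -> s - d1' < r.
  apply: (argmins_stable_left rphi inflow_diverges) => //; first by lra.
  by move=> r /uniq ->; lra.
have [d3 d30 hd3] : exists2 d, 0 < d & forall y r, 0 < y -> x - d < y ->
    argmins phi t y r -> r < s + d1'.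
  apply: (argmins_stable_right rphi inflow_diverges) => //; first by lra.
  by move=> r /uniq ->; lra.
pose d := Num.min (Num.min d2 d3) (Num.min (x / 2) (e * (t - s) / 2)).
have d0 : 0 < d by rewrite !lt_min d20 d30 !divr_gt0// mulr_gt0.
have dd2 : d <= d2 by rewrite !ge_min lexx.
have dd3 : d <= d3 by rewrite !ge_min lexx orbT.
have dx : d <= x / 2 by rewrite !ge_min lexx !orbT.
have dts : d <= e * (t - s) / 2 by rewrite !ge_min lexx !orbT.
exists d => // y yxd; have := yxd; rewrite ltr_norml => /andP[yx1 yx2].
have y0 : 0 < y by lra.
have [hr _] := tstarP rphi inflow_diverges t y y0; set r := tstar phi t y in hr.
have r1 : s - d1' < r by apply: (hd2 y) => //; lra.
have r2 : r < s + d1' by apply: (hd3 y) => //; lra.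
have rs : `|(t - r) - (t - s)| < d1 by rewrite ltr_norml; apply/andP; split; lra.
have [tr0 hinv] := hd1 _ rs.
have up := minF_increment rphi inflow_diverges _ _ _ _ x0 y0 hs.
have low := minF_increment rphi inflow_diverges _ _ _ _ y0 x0 hr.
(* the increment of M lies between the chords with slopes given by s and r *)
have eE z : 0 < t - z -> (y ^+ 2 - x ^+ 2) / (2 * (t - z)) =
    (y - x) * (x / (t - z)) + (y - x) ^+ 2 / (2 * (t - z)).
  by move=> z0; field; rewrite gt_eqF.
have low' : (y ^+ 2 - x ^+ 2) / (2 * (t - r)) <= M t y - M t x.
  by move: low; rewrite -(opprB (y ^+ 2)) mulNr lerBrDr => low; rewrite lerBrDr addrC.
have up' : M t y - M t x <= (y ^+ 2 - x ^+ 2) / (2 * (t - s)).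
  by rewrite lerBlDl.
rewrite (eE s ts) in up'; rewrite (eE r tr0) in low'.
have q1 : (y - x) ^+ 2 / (2 * (t - s)) <= e * `|y - x|.
  rewrite -(real_normK (num_real (y - x))) expr2 ler_pdivrMr ?mulr_gt0// mulrAC ler_wpM2r//.
  by apply: (le_trans (ltW yxd)); clear -dts d0; lra.
have q2 : 0 <= (y - x) ^+ 2 / (2 * (t - r)).
  by rewrite divr_ge0 ?sqr_ge0// mulr_ge0// ltW.
have q3 : `|(y - x) * (x / (t - r)) - (y - x) * (x / (t - s))| <= e * `|y - x|.
  rewrite -mulrBr -mulrBr !normrM (ger0_norm (ltW x0)) mulrC ler_wpM2r//.
  have : x * `|(t - r)^-1 - (t - s)^-1| <= x * (e / (2 * x)) by rewrite ler_pM2l.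
  move=> /le_trans; apply; rewrite (_ : x * (e / (2 * x)) = e / 2); last by field; rewrite gt_eqF.
  by clear -e0; lra.
move: up' low' q1 q2 q3; rewrite [x / (t - s) * _]mulrC.
move: ((y - x) ^+ 2 / _) ((y - x) ^+ 2 / _) (_ * (x / (t - s))) (_ * (x / (t - r))) => a b c c'.
move: (M t y - M t x) (e * _) => m k; clear; rewrite !ler_norml => h1 h2 h3 h4 /andP[h5 h6].
apply/andP; split; lra.
Qed.

(** minF lies below the parabola given by s and touches it at x. *)
Lemma derivable_minF_argmin t x s : 0 < x -> derivable (M t) x 1 ->
  argmins phi t x s -> derive1 (M t) x = x / (t - s).
Proof.
move=> x0 dM hs; have [st _] := hs; have ts : 0 < t - s by rewrite subr_gt0.
have inc y := minF_increment rphi inflow_diverges t x y s x0 ^~ hs.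
have eE y : (y ^+ 2 - x ^+ 2) / (2 * (t - s)) =
    (y - x) * (x / (t - s)) + (y - x) ^+ 2 / (2 * (t - s)).
  by field; rewrite gt_eqF.
have key e : 0 < e -> exists2 z, 0 < z & (derive1 (M t) x - e) * z <= z * (x / (t - s)) + e * z /\
    z * (x / (t - s)) - e * z <= (derive1 (M t) x + e) * z.
  move=> e0; have [d d0 hd] := derivable_expansion _ _ dM e e0.
  pose z := Num.min (d / 2) (Num.min (x / 2) (e * (t - s))).
  have z0 : 0 < z by rewrite !lt_min !divr_gt0// mulr_gt0.
  have zd : z <= d / 2 by rewrite !ge_min lexx.
  have zx : z <= x / 2 by rewrite !ge_min lexx !orbT.
  have ze : z <= e * (t - s) by rewrite !ge_min lexx !orbT.
  have zq : z ^+ 2 / (2 * (t - s)) <= e * z.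
    rewrite expr2 ler_pdivrMr ?mulr_gt0// mulrAC ler_pM2r//; clear -ze e0 ts; nra.
  exists z => //; split.
    have := hd (x + z); rewrite [x + z - x]addrC addKr (gtr0_norm z0) => h.
    have {}h : `|M t (x + z) - M t x - derive1 (M t) x * z| <= e * z by apply: h; clear -zd d0; lra.
    have := inc (x + z); rewrite eE [x + z - x]addrC addKr => /(_ (addr_gt0 x0 z0)).
    move: h zq; rewrite ler_norml => /andP[h1 _].
    move: h1; move: (M t _) (M t x) (derive1 _ _ ) (z * (x / _)) (z ^+ 2 / _) => m1 m2 l c q.
    clear; lra.
  have := hd (x - z); rewrite [x - z - x]addrC addKr normrN (gtr0_norm z0) => h.
  have {}h : `|M t (x - z) - M t x - derive1 (M t) x * - z| <= e * z by apply: h; clear -zd d0; lra.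
  have xz : 0 < x - z by clear -zx x0; lra.
  have := inc (x - z) xz; rewrite eE [x - z - x]addrC addKr sqrrN mulNr.
  move: h zq; rewrite ler_norml => /andP[h1 _].
  move: h1; move: (M t _) (M t x) (derive1 _ _ ) (z * (x / _)) (z ^+ 2 / _) => m1 m2 l c q.
  clear; lra.
apply/eqP; rewrite eq_le; apply/andP; split; apply/ler_addgt0Pr => e e0;
  have e2 : 0 < e / 2 by rewrite divr_gt0.
- have [z z0 [h _]] := key _ e2.
  rewrite -(ler_pM2r z0); move: h; move: (derive1 _ _) (x / _) => l c; clear; lra.
- have [z z0 [_ h]] := key _ e2.
rewrite -(ler_pM2r z0); move: h; move: (derive1 _ _) (x / _) => l c; clear; lra.
Qed.

Lemma derivable_minF_argmin_uniq t x s r : 0 < x -> derivable (M t) x 1 ->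
  argmins phi t x s -> argmins phi t x r -> r = s.
Proof.
move=> x0 dM hs hr; have := derivable_minF_argmin _ _ _ x0 dM hs.
rewrite (derivable_minF_argmin _ _ _ x0 dM hr) => /(mulfI _) h.
have /invr_inj : (t - r)^-1 = (t - s)^-1 by apply: h; rewrite gt_eqF.
by move=> /(addrI) /oppr_inj.
Qed.

Lemma usol_minF_derive t x : 0 < x -> derivable (M t) x 1 ->
  usol phi t x = derive1 (M t) x.
Proof.
move=> x0 dM; have [hs _] := tstarP rphi inflow_diverges t x x0.
by rewrite (derivable_minF_argmin _ _ _ x0 dM hs).
Qed.

(** The argmin intervals of distinct points do not overlap, so that only
    countably many are not reduced to a point. *)
Lemma minF_not_derivable_countable t :
  countable [set x | 0 < x /\ ~ derivable (M t) x 1].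
Proof.
pose A (q : rat) := [set x | 0 < x /\ exists s r,
  [/\ argmins phi t x s, argmins phi t x r & s < ratr q < r]].
apply: (@sub_countable _ _ _ (\bigcup_(q in setT) A q)).
  apply: subset_card_le => x [x0 ndx]; apply: contrapT => nA; apply: ndx.
  have [hs _] := tstarP rphi inflow_diverges t x x0.
  suff uniq r : argmins phi t x r -> r = tstar phi t x.
    by have [] := minF_derive t x _ x0 hs uniq.
  move=> hr; apply: contrapT => rs; apply: nA.
  have : tstar phi t x < r \/ r < tstar phi t x.
    by apply/orP; rewrite -neq_lt; apply/eqP => /esym.
  by case=> /rat_in_itvoo[q]; rewrite in_itv/= => qsr; exists q => //; split => //;
    [exists (tstar phi t x), r|exists r, (tstar phi t x)].
apply: bigcup_countable; first exact: countableP.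
move=> q _; have [->|/set0P[x0 hx0]] := eqVneq (A q) set0; first exact: countable0.
have key x y : A q x -> A q y -> ~ x < y.
  move=> [x0' [s [r [hs hr /andP[sq qr]]]]] [y0 [s' [r' [hs' hr' /andP[sq' qr']]]]] xy.
  have := argmins_antitone rphi inflow_diverges _ _ _ _ _ x0' xy hs hr'.
  by rewrite leNgt (lt_trans sq qr').
suff -> : A q = [set x0] by exact: countable1.
apply/seteqP; split => [y Ay|_ ->//].
apply/eqP; rewrite /= eq_le !leNgt; apply/andP; split; apply/negP; exact: key.
Qed.

(** Minimum points decrease in x, so those on the right of x converge to the
    smallest one at x. *)
Lemma usol_right_continuous t x (e : R) : 0 < x -> 0 < e -> exists2 d, 0 < d &
  forall y, x < y -> y < x + d -> `|usol phi t y - usol phi t x| <= e.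
Proof.
move=> x0 e0; have [hs hmin] := tstarP rphi inflow_diverges t x x0.
rewrite /usol; set s := tstar phi t x in hs hmin *.
have [st _] := hs; have ts : 0 < t - s by rewrite subr_gt0.
have e1 : 0 < e / (2 * (x + 1)) by rewrite divr_gt0// mulr_gt0// addr_gt0.
have [d1 d10 hd1] := inv_sub_close _ _ ts e1.
have [d2 d20 hd2] : exists2 d, 0 < d & forall y r, 0 < y -> y < x + d ->
    argmins phi t y r -> s - d1 < r.
  apply: (argmins_stable_left rphi inflow_diverges) => //; first by lra.
  by move=> r /hmin; lra.
pose d := Num.min d2 (Num.min 1 (e * (t - s) / 2)).
have d0 : 0 < d by rewrite !lt_min d20 ltr01 divr_gt0// mulr_gt0.
have dd2 : d <= d2 by rewrite !ge_min lexx.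
have dd1 : d <= 1 by rewrite !ge_min lexx !orbT.
have dd3 : d <= e * (t - s) / 2 by rewrite !ge_min lexx !orbT.
exists d => // y xy yd; have y0 : 0 < y by exact: lt_trans xy.
have [hr _] := tstarP rphi inflow_diverges t y y0; set r := tstar phi t y in hr *.
have r1 : s - d1 < r by apply: (hd2 y) => //; lra.
have r2 : r <= s by apply: (argmins_antitone rphi inflow_diverges t x y).
have rs : `|(t - r) - (t - s)| < d1 by rewrite ltr_norml; apply/andP; split; lra.
have [tr0 hinv] := hd1 _ rs.
have -> : y / (t - r) - x / (t - s) = y * ((t - r)^-1 - (t - s)^-1) + (y - x) / (t - s).
  by field; rewrite !gt_eqF.
apply: (le_trans (ler_normD _ _)); rewrite !normrM (gtr0_norm y0).
rewrite (gtr0_norm (_ : 0 < y - x)) ?subr_gt0// (gtr0_norm (_ : 0 < (t - s)^-1)) ?invr_gt0//.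
have h1 : y * `|(t - r)^-1 - (t - s)^-1| <= e / 2.
  have -> : e / 2 = (x + 1) * (e / (2 * (x + 1))) by field; rewrite gt_eqF// addr_gt0.
  by apply: ler_pM => //; [exact: ltW|lra].
have h2 : (y - x) / (t - s) <= e / 2.
  by rewrite ler_pdivrMr//; clear -dd3 yd; lra.
by move: h1 h2; clear; move: (y * _) (_ / (t - s)) => a b; lra.
Qed.

End boundary_action_derivative.

(** * The potential of the explicit velocity *)

Lemma countable_setU (T : Type) (A B : set T) :
  countable A -> countable B -> countable (A `|` B).
Proof.
move=> cA cB; rewrite -bigcup2E; apply: bigcup_countable => // i _.
by case: i => [|[|i]] //=; exact: countable0.
Qed.

Section explicit_potential.
Context {R : realType}.
Notation mu := (@lebesgue_measure R).

Lemma potential0 (u0 : R -> R) : potential u0 0 = 0.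
Proof. by rewrite /potential set_itv1 Rintegral_set1. Qed.

Context {phi : R -> R} (rphi : regular_boundary phi).
Hypothesis inflow_diverges : forall K, exists S, forall s, s <= S -> inflow phi s <= K.
Implicit Types (t x y s r : R).
Notation M := (minF (phi := phi)).

(** A particle that leaves the boundary at time t - z arrives with speed 1, after a
    time z. *)
Lemma minF_le_linear t y : 0 < y -> exists2 C, 0 < C &
  forall z, 0 < z -> z <= y -> M t z <= C * z.
Proof.
move=> y0; have [C C0 hC] := inflow_lipschitz rphi (t - y) t.
exists ((1 + C) / 2); first by rewrite divr_gt0// ltr_pwDl.
move=> z z0 zy; have tz : t - z < t by rewrite ltrBlDr ltrDl.
apply: (le_trans (minF_le rphi inflow_diverges t z _ z0 tz)).
rewrite (FactionE rphi _ _ _ (ltW tz)).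
have -> : t - (t - z) = z by ring.
have yz : t - y <= t - z by rewrite lerD2l lerN2.
have := hC (t - z) t yz (ltW tz) (lexx t); rewrite (_ : t - (t - z) = z); last by ring.
move=> h.
have -> : z ^+ 2 / (2 * z) = z / 2 by field; rewrite gt_eqF.
by move: h; clear; move: (inflow phi t - _) => a; lra.
Qed.

Lemma usol_gt0 t x : 0 < x -> 0 < usol phi t x.
Proof.
move=> x0; rewrite /usol divr_gt0// subr_gt0.
exact: tstar_lt.
Qed.

Lemma usol_bounded t y : 0 < y -> exists2 C, 0 < C &
  forall z, 0 < z -> z <= y -> usol phi t z <= C.
Proof.
move=> y0; have [C C0 hC] := minF_le_linear t y y0; exists (2 * C) => [|z z0 zy].
  by rewrite mulr_gt0.
have st := tstar_lt rphi inflow_diverges t z z0.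
have := hC z z0 zy; rewrite /minF (FactionE rphi _ _ _ (ltW st)) /usol.
have : 0 <= inflow phi t - inflow phi (tstar phi t z) by rewrite subr_ge0 inflow_le// ltW.
set s := tstar phi t z in st *; have ts : 0 < t - s by rewrite subr_gt0.
have -> : z ^+ 2 / (2 * (t - s)) = z / (t - s) / 2 * z by field; rewrite gt_eqF.
move=> h1 h2; have : z / (t - s) / 2 * z <= C * z.
  by move: h1 h2; move: (_ * z) (_ * z) (_ - inflow phi s) => a b c; clear; lra.
by rewrite ler_pM2r//; move: (z / _) => a; clear; lra.
Qed.

Lemma usol_measurable t y : measurable_fun `[0, y] (usol phi t).
Proof.
pose h z := if 0 < z then tstar phi t z else t.
have hm z1 z2 : z1 <= z2 -> h z2 <= h z1.
  move=> z12; rewrite /h; case: ifPn => [z2p|/negP z2p]; last first.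
    by rewrite ifN//; apply/negP => z1p; apply: z2p; exact: lt_le_trans z12.
  case: ifPn => z1p; last by rewrite ltW// tstar_lt.
  move: z12; rewrite le_eqVlt => /predU1P[->//|z12].
  have [h1 _] := tstarP rphi inflow_diverges t _ z1p.
  have [h2 _] := tstarP rphi inflow_diverges t _ z2p.
  exact: argmins_antitone z1p z12 h1 h2.
have mh : measurable_fun setT h.
  by apply: nonincreasing_measurable => // z1 z2 z12; exact: hm.
have mk : measurable_fun `[0, y] (fun z => z * (t - h z)^-1).
  apply: measurable_funM => //; apply: (measurableT_comp inv_measurable).
  by apply: measurable_funB => //; exact: measurable_funTS.
have e : {in `[0, y]%classic, (fun z => z * (t - h z)^-1) =1 usol phi t}.
  move=> z; rewrite inE/= in_itv/= => /andP[z0 _]; rewrite /usol /h.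
  by case: ltP => // z0'; rewrite (_ : z = 0) ?mul0r//; apply/eqP; rewrite eq_le z0 z0'.
exact: (eq_measurable_fun _ e mk).
Qed.

Lemma usol_integrable t y : 0 < y -> mu.-integrable `[0, y] (EFin \o usol phi t).
Proof.
move=> y0; have [C C0 hC] := usol_bounded t y y0.
apply: (itv_bounded_integrable _ _ _ C); first exact: usol_measurable.
move=> z /andP[z0 zy]; move: z0; rewrite le_eqVlt => /predU1P[<-|z0].
  by rewrite /usol mul0r normr0 ltW.
by rewrite ger0_norm ?hC// ltW// usol_gt0.
Qed.

(** minF is Lipschitz up to the boundary and usol is its derivative off a
    countable set. *)
Lemma potential_usol t y : 0 < y -> potential (usol phi t) y = M t y.
Proof.
move=> y0; have [C C0 hC] := minF_le_linear t y y0.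
pose M0 z := if 0 < z then M t z else 0.
have Mle z1 z2 : 0 < z1 -> z1 <= z2 -> M t z1 <= M t z2.
  move=> z10 z12; have z20 := lt_le_trans z10 z12.
  have [h2 _] := tstarP rphi inflow_diverges t _ z20.
  apply: (le_trans (minF_increment rphi inflow_diverges _ _ _ _ z20 z10 h2)).
  rewrite gerDl mulr_le0_ge0//; first by rewrite subr_le0 ler_sqr ?nnegrE// ltW.
  by rewrite invr_ge0 mulr_ge0// subr_ge0 ltW; case: h2.
have lip z1 z2 : 0 <= z1 -> z1 <= z2 -> z2 <= y -> `|M0 z2 - M0 z1| <= 3 * C * (z2 - z1).
  move=> z10 z12 z2y; rewrite /M0.
  have z3 : 0 <= C * (z2 - z1) by rewrite mulr_ge0 ?subr_ge0// ltW.
  move: z10; rewrite le_eqVlt => /predU1P[z10|z10].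
    rewrite -z10 ltxx subr0; case: ltP => [z20|_]; last first.
      by rewrite normr0 -mulrA; move: z3; rewrite -z10 subr0; clear; move: (C * _) => a; lra.
    rewrite ger0_norm ?minF_ge0// (le_trans (hC _ z20 z2y))//.
    by move: z3; rewrite -z10 subr0; clear; rewrite -mulrA; move: (C * _) => a; lra.
  have z20 := lt_le_trans z10 z12; rewrite z10 z20 ger0_norm ?subr_ge0 ?Mle//.
  have [z2z1|z2z1] := leP z2 (2 * z1); last first.
    have := hC _ z20 z2y; have := minF_ge0 rphi inflow_diverges t z1 z10.
    have : C * z2 <= 2 * (C * (z2 - z1)).
      by rewrite mulrCA ler_pM2l//; clear -z2z1; lra.
    by move: z3; rewrite -mulrA; move: (C * (z2 - z1)) (C * z2) (M t z1) (M t z2); clear => *; lra.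
  have [h1 _] := tstarP rphi inflow_diverges t _ z10.
  have := minF_increment rphi inflow_diverges _ _ _ _ z10 z20 h1.
  rewrite -lerBlDl => /le_trans; apply.
  set s := tstar phi t z1 in h1 *; have [st _] := h1; have ts : 0 < t - s by rewrite subr_gt0.
  have e : z1 ^+ 2 / (2 * (t - s)) <= C * z1.
    apply: le_trans (hC _ z10 (le_trans z12 z2y)).
    rewrite /minF (FactionE rphi _ _ _ (ltW st)) lerDl divr_ge0// subr_ge0.
    by apply: inflow_le => //; exact: ltW.
  have e2 : z1 / (2 * (t - s)) <= C by rewrite -(ler_pM2r z10) mulrAC -expr2.
  rewrite (_ : (z2 ^+ 2 - z1 ^+ 2) / (2 * (t - s)) = (z2 + z1) / (2 * (t - s)) * (z2 - z1)); last first.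
    by field; rewrite gt_eqF.
  rewrite ler_wpM2r ?subr_ge0// (le_trans _ (_ : 3 * (z1 / (2 * (t - s))) <= _))//; last first.
    by rewrite ler_pM2l.
  by rewrite mulrA ler_pM2r ?invr_gt0 ?mulr_gt0//; clear -z2z1; lra.
have acM : absolutely_continuous 0 y M0.
  apply: (lipschitz_absolutely_continuous _ _ (3 * C)) lip.
  by rewrite mulr_ge0// ltW.
have [f [fi fE fae]] := absolutely_continuous_derive _ _ _ (ltW y0) acM.
have -> : M t y = \int[mu]_(z in `[0, y]) f z.
  by have := fE 0 y (lexx _) (ltW y0) (lexx _); rewrite /M0 ltxx y0 subr0.
rewrite /potential /Rintegral; congr fine; apply: ae_eq_integral => //=.
- by apply/measurable_EFinP; exact: usol_measurable.
- by apply: measurable_funTS; case/integrableP: fi.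
have [N [mN N0 hN]] := fae.
pose B := [set x | 0 < x /\ ~ derivable (M t) x 1].
have cB : countable ([set 0; y] `|` B).
  apply: countable_setU; first exact: finite_set_countable.
  exact: minF_not_derivable_countable.
have mB : measurable ([set 0; y] `|` B : set R) by exact: countable_measurable.
exists (N `|` ([set 0; y] `|` B)); split.
- exact: measurableU.
- transitivity (mu N); [apply: (measureU0 mN mB)|exact: N0].
  exact: countable_lebesgue_measure0.
move=> z hz; apply: contrapT => /not_orP[Nz /not_orP[/not_orP[/eqP z0 /eqP zy] Bz]].
apply: hz => /=; rewrite ?in_itv/= => /andP[z0' zy']; congr EFin.
have {}z0 : 0 < z by rewrite lt_neqAle eq_sym z0.
have {}zy : z < y by rewrite lt_neqAle zy.
have dz : derivable (M t) z 1 by apply: contrapT => ndz; apply: Bz.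
rewrite (usol_minF_derive rphi inflow_diverges _ _ z0 dz).
have <- : derive1 M0 z = f z.
  by apply: contrapT => h; apply/Nz/hN => /= hz; apply/h/hz; rewrite in_itv/= z0.
rewrite !derive1E; apply: near_eq_derive; near=> w; rewrite /M0 ifT//.
by near: w; exact: lt_nbhsr.
Unshelve. all: by end_near. Qed.

Lemma usol_L1loc t : L1loc_halfline (usol phi t).
Proof.
move=> x; rewrite le_eqVlt => /predU1P[<-|x0]; last exact: usol_integrable.
rewrite set_itv1; apply: null_set_integrable; [exact: measurable_set1| |].
  exact: measurable_fun_set1.
exact: lebesgue_measure_set1.
Qed.

Lemma usol_Uspace t : Uspace -oo%E (usol phi t).
Proof.
split; first exact: usol_L1loc.
rewrite limf_einfE; apply: (@lt_le_trans _ _ 0%E) => //.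
apply: (@le_trans _ _ (ereal_inf ((fun x : R =>
    (x^-1 * \int[mu]_(y in `[0%R, x]) usol phi t y)%:E) @` `]0, +oo[%classic))).
  apply: le_ereal_inf_tmp => _ [x /= + <-]; rewrite in_itv/= andbT => x0.
  rewrite lee_fin -/(potential _ _) potential_usol//.
  by rewrite mulr_ge0 ?minF_ge0// invr_ge0 ltW.
apply: ereal_sup_ubound; exists `]0, +oo[%classic => //.
by exists 0; split; [exact: num_real|move=> x x0; rewrite /= in_itv/= x0].
Qed.

End explicit_potential.

(** * Solutions of the initial-boundary value problem *)

Section potential_bounds.
Context {R : realType}.
Notation mu := (@lebesgue_measure R).
Implicit Types (u : R -> R) (x y : R).

Lemma L1loc_integrable u x : L1loc_halfline u -> mu.-integrable `[0, x] (EFin \o u).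
Proof.
move=> hu; have [x0|x0] := leP 0 x; first exact: hu.
rewrite set_itv_ge; first exact: integrable_set0.
by rewrite bnd_simp -ltNge.
Qed.

Lemma potentialB u x y : L1loc_halfline u -> 0 <= x -> x <= y ->
  potential u y - potential u x = \int[mu]_(z in `]x, y]) u z.
Proof.
move=> hu x0 xy; apply: (@Rintegral_itvB _ u (BLeft 0) (BRight y) x).
- exact: L1loc_integrable.
- by rewrite bnd_simp.
- by rewrite bnd_simp.
Qed.

Lemma potential_continuous u (Y : R) : L1loc_halfline u -> 0 <= Y ->
  continuous (fun y => potential u (clamp 0 Y y)).
Proof.
move=> hu Y0 y.
have := @parameterized_integral_continuous _ 0 Y u Y0 (L1loc_integrable _ _ hu).
have cin z : `[0, Y]%classic (clamp 0 Y z) by rewrite /= in_itv/= clamp_in.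
move=> /subspace_continuousP/(_ _ (cin y)) h.
have cc : continuous (clamp 0 Y).
  apply: (lipschitz_continuous 1) => // a b ab.
  by rewrite mul1r ger0_norm ?subr_ge0 ?clamp_le// clamp_lip.
have c1 : clamp 0 Y z @[z --> y] --> within `[0, Y] (nbhs (clamp 0 Y y)).
  move=> A hA; have hB : nbhs y (fun z => `[0, Y]%classic (clamp 0 Y z) -> A (clamp 0 Y z)).
    exact: cc y _ hA.
  change (nbhs y (fun z => A (clamp 0 Y z))).
  apply: filterS hB => z h1; exact: (h1 (cin z)).
exact: (cvg_comp _ _ c1 h).
Qed.

(** The lower limit controls the means over [0, y] for y beyond some A', and the
    constant C accounts for the integral over [0, A']. Up to A' a positive slope
    is useless, whence the minimum. *)
Lemma Uspace_potential_ge (p0 : \bar R) u : Uspace p0 u -> (p0 < +oo)%E ->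
  exists p C, [/\ (p0 < p%:E)%E, 0 <= C & forall y, 0 <= y -> Num.min p 0 * y - C <= potential u y].
Proof.
move=> [hu]; rewrite limf_einfE => /ereal_sup_gt[_ [V [A [_ hA]] <-] p0V] p0y.
have [p p0p hp] : exists2 p : R, (p0 < p%:E)%E & (p%:E <= ereal_inf [set
    (x^-1 * \int[mu]_(y in `[0%R, x]) u y)%:E | x in V])%E.
  case: (ereal_inf _) p0V => [r| |] p0V; first by exists r.
    case: p0 p0y {p0V hu} => [r| |] // _.
      by exists (r + 1); rewrite ?lte_fin ?ltrDl// leey.
    by exists 0; rewrite ?ltNyr// leey.
  by move: p0V; rewrite ltNge leNye.
pose A' := Num.max A 0; pose K := \int[mu]_(z in `[0, A']) `|u z|.
have K0 : 0 <= K by apply: Rintegral_ge0.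
exists p, K; split => // y y0.
have p1 : Num.min p 0 * y <= p * y by rewrite ler_wpM2r// ge_min lexx.
have p2 : Num.min p 0 * y <= 0 by rewrite mulr_le0_ge0// ge_min lexx orbT.
have [yA|Ay] := leP y A'.
  have : - K <= potential u y.
    rewrite lerNl; apply: le_trans (ler_norm _) _; rewrite normrN.
    apply: (le_trans (le_normr_Rintegral _ (L1loc_integrable _ y hu))); first exact: measurable_itv.
    have ui : mu.-integrable `[0, A'] (EFin \o (fun z => `|u z|)).
      by apply: integrable_norm; exact: L1loc_integrable.
    rewrite -lee_fin /Rintegral !fineK; last 2 first.
    - by apply: integrable_fin_num; [exact: measurable_itv|exact: ui].
    - apply: integrable_fin_num; first exact: measurable_itv.
      by apply: integrable_norm; exact: L1loc_integrable.
    apply: ge0_subset_integral; [exact: measurable_itv|exact: measurable_itv| | |].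
    + by case/integrableP: ui.
    + by move=> z _; rewrite lee_fin.
    + by apply: subset_itvl; rewrite bnd_simp.
  by move: p2; move: (_ * y) (potential u y); clear => a b; lra.
have yA : A < y by apply: le_lt_trans Ay; rewrite le_max lexx.
have yp : 0 < y by apply: le_lt_trans Ay; rewrite le_max lexx orbT.
have : p <= y^-1 * potential u y.
  rewrite -lee_fin; apply: (le_trans hp); apply: ereal_inf_lbound.
  by exists y => //; exact: hA.
rewrite mulrC ler_pdivlMr// => h; move: p1 h K0; move: (_ * y) (potential u y).
by clear => a b; lra.
Qed.

End potential_bounds.

Lemma derivable_near_shift {R : realType} (f g : R -> R) (x c : R) :
  (\forall y \near x, f y = g y + c) -> derivable g x 1 ->
  derivable f x 1 /\ derive1 f x = derive1 g x.
Proof.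
move=> /nbhs_ballP[d1 d10 h1] dg; apply: derivable_of_expansion => e e0.
have [d2 d20 h2] := derivable_expansion _ _ dg e e0.
exists (Num.min d1 d2); first by rewrite lt_min; apply/andP.
have fg z : `|z - x| < d1 -> f z = g z + c.
  by move=> zx; apply: h1; rewrite -ball_normE /= distrC.
move=> y; rewrite lt_min => /andP[y1 y2].
rewrite !fg ?subrr ?normr0// (_ : g y + c - (g x + c) = g y - g x); last by ring.
exact: h2.
Qed.

Section solutions.
Context {R : realType}.
Notation mu := (@lebesgue_measure R).
Context {phi psi : R -> R} {t0 : R} {u0 v0 : R -> R} {t : R} (t0t : t0 < t).
Implicit Types (x y s : R) (u v : R -> R) (D : set R).

Lemma transported_uniq g (z z' : R) :
  transported psi t0 v0 t g z -> transported psi t0 v0 t g z' -> z = z'.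
Proof.
case=> [[nz ->]|[a [b [ab gab ->]]]] [[nz' ->]|[a' [b' [ab' gab' ->]]]] //.
- have : [set s | t0 <= s <= t /\ g s = 0] a' by rewrite gab' /= in_itv/= lexx.
  by move=> [/nz/eqP].
- have : [set s | t0 <= s <= t /\ g s = 0] a by rewrite gab /= in_itv/= lexx.
  by move=> [/nz'/eqP].
congr psi; apply/eqP; rewrite eq_le; apply/andP; split.
  have : `[a', b']%classic b by rewrite -gab' gab /= in_itv/= ab lexx.
  by rewrite /= in_itv/= => /andP[].
have : `[a, b]%classic b' by rewrite -gab gab' /= in_itv/= ab' lexx.
by rewrite /= in_itv/= => /andP[].
Qed.

Lemma itv_not_countable (a b : R) (B : set R) : a < b -> countable B ->
  exists2 x, a < x < b & ~ B x.
Proof.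
move=> ab cB; apply: contrapT => h.
have : countable `]a, b[%classic.
  apply: sub_countable cB; apply: subset_card_le => x; rewrite /= in_itv/= => xab.
  by apply: contrapT => Bx; apply: h; exists x.
move=> /countable_lebesgue_measure0; rewrite /= lebesgue_measure_itv/= lte_fin ab.
by move=> /eqP; rewrite -EFinD eqe subr_eq0 gt_eqF.
Qed.

(** The value function determines u off the shocks, which are countable and
    hence leave room for right limits; any minimizer determines v. *)
Lemma solution_uniq D u v u' v' : open D ->
  solution_on phi psi t0 u0 v0 D t u v -> solution_on phi psi t0 u0 v0 D t u' v' ->
  (forall x, D x -> u x = u' x) /\
  (forall x, D x -> ~ shocks phi t0 u0 t x -> v x = v' x).
Proof.
move=> oD [cD off sh] [_ off' sh']; split=> x Dx.
  have [shx|nshx] := pselect (shocks phi t0 u0 t x); last first.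
    by have [-> _ _] := off x Dx nshx; have [-> _ _] := off' x Dx nshx.
  have := sh x Dx shx; have := sh' x Dx shx.
  set F := within _ _ => h' h.
  have FF : ProperFilter F.
    split; last exact: within_filter.
    rewrite /F /within /= => Fset0.
    have /nbhs_ballP[d d0 hd] : nbhs x (fun y => x < y -> ~ (~` shocks phi t0 u0 t) y) by exact: Fset0.
    have /nbhs_ballP[e e0 he] : nbhs x D by exact: open_nbhs_nbhs.
    have xde : x < x + Num.min d e by rewrite ltrDl lt_min; apply/andP.
    have [y /andP[xy yde] By] := itv_not_countable _ _ _ xde cD.
    have yd : ball x d y.
      rewrite -ball_normE /= distrC gtr0_norm ?subr_gt0// ltrBlDl.
      by apply: lt_le_trans yde _; rewrite lerD2l ge_min lexx.
    have ye : ball x e y.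
      rewrite -ball_normE /= distrC gtr0_norm ?subr_gt0// ltrBlDl.
      by apply: lt_le_trans yde _; rewrite lerD2l ge_min lexx orbT.
    by apply: (hd y yd xy) => shy; apply: By; split => //; exact: he.
  exact: (cvg_unique _ h h').
move=> nshx; have [_ [g mg] /(_ g mg)[_ tg]] := off x Dx nshx.
have [_ _ /(_ g mg)[_ tg']] := off' x Dx nshx.
exact: transported_uniq tg tg'.
Qed.

Context (rphi : regular_boundary phi).
Hypothesis inflow_diverges : forall K, exists S, forall s, s <= S -> inflow phi s <= K.
Notation M := (minF (phi := phi)).

(** The value function and minF have the same points of differentiability, where
    the minimum point of F is unique and all minimizers have the same terminal
    slope. The open set O serves to compare derivatives, even if D is not open. *)
Lemma explicit_solution_on D (O : set R) (c : R) : open O ->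
  O `<=` [set x | 0 < x] -> D `<=` O ->
  (forall x, O x -> value phi t0 u0 t x = M t x + c) ->
  (forall x, D x -> exists g, minimizer phi t0 u0 t x g) ->
  (forall x g, D x -> minimizer phi t0 u0 t x g -> exists s b,
    [/\ argmins phi t x s, b < t,
        forall r, b <= r <= t -> g r = x - x / (t - s) * (t - r) &
        transported psi t0 v0 t g (psi s)]) ->
  solution_on phi psi t0 u0 v0 D t (usol phi t) (vsol phi psi t).
Proof.
move=> oO O0 DO valO ex mini.
have val_near x : O x -> \forall y \near x, value phi t0 u0 t y = M t y + c.
  move=> Ox; have : nbhs x O by exact: open_nbhs_nbhs.
  by apply: filterS => y /valO.
have dvalM x : O x -> derivable (value phi t0 u0 t) x 1 -> derivable (M t) x 1.
  move=> Ox dv; have near_M : \forall y \near x, M t y = value phi t0 u0 t y + - c.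
  by move: (val_near _ Ox); apply: filterS => y yE; rewrite yE addrK.
  by case: (derivable_near_shift _ _ _ _ near_M dv).
have dMval x : O x -> derivable (M t) x 1 ->
    derivable (value phi t0 u0 t) x 1 /\ derive1 (value phi t0 u0 t) x = derive1 (M t) x.
  by move=> Ox dM; exact: (derivable_near_shift _ _ _ _ (val_near _ Ox) dM).
have nsh x : O x -> ~ shocks phi t0 u0 t x -> derivable (M t) x 1.
  move=> Ox ns; apply: dvalM => //; apply: contrapT => nd; apply: ns; split => //.
  exact: O0.
have uE x : O x -> ~ shocks phi t0 u0 t x ->
    usol phi t x = derive1 (value phi t0 u0 t) x.
  move=> Ox ns; have dM := nsh _ Ox ns; have [_ ->] := dMval _ Ox dM.
  by apply: usol_minF_derive => //; exact: O0.
split.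
- have sub : D `&` shocks phi t0 u0 t `<=` [set x | 0 < x /\ ~ derivable (M t) x 1].
    move=> x [/DO Ox [x0 nd]]; split; first exact: x0.
    by move=> dM; apply: nd; have [dv _] := dMval _ Ox dM; exact: dv.
  exact: sub_countable (subset_card_le sub) (minF_not_derivable_countable rphi inflow_diverges t).
- move=> x Dx ns; have Ox := DO _ Dx; have x0 := O0 _ Ox; split.
  + exact: uE.
  + exact: ex.
  move=> g mg; have [s [b [hs bt gl tr]]] := mini x g Dx mg.
  have [hm _] := tstarP rphi inflow_diverges t x x0.
  have sE := derivable_minF_argmin_uniq rphi inflow_diverges _ _ _ _ x0 (nsh _ Ox ns) hm hs.
  rewrite /vsol -sE; split => //.
  rewrite /usol -sE; apply: cvg_near_cst; near=> r.
  have br : b <= r by near: r; exact: nbhs_left_ge.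
  have rt : r < t by near: r; exact: nbhs_left_lt.
  have -> : g t = x - x / (t - s) * (t - t) by apply: gl; rewrite lexx andbT ltW.
  have -> : g r = x - x / (t - s) * (t - r) by apply: gl; rewrite br ltW.
  have ts : 0 < t - s by rewrite subr_gt0; case: hs.
  have tr0 : 0 < t - r by rewrite subr_gt0.
  by field; rewrite !gt_eqF.
move=> x Dx _; have Ox := DO _ Dx; have x0 := O0 _ Ox.
apply/cvgrPdist_le => e e0.
have [d d0 hd] := usol_right_continuous rphi inflow_diverges t x e x0 e0.
have nO : nbhs x O by exact: open_nbhs_nbhs.
suff : nbhs x (fun y => x < y -> ~ shocks phi t0 u0 t y ->
  `|usol phi t x - derive1 (value phi t0 u0 t) y| <= e) by [].
near=> y => xy ns.
have yO : O y by near: y.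
rewrite -uE// distrC; apply: hd => //.
by near: y; apply: lt_nbhsl; rewrite ltrDl.
Unshelve. all: by end_near. Qed.

End solutions.

(** * The explicit solution is global *)

Section explicit_is_global.
Context {R : realType}.
Context {phi psi : R -> R} (rphi : regular_boundary phi).
Hypothesis inflow_diverges : forall K, exists S, forall s, s <= S -> inflow phi s <= K.
Notation M := (minF (phi := phi)).
Notation Phi := (inflow phi).

Lemma chord_convexity (u v A B : R) : 0 < u -> 0 < v ->
  (A + B) ^+ 2 / (2 * (u + v)) <= A ^+ 2 / (2 * u) + B ^+ 2 / (2 * v).
Proof.
move=> u0 v0; have uv : 0 < u + v by exact: addr_gt0.
rewrite -subr_ge0 (_ : _ - _ = (A * v - B * u) ^+ 2 / (2 * (u * v * (u + v)))).
  by rewrite divr_ge0 ?sqr_ge0// !mulr_ge0// ltW.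
by field; rewrite !gt_eqF.
Qed.

Lemma chord_convexity_eq (u v A B : R) : 0 < u -> 0 < v ->
  A ^+ 2 / (2 * u) + B ^+ 2 / (2 * v) <= (A + B) ^+ 2 / (2 * (u + v)) -> A * v = B * u.
Proof.
move=> u0 v0; have uv : 0 < u + v by exact: addr_gt0.
have h2 (w z : R) : 0 < w -> z / (2 * w) = z / w / 2 by move=> w0; field; rewrite gt_eqF.
rewrite !h2// -mulrDl ler_pM2r ?invr_gt0//.
exact: parallel_slopes.
Qed.

Context {t0 t : R} (t0t : t0 < t).
Notation V := (potential (usol phi t0)).
Notation c := (- (Phi t - Phi t0) / 2).

Lemma potential_usol_ge0 y : 0 <= y -> 0 <= V y.
Proof.
rewrite le_eqVlt => /predU1P[<-|y0]; first by rewrite potential0.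
by rewrite potential_usol// minF_ge0.
Qed.

(** From the boundary at time s to y at time t0 and on to x, the chord is
    the cheaper path. *)
Lemma usol_direct_cost_ge x y s : 0 < x -> 0 < y -> argmins phi t0 y s ->
  Faction phi t x s + c <= direct_cost (usol phi t0) t0 t x y.
Proof.
move=> x0 y0 hs; have [st _] := hs; have ts : 0 < t0 - s by rewrite subr_gt0.
have tt : 0 < t - t0 by rewrite subr_gt0.
rewrite /direct_cost potential_usol// -(argmins_minF rphi inflow_diverges _ _ _ y0 hs).
rewrite (FactionE rphi _ _ _ (ltW st)) (FactionE rphi _ _ _ (ltW (lt_trans st t0t))).
have := chord_convexity (t0 - s) (t - t0) y (x - y) ts tt.
rewrite (_ : y + (x - y) = x); last by ring.
rewrite (_ : t0 - s + (t - t0) = t - s); last by ring.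
move: (x ^+ 2 / _) (y ^+ 2 / _) ((x - y) ^+ 2 / _) (Phi t) (Phi t0) (Phi s) => *; lra.
Qed.

Lemma usol_boundary_cost_ge x y a b : 0 < x -> boundary_visit t0 t y a b ->
  V y + Faction phi t x b + c <= boundary_cost phi (usol phi t0) t0 t x y a b.
Proof.
move=> x0 [ta ab bt y0 ya].
rewrite /boundary_cost (FactionE rphi _ _ _ (ltW bt)).
have : 0 <= y ^+ 2 / (2 * (a - t0)).
  by rewrite divr_ge0 ?sqr_ge0// mulr_ge0// subr_ge0.
have := inflow_le rphi _ _ ta.
move: (x ^+ 2 / _) (y ^+ 2 / _) (V y) (Phi t) (Phi t0) (Phi a) (Phi b) => *; lra.
Qed.

Lemma usol_cost_lower_bound x : 0 < x -> cost_lower_bound phi (usol phi t0) t0 t x (M t x + c).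
Proof.
move=> x0; split=> [y|y a b vis].
  rewrite le_eqVlt => /predU1P[<-|y0].
    have := minF_le rphi inflow_diverges t x t0 x0 t0t.
    rewrite (FactionE rphi _ _ _ (ltW t0t)) /direct_cost potential0 subr0.
    by move: (M t x) (x ^+ 2 / _) (Phi t) (Phi t0) => *; lra.
  have [hs _] := tstarP rphi inflow_diverges t0 y y0; have [st _] := hs.
  apply: le_trans (usol_direct_cost_ge _ _ _ x0 y0 hs); rewrite lerD2r.
  by apply: minF_le => //; exact: lt_trans t0t.
have [ta ab bt y0 ya] := vis.
apply: le_trans (usol_boundary_cost_ge _ _ _ _ x0 vis); rewrite lerD2r.
by rewrite (le_trans (minF_le rphi inflow_diverges t x b x0 bt))// lerDr potential_usol_ge0.
Qed.

Lemma usol_cost_attained x : 0 < x ->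
  (exists2 y, 0 <= y & direct_cost (usol phi t0) t0 t x y <= M t x + c) \/
  (exists y a b, boundary_visit t0 t y a b /\
     boundary_cost phi (usol phi t0) t0 t x y a b <= M t x + c).
Proof.
move=> x0; have st := tstar_lt rphi inflow_diverges t x x0.
rewrite /minF; set s := tstar phi t x in st *; rewrite (FactionE rphi _ _ _ (ltW st)).
have [t0s|st0] := leP t0 s; [right|left].
  exists 0, t0, s; split; first by split.
  rewrite /boundary_cost potential0 subrr mulr0 invr0 mulr0.
  by move: (x ^+ 2 / _) (Phi t) (Phi t0) (Phi s) => *; lra.
have ts : 0 < t - s by rewrite subr_gt0.
have t0s : 0 < t0 - s by rewrite subr_gt0.
have tt : 0 < t - t0 by rewrite subr_gt0.
pose y := x * (t0 - s) / (t - s).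
have y0 : 0 < y by rewrite !divr_gt0 ?mulr_gt0.
exists y; first exact: ltW.
rewrite /direct_cost potential_usol//.
have := minF_le rphi inflow_diverges t0 y s y0 st0.
rewrite (FactionE rphi _ _ _ (ltW st0)).
have : x ^+ 2 / (2 * (t - s)) = y ^+ 2 / (2 * (t0 - s)) + (x - y) ^+ 2 / (2 * (t - t0)).
  by rewrite /y; field; rewrite !gt_eqF.
move: (M t0 y) (x ^+ 2 / _) (y ^+ 2 / _) ((x - y) ^+ 2 / _) (Phi t) (Phi t0) (Phi s) => *; lra.
Qed.

(** Prepending an optimal path of F to a path of the initial-value problem
    yields a path that enters the computation of minF at time t. *)
Lemma explicit_solution_global :
  solution_on phi psi t0 (usol phi t0) (vsol phi psi t0) `]0, +oo[ t
    (usol phi t) (vsol phi psi t).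
Proof.
have pos : `]0, +oo[%classic `<=` [set x : R | 0 < x].
  by move=> x; rewrite /= in_itv/= andbT.
have val x : 0 < x -> value phi t0 (usol phi t0) t x = M t x + c /\
    exists g, minimizer phi t0 (usol phi t0) t x g.
  by move=> x0; apply: value_eq => //; [exact: usol_cost_lower_bound|exact: usol_cost_attained].
apply: (explicit_solution_on rphi inflow_diverges _ `]0, +oo[ c) => //.
- by move=> x /pos/val[].
- by move=> x /pos/val[].
move=> x g /pos x0 mg; have [vE _] := val _ x0.
have V_lb y : 0 <= y -> - 0 * y - 0 <= V y.
  by move=> /potential_usol_ge0; rewrite oppr0 mul0r addr0.
have [[nz gl vd _]|[a [b [vis zE gl vd _]]]] :=
  minimizer_cases rphi (usol phi t0) t0t (lexx 0) V_lb _ _ x0 mg.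
  have [[_ g0 _] _] := mg.
  have t00 : t0 <= t0 <= t by rewrite lexx ltW.
  have y0 : 0 < g t0 by rewrite lt_neqAle eq_sym nz// g0.
  have [hs _] := tstarP rphi inflow_diverges t0 _ y0; have [st _] := hs.
  set s := tstar phi t0 (g t0) in hs st.
  have st' := lt_trans st t0t.
  have hst : argmins phi t x s.
    apply: (argminsP rphi inflow_diverges) => //.
    by rewrite -(lerD2r c) -vE vd usol_direct_cost_ge.
  have ts : 0 < t0 - s by rewrite subr_gt0.
  have tt : 0 < t - t0 by rewrite subr_gt0.
  have tss : 0 < t - s by rewrite subr_gt0.
  (* the two segments through (t0, g t0) have the same slope *)
  have yE : g t0 * (t - t0) = (x - g t0) * (t0 - s).
    apply: chord_convexity_eq => //.
    rewrite (_ : g t0 + (x - g t0) = x); last by ring.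
    rewrite (_ : t0 - s + (t - t0) = t - s); last by ring.
    move: vd; rewrite vE /direct_cost potential_usol//.
    rewrite -(argmins_minF rphi inflow_diverges _ _ _ y0 hs).
    rewrite -(argmins_minF rphi inflow_diverges _ _ _ x0 hst).
    rewrite (FactionE rphi _ _ _ (ltW st)) (FactionE rphi _ _ _ (ltW st')).
    move: (x ^+ 2 / _) (g t0 ^+ 2 / _) ((x - g t0) ^+ 2 / _) (Phi t) (Phi t0) (Phi s) => *; lra.
  have slope : (x - g t0) / (t - t0) = x / (t - s).
    have e : x * (t - t0) = (x - g t0) * (t - s) by move: yE; move: (g t0) => *; lra.
    by apply/eqP; rewrite eqr_div ?lt0r_neq0// -e.
  exists s, t0; split => //.
    by move=> r rt; rewrite gl// slope.
  by left; split.
have [ta ab bt y0 ya] := vis.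
exists b, b; split => //; last by right; exists a, b; split.
apply: (argminsP rphi inflow_diverges) => //.
rewrite -(lerD2r c) -vE vd; apply: le_trans (usol_boundary_cost_ge _ _ _ _ x0 vis).
by rewrite lerD2r lerDr potential_usol_ge0.
Qed.

End explicit_is_global.

(** * Pullback attraction *)

Lemma inflow0 {R : realType} (phi : R -> R) : inflow phi 0 = 0.
Proof. by rewrite /inflow lexx set_itv1 Rintegral_set1. Qed.

(** As s tends to -oo, the mean of phi_+^2 over [s, 0] has a lower limit of at
    least q ^+ 2; the integral over [s, 0] is - inflow phi s. *)
Definition inflow_growth {R : realType} (phi : R -> R) (q : R) : Prop :=
  forall p, p < q ^+ 2 -> exists T, forall s, s <= T -> inflow phi s <= p * s.

Lemma growth_diverges {R : realType} (phi : R -> R) (q : R) : 0 < q ->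
  inflow_growth phi q ->
  forall K, exists S, forall s, s <= S -> inflow phi s <= K.
Proof.
move=> q0 gr K; have q2 : 0 < q ^+ 2 / 2 by rewrite divr_gt0 ?exprn_gt0.
have [|T hT] := gr (q ^+ 2 / 2); first by lra.
exists (Num.min T (K / (q ^+ 2 / 2))) => s; rewrite le_min => /andP[sT sK].
by rewrite (le_trans (hT _ sT))// mulrC -ler_pdivlMr.
Qed.

Section arrival_cost.
Context {R : realType}.
Context {phi : R -> R} (rphi : regular_boundary phi) (u0 : R -> R) (hu : L1loc_halfline u0).
Context {p C : R} (p0 : 0 <= p) (C0 : 0 <= C).
Hypothesis u0_ge : forall y : R, 0 <= y -> - p * y - C <= potential u0 y.
Context {t0 S : R} (t0S : t0 < S).
Notation V := (potential u0).
Notation Phi := (inflow phi).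

(** The part of the cost of a path that is paid before its arrival at the
    boundary, compared with staying at the boundary from the beginning. *)
Definition arrival_cost (phi u0 : R -> R) (t0 y a : R) : R :=
  potential u0 y + y ^+ 2 / (2 * (a - t0)) + (inflow phi a - inflow phi t0) / 2.

Let k := arrival_cost phi u0 t0.

Let inflow_ge0 a : t0 <= a -> 0 <= (Phi a - Phi t0) / 2.
Proof. by move=> ta; rewrite divr_ge0// subr_ge0 inflow_le. Qed.

(** From afar, the kinetic energy spent before time S exceeds what the potential
    may give. *)
Let k_large y a (Y : R) : t0 < a -> a <= S -> Y = 2 * (S - t0) * (p + C + 1) + 1 ->
  Y <= y -> 0 < k y a.
Proof.
move=> ta aS YE Yy; have St : 0 < S - t0 by rewrite subr_gt0.
have pC : 0 < p + C + 1 by rewrite ltr_wpDl// addr_ge0.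
have Y1 : 1 <= Y by rewrite YE lerDr !mulr_ge0// ltW.
have y1 : 1 <= y := le_trans Y1 Yy; have y0 : 0 < y := lt_le_trans ltr01 y1.
have at0 : 0 < a - t0 by rewrite subr_gt0.
have h1 := u0_ge _ (ltW y0); have h2 := inflow_ge0 _ (ltW ta).
have h3 : y * (p + C + 1) <= y ^+ 2 / (2 * (a - t0)).
  rewrite ler_pdivlMr ?mulr_gt0// expr2 -mulrA ler_pM2l//.
  rewrite (le_trans _ Yy)// YE mulrC.
  have : 2 * (a - t0) * (p + C + 1) <= 2 * (S - t0) * (p + C + 1).
    by rewrite ler_pM2r// ler_pM2l// lerD2r.
  by move=> h; rewrite (le_trans h)// lerDl.
have h4 : C + 1 <= y * (C + 1).
  by rewrite ler_peMl// addr_ge0.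
rewrite /k /arrival_cost; move: h1 h2 h3 h4.
move: (V y) (y ^+ 2 / _) (_ / 2) => v e f h1 h2 h3 h4.
have : y * (p + C + 1) = p * y + y * (C + 1) by ring.
move=> h5; rewrite h5 in h3; move: h1 h2 h3 h4; rewrite mulNr.
by move: (p * y) (y * (C + 1)) => A B; lra.
Qed.

(** Near time t0, either y is small and so is its potential, or the path is so
    fast that its kinetic energy dominates. *)
Let k_near (iota : R) : iota < 0 -> exists2 eta, 0 < eta &
  forall y a : R, 0 <= y -> t0 < a -> a <= t0 + eta -> iota < k y a.
Proof.
move=> i0.
have [d d0 hd] : exists2 d, 0 < d & forall y, 0 <= y -> y < d -> iota < V y.
  have /(_ 0) := potential_continuous _ _ hu (@ler01 R).
  rewrite /continuous_at.
  have -> : potential u0 (clamp 0 1 0) = 0 by rewrite clamp_id// potential0.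
  move=> /cvgrPdist_lt/(_ (- iota)); rewrite oppr_gt0 => /(_ i0)/nbhs_ballP[d d0 hd].
  exists (Num.min d 1); first by rewrite lt_min d0 ltr01.
  move=> y y0; rewrite lt_min => /andP[yd y1].
  have := hd y; rewrite -ball_normE/= !sub0r !normrN (ger0_norm y0) => /(_ yd).
  rewrite /= clamp_id ?y0 ?(ltW y1)//.
  by rewrite ltr_norml opprK => /andP[].
have pC : 0 < p * d + C + 1 by rewrite ltr_wpDl// addr_ge0// mulr_ge0// ltW.
pose eta := d ^+ 2 / (2 * (p * d + C + 1)).
have eta0 : 0 < eta by rewrite divr_gt0 ?exprn_gt0// mulr_gt0.
exists eta => // y a y0 ta ae.
have at0 : 0 < a - t0 by rewrite subr_gt0.
have h2 := inflow_ge0 _ (ltW ta).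
have h3 : 0 <= y ^+ 2 / (2 * (a - t0)) by rewrite divr_ge0 ?sqr_ge0// mulr_ge0// ltW.
have [yd|dy] := ltP y d.
  by have := hd y y0 yd; rewrite /k /arrival_cost; move: (V y) (y ^+ 2 / _) (_ / 2) h2 h3 => *; lra.
have h1 := u0_ge _ y0; have y0' : 0 < y := lt_le_trans d0 dy.
have yd1 : 1 <= y / d by rewrite ler_pdivlMr// mul1r.
have h4 : (y / d) ^+ 2 * (p * d + C + 1) <= y ^+ 2 / (2 * (a - t0)).
  have ae' : a - t0 <= eta by rewrite lerBlDl.
  rewrite ler_pdivlMr ?mulr_gt0// expr_div_n.
  rewrite (_ : y ^+ 2 / d ^+ 2 * (p * d + C + 1) * (2 * (a - t0)) =
     y ^+ 2 * ((a - t0) / eta)); last by rewrite /eta; field; rewrite !gt_eqF.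
  by rewrite ler_piMr ?sqr_ge0// ler_pdivrMr// mul1r.
have h5 : p * y + C + 1 <= (y / d) ^+ 2 * (p * d + C + 1).
  have h6 : y / d * (p * d) = p * y by field; rewrite gt_eqF.
  have h7 : y / d <= (y / d) ^+ 2 by rewrite expr2 ler_peMl// divr_ge0// ltW.
  have h8 : 1 <= (y / d) ^+ 2 := le_trans yd1 h7.
  have h9 : 0 <= p * d by rewrite mulr_ge0// ltW.
  have : (y / d) * (p * d) <= (y / d) ^+ 2 * (p * d) by rewrite ler_wpM2r.
  have : 1 * (C + 1) <= (y / d) ^+ 2 * (C + 1) by rewrite ler_wpM2r// addr_ge0.
  by rewrite h6; move: ((y / d) ^+ 2) (p * y) (p * d) => *; lra.
rewrite /k /arrival_cost; move: h1 h2 h4 h5; rewrite mulNr.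
by move: (_ ^+ 2 * _) (p * y) (V y) (y ^+ 2 / _) (_ / 2) => *; lra.
Qed.

Let k_continuous (e Y : R) : 0 < e -> t0 + e <= S -> 0 <= Y ->
  continuous (fun z : R * R => k (clamp 0 Y z.2) (clamp (t0 + e) S z.1)).
Proof.
move=> e0 eS Y0 z; have cc (a b : R) (ab : a <= b) : continuous (clamp a b).
  apply: (lipschitz_continuous 1) => // v w vw.
  by rewrite mul1r ger0_norm ?subr_ge0 ?clamp_le// clamp_lip.
have c1 : clamp (t0 + e) S z'.1 @[z' --> z] --> clamp (t0 + e) S z.1.
  by apply: (@continuous_comp _ _ _ fst (clamp _ _) z); [exact: cvg_fst|exact: cc].
have c2 : clamp 0 Y z'.2 @[z' --> z] --> clamp 0 Y z.2.
  by apply: (@continuous_comp _ _ _ snd (clamp _ _) z); [exact: cvg_snd|exact: cc].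
have a0 : 2 * (clamp (t0 + e) S z.1 - t0) != 0.
  have /andP[h _] := clamp_in eS z.1; rewrite mulf_neq0// subr_eq0 gt_eqF//; lra.
rewrite /k /arrival_cost; apply: cvgD; first apply: cvgD.
- apply: (@continuous_comp _ _ _ snd (fun y => V (clamp 0 Y y)) z); first exact: cvg_snd.
  exact: potential_continuous.
- apply: cvgM; first by rewrite expr2; apply: cvgM.
  by apply: cvgV => //; apply: cvgM; [exact: cvg_cst|apply: cvgB => //; exact: cvg_cst].
- apply: cvgM; last exact: cvg_cst.
  apply: cvgB; last exact: cvg_cst.
  apply: (@continuous_comp _ _ _ (fun z : R * R => clamp (t0 + e) S z.1) Phi z) => //.
  exact: inflow_continuous.
Qed.

Definition arrival (t0 S y a : R) : Prop :=
  [/\ t0 <= a, a <= S, 0 <= y & a = t0 -> y = 0].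

Let k_start y a : arrival t0 S y a -> a = t0 -> k y a = 0.
Proof.
move=> [_ _ _ ya] at0; rewrite /k /arrival_cost (ya at0) at0 potential0.
by rewrite expr0n/= mul0r subrr mul0r !addr0.
Qed.

(** If some arrival has a negative cost then it does better than starting from
    afar and than arriving immediately after t0, so the minimum is taken over a
    compact set of times and positions. Otherwise the minimum is 0. *)
Lemma arrival_cost_min : exists y a, [/\ arrival t0 S y a,
  arrival_cost phi u0 t0 y a <= 0 &
  forall y' a', arrival t0 S y' a' ->
    arrival_cost phi u0 t0 y a <= arrival_cost phi u0 t0 y' a'].
Proof.
have arr0 : arrival t0 S 0 t0 by split => //; exact: ltW.
have [[y1 [a1 [arr1 k1]]]|h] := pselect (exists y a, arrival t0 S y a /\ k y a < 0); last first.
  exists 0, t0; have k0 := k_start _ _ arr0 erefl; split => //; rewrite -/(k 0 t0) k0//.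
  by move=> y' a' arr'; rewrite leNgt; apply/negP => kn; apply: h; exists y', a'.
have ta1 : t0 < a1.
  have [ta _ _ _] := arr1; rewrite lt_neqAle ta andbT; apply/eqP => /esym at0.
  by move: k1; rewrite (k_start _ _ arr1 at0) ltxx.
have [e e0 he] := k_near _ k1.
have [_ a1S y10 _] := arr1.
pose e' := Num.min e (a1 - t0).
have e'0 : 0 < e' by rewrite lt_min e0 subr_gt0.
have e'a : t0 + e' <= a1 by rewrite -lerBrDl ge_min lexx orbT.
have e'S : t0 + e' <= S := le_trans e'a a1S.
pose Y := 2 * (S - t0) * (p + C + 1) + 1.
have Y0 : 0 <= Y by rewrite /Y addr_ge0// !mulr_ge0 ?subr_ge0 ?(ltW t0S)// addr_ge0// addr_ge0.
have y1Y : y1 <= Y.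
  rewrite leNgt; apply/negP => /ltW Yy.
  have := k_large y1 a1 Y ta1 a1S erefl Yy; by move: k1; move: (k _ _) => ? *; lra.
have cK : compact (`[t0 + e', S] `*` `[0, Y] : set (R * R)).
  by apply: compact_setX; exact: segment_compact.
have K0 : (`[t0 + e', S] `*` `[0, Y] : set (R * R)) !=set0.
  by exists (a1, y1); split; rewrite /= in_itv/=; apply/andP.
have [z /set_mem[]] := compact_EVT_min K0 cK
    (continuous_subspaceT (k_continuous e' Y e'0 e'S Y0)).
rewrite /= !in_itv/= => /andP[z1 z1'] /andP[z2 z2'] hz.
rewrite !clamp_id ?z1 ?z1' ?z2 ?z2'// in hz.
have kz : k z.2 z.1 <= k y1 a1.
  have := hz (a1, y1); rewrite /= !clamp_id ?e'a ?a1S ?y10 ?y1Y//; apply.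
  by rewrite inE; split; rewrite /= in_itv/=; apply/andP.
have arrz : arrival t0 S z.2 z.1.
  by split => //; [lra|move=> h; move: z1; rewrite h gerDl leNgt e'0].
exists z.2, z.1; split => //; first by apply: (le_trans kz); exact: ltW.
move=> y' a' arr'; rewrite -/(k z.2 z.1) -/(k y' a').
have [ta' a'S y'0 _] := arr'.
have [at0|at0] := eqVneq a' t0.
  by rewrite (k_start _ _ arr' at0) (le_trans kz)// ltW.
have {}ta' : t0 < a' by rewrite lt_neqAle eq_sym at0.
have [ae|ea] := ltP a' (t0 + e').
  apply: (le_trans kz); apply: ltW; apply: he => //.
  by rewrite (le_trans (ltW ae))// lerD2l ge_min lexx.
have [yY|Yy] := leP y' Y; last first.
  apply: (le_trans kz); apply: (le_trans (ltW k1)); apply: ltW.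
  exact: (k_large y' a' Y ta' a'S erefl (ltW Yy)).
have := hz (a', y'); rewrite /= !clamp_id ?ea ?a'S ?y'0 ?yY//; apply.
by rewrite inE; split; rewrite /= in_itv/=; apply/andP.
Qed.

End arrival_cost.

Section pullback.
Context {R : realType}.
Context {phi : R -> R} (psi : R -> R) (rphi : regular_boundary phi).
Context {q : R} (q0 : 0 < q) (growth : inflow_growth phi q).
Notation V := potential.
Notation Phi := (inflow phi).
Notation F := (Faction phi).
Notation M := (minF (phi := phi)).

Let inflow_diverges := growth_diverges phi q q0 growth.

Lemma boundary_costE u0 t0 t x y a b : b <= t ->
  boundary_cost phi u0 t0 t x y a b =
  arrival_cost phi u0 t0 y a + F t x b - (Phi t - Phi t0) / 2.
Proof.
move=> bt; rewrite /boundary_cost /arrival_cost (FactionE rphi)//.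
by move: (V u0 y) (y ^+ 2 / _) (x ^+ 2 / _) (Phi a) (Phi b) (Phi t) (Phi t0) => *; lra.
Qed.

(** Over a long time, a path that does not stop at the boundary saves at most
    p^2/2 per unit of time thanks to its initial condition, less than what
    the boundary yields. Optimal paths hence visit the boundary before the
    smallest minimum point S of F for a point beyond r, and what they do
    afterwards does not depend on the data. *)
Lemma pullback_attraction (t r p C : R) : 0 <= p -> p < q -> 0 <= C -> 0 < r ->
  exists T, forall t0, t0 < T -> forall u0 v0, L1loc_halfline u0 ->
    (forall y : R, 0 <= y -> - p * y - C <= V u0 y) ->
    solution_on phi psi t0 u0 v0 `]0, r] t (usol phi t) (vsol phi psi t).
Proof.
move=> p0 pq C0 r0; pose rho := r + 1.
have rho0 : 0 < rho by rewrite addr_gt0.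
have St := tstar_lt rphi inflow_diverges t rho rho0.
pose S := tstar phi t rho; rewrite -/S in St.
have [T0 hT0] := growth ((p ^+ 2 + q ^+ 2) / 2) ltac:(
  rewrite ltr_pdivrMr// mulr_natr mulr2n ltrD2r ltr_sqr ?nnegrE ?(ltW q0)//).
(* twice what waiting gains over going straight, per unit of time, if the mean of
   phi_+^2 is at least (p ^+ 2 + q ^+ 2) / 2 *)
pose dlt := (q ^+ 2 - p ^+ 2) / 2.
have dlt0 : 0 < dlt.
  by rewrite divr_gt0// subr_gt0 ltr_sqr ?nnegrE ?(ltW q0).
pose K := 2 * (C + p * rho + M t rho) + p ^+ 2 * t - Phi S.
exists (Num.min T0 (Num.min S (- K / dlt))) => t0.
rewrite !lt_min => /and3P[t0T t0S t0K] u0 v0 hu u0_ge.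
have t0t := lt_trans t0S St.
(* a direct path gains less than the boundary yields before S *)
have far : C + p * rho + M t rho + p ^+ 2 * (t - t0) / 2 < (Phi S - Phi t0) / 2.
  have := hT0 _ (ltW t0T); move: t0K; rewrite ltr_pdivlMr// /K /dlt.
  move: (p ^+ 2) (q ^+ 2) (p * rho) (M t rho) (Phi S) (Phi t0) => p2 q2 pr m a b.
  by clear; nra.
(* a cheapest way to the boundary, which does not depend on the terminal point *)
have [ys [as_ [[ta aS ys0 ya] k0 kmin]]] := arrival_cost_min rphi u0 hu p0 C0 u0_ge t0S.
set k := arrival_cost phi u0 t0 ys as_ in k0 kmin.
pose c := k - (Phi t - Phi t0) / 2.
have St_le : Phi S <= Phi t by apply: inflow_le => //; exact: ltW.
have mrho := minF_ge0 rphi inflow_diverges t rho rho0.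
have prho : 0 <= p * rho by rewrite mulr_ge0// ltW.
have p2 : 0 <= p ^+ 2 by rewrite sqr_ge0.
have direct_gt x y : 0 < x -> x < rho -> 0 <= y ->
    M t x + c < direct_cost u0 t0 t x y.
  move=> x0 xr y0; apply: lt_le_trans (direct_cost_ge u0 t0t u0_ge x y y0).
  have := minF_le_minF rphi inflow_diverges t x rho x0 (ltW xr).
  have : p * x <= p * rho by rewrite ler_wpM2l// ltW.
  move: far St_le k0; rewrite /c; clear.
  move: (p ^+ 2 * _ / 2) (p * rho) (p * x) (M t x) (M t rho) (Phi S) (Phi t0) (Phi t) k => *.
  lra.
have arrival_ge y a b : boundary_visit t0 t y a b -> k <= arrival_cost phi u0 t0 y a.
  move=> [ta' ab bt y0 ya']; have [aS'|Sa] := leP a S; first exact: kmin.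
  apply: (le_trans k0); rewrite /arrival_cost.
  have := arrival_cost_ge u0 u0_ge y a y0 ta' ya'.
  have : Phi S <= Phi a by apply: inflow_le => //; exact: ltW.
  have : p ^+ 2 * (a - t0) <= p ^+ 2 * (t - t0).
    by rewrite ler_wpM2l// lerD2r; apply: ltW; exact: le_lt_trans ab bt.
  move: far mrho prho; clear.
  move: (p ^+ 2 * (a - t0)) (p ^+ 2 * (t - t0)) (p * rho) (M t rho) (Phi S) (Phi t0) (Phi a).
  move: (V u0 y) (y ^+ 2 / _) C.
  move=> *; lra.
have val x : 0 < x -> x < rho -> value phi t0 u0 t x = M t x + c /\
    exists g, minimizer phi t0 u0 t x g.
  move=> x0 xr; apply: value_eq => //.
    split=> [y y0|y a b vis]; first exact/ltW/direct_gt.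
    have [_ _ bt _ _] := vis; rewrite (boundary_costE _ _ _ _ _ _ _ (ltW bt)) /c.
    have := arrival_ge _ _ _ vis; have := minF_le rphi inflow_diverges t x b x0 bt.
    by move: (M t x) (F t x b) (arrival_cost _ _ _ _ _) (Phi t) (Phi t0) => *; lra.
  right; exists ys, as_, (tstar phi t x).
  have st := tstar_lt rphi inflow_diverges t x x0; split.
    split => //; apply: (le_trans aS).
    have [hr _] := tstarP rphi inflow_diverges t rho rho0.
    have [hx _] := tstarP rphi inflow_diverges t x x0.
    exact: (argmins_antitone rphi inflow_diverges t x rho).
  rewrite (boundary_costE _ _ _ _ _ _ _ (ltW st)) -/k /c.
  by rewrite -addrA addrCA.
apply: (explicit_solution_on rphi inflow_diverges _ `]0, rho[ c) => //.
- by move=> x; rewrite /= in_itv/= => /andP[].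
- move=> x; rewrite /= !in_itv/= => /andP[-> xr]; apply: (le_lt_trans xr).
  by rewrite ltrDl.
- by move=> x; rewrite /= in_itv/= => /andP[x0 xr]; case: (val x x0 xr).
- move=> x; rewrite /= in_itv/= => /andP[x0 xr]; have [] // := val x x0.
  by rewrite (le_lt_trans xr)// ltrDl.
move=> x g; rewrite /= in_itv/= => /andP[x0 xr] mg.
have {}xr : x < rho by rewrite (le_lt_trans xr)// ltrDl.
have [vE _] := val x x0 xr.
have [[nz gl vd _]|[a [b [vis zE gl vd _]]]] :=
  minimizer_cases rphi u0 t0t p0 u0_ge _ _ x0 mg.
  have [[_ g0 _] _] := mg.
  have y0 : 0 <= g t0 by apply: g0; rewrite lexx ltW.
  by have := direct_gt x (g t0) x0 xr y0; rewrite -vE vd ltxx.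
have [ta' ab bt y0 ya'] := vis.
exists b, b; split => //; last by right; exists a, b; split.
apply: (argminsP rphi inflow_diverges _ _ _ x0 bt).
have saved (k' m f a' e : R) : k' <= a' -> m + (k' - e) = a' + f - e -> f <= m.
  by move=> ka; rewrite addrA => /addIr e'; rewrite -(lerD2r k') e' addrC lerD2r.
apply: (saved k _ _ (arrival_cost phi u0 t0 (g t0) a) ((Phi t - Phi t0) / 2)).
  exact: arrival_ge vis.
by rewrite -(boundary_costE _ _ _ _ _ _ _ (ltW bt)) -vd -/c -vE.
Qed.

End pullback.

(** * Velocities of global solutions *)

Section potential_slopes.
Context {R : realType}.
Notation mu := (@lebesgue_measure R).
Implicit Types (u : R -> R) (x y c : R).

Lemma potential_slope_le u (N : set R) x y c : L1loc_halfline u -> countable N ->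
  0 <= x -> x <= y -> (forall z, x < z -> z < y -> ~ N z -> u z <= c) ->
  potential u y - potential u x <= c * (y - x).
Proof.
move=> hu cN x0 xy h; rewrite potentialB//.
pose N' := N `|` [set y].
have cN' : countable N' by apply: countable_setU => //; exact: countable1.
have mN' : measurable (N' : set (measurableTypeR R)).
  exact: countable_measurable.
have mD : measurable (`]x, y] : set (measurableTypeR R)) by [].
have N0 : mu N' = 0%E by exact: countable_lebesgue_measure0.
have iu : mu.-integrable `]x, y] (EFin \o u).
  apply: integrableS (hu y (le_trans x0 xy)) => //.
  by move=> z; rewrite /= !in_itv/= => /andP[xz ->]; rewrite (le_trans x0 (ltW xz)).
have ic : mu.-integrable `]x, y] (EFin \o cst c).
  have : mu.-integrable `[x, y] (EFin \o cst c).
    by apply: (itv_bounded_integrable _ _ _ `|c|) => //; exact: measurable_cst.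
  apply: integrableS => //; exact: subset_itv_oc_cc.
have -> : c * (y - x) = \int[mu]_(z in `]x, y]) c.
  rewrite Rintegral_cst//= lebesgue_measure_itv/= lte_fin.
  by case: ifPn => [//|]; rewrite -leNgt => yx; rewrite (@le_anti _ _ x y) ?xy// subrr mulr0.
rewrite /Rintegral (negligible_integral mN' mD iu N0) (negligible_integral mN' mD ic N0).
apply: le_Rintegral; first exact: measurableD.
- by apply: integrableS iu => //; exact: measurableD.
- by apply: integrableS ic => //; exact: measurableD.
move=> z [] /=; rewrite in_itv/= => /andP[xz zy] /not_orP[Nz /eqP zny].
by apply: h => //; rewrite lt_neqAle zny.
Qed.

Lemma potential_slope_ge u (N : set R) x y c : L1loc_halfline u -> countable N ->
  0 <= x -> x <= y -> (forall z, x < z -> z < y -> ~ N z -> c <= u z) ->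
  c * (y - x) <= potential u y - potential u x.
Proof.
move=> hu cN x0 xy h.
have hNu : L1loc_halfline (fun z => -1 * u z).
  by move=> z z0; exact: (integrableZl _ (-1) (hu z z0)).
have := potential_slope_le _ N x y (- c) hNu cN x0 xy.
rewrite !potentialB//.
have -> : \int[mu]_(z in `]x, y]) (-1 * u z) = - \int[mu]_(z in `]x, y]) u z.
  rewrite RintegralZl ?mulN1r//.
  apply: integrableS (hu y (le_trans x0 xy)) => //.
  by move=> z; rewrite /= !in_itv/= => /andP[xz ->]; rewrite (le_trans x0 (ltW xz)).
rewrite mulNr lerN2; apply => z xz zy Nz; rewrite mulN1r lerN2; exact: h.
Qed.

Lemma affine_terminal_slope (g : R -> R) (b t x k w : R) : b < t ->
  (forall s, b <= s <= t -> g s = x - k * (t - s)) ->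
  (g t - g s) / (t - s) @[s --> t^'-] --> w -> w = k.
Proof.
move=> bt gl gw; apply: (norm_cvg_unique gw); apply: cvg_near_cst; near=> r.
have br : b <= r by near: r; exact: nbhs_left_ge.
have rt : r < t by near: r; exact: nbhs_left_lt.
have -> : g t = x - k * (t - t) by apply: gl; rewrite lexx andbT ltW.
have -> : g r = x - k * (t - r) by apply: gl; rewrite br ltW.
have tr0 : 0 < t - r by rewrite subr_gt0.
by field; rewrite gt_eqF.
Unshelve. all: by end_near. Qed.

End potential_slopes.

Lemma exists_nat_gt {R : realType} (r : R) : exists n, r < n.+1%:R.
Proof.
exists (Num.bound `|r|); apply: le_lt_trans (ler_norm r) _.
by apply: lt_le_trans (archi_boundP (normr_ge0 r)) _; rewrite ler_nat.
Qed.

Lemma solution_onS {R : realType} (phi psi : R -> R) (t0 : R) (u0 v0 : R -> R)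
    (D D' : set R) (t : R) (u v : R -> R) : D' `<=` D ->
  solution_on phi psi t0 u0 v0 D t u v -> solution_on phi psi t0 u0 v0 D' t u v.
Proof.
move=> DD [cD off on]; split.
- by apply: sub_countable cD; apply: subset_card_le => x [/DD].
- by move=> x /DD; exact: off.
- by move=> x /DD; exact: on.
Qed.

Section global_velocity.
Context {R : realType}.
Context {phi psi : R -> R} (rphi : regular_boundary phi).
Context {q : R} (q0 : 0 < q) (growth : inflow_growth phi q).
Context {u v : R -> R -> R}.
Hypothesis sol : forall t0 t, t0 < t ->
  solution_on phi psi t0 (u t0) (v t0) `]0, +oo[ t (u t) (v t).
Hypothesis uU : forall t, Uspace (- q)%:E (u t).
Notation V t := (potential (u t)).
Implicit Types (t x y z : R).
Notation Phi := (inflow phi).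

Let uL1 t : L1loc_halfline (u t). Proof. by case: (uU t). Qed.

Lemma Uspace_potential_gt t : exists p C, [/\ 0 <= p, p < q, 0 <= C &
  forall y, 0 <= y -> - p * y - C <= V t y].
Proof.
have [p [C [qp C0 h]]] := Uspace_potential_ge _ _ (uU t) (ltry _).
exists (- Num.min p 0), C; split => //.
- by rewrite oppr_ge0 ge_min lexx orbT.
- by rewrite ltrNl lt_min -lte_fin qp oppr_lt0.
by move=> y y0; rewrite opprK; exact: h.
Qed.

Lemma arrival_velocity t0 t x : t0 < t -> 0 < x -> ~ shocks phi t0 (u t0) t x ->
  (exists y, [/\ 0 <= y, u t x = (x - y) / (t - t0) &
     cost_lower_bound phi (u t0) t0 t x (direct_cost (u t0) t0 t x y)]) \/
  (exists y a b, [/\ boundary_visit t0 t y a b, u t x = x / (t - b) &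
     cost_lower_bound phi (u t0) t0 t x (boundary_cost phi (u t0) t0 t x y a b)]).
Proof.
move=> t0t x0 ns; have [_ off _] := sol _ _ t0t.
have [_ [g mg] /(_ g mg)[gu _]] : [/\ u t x = derive1 (value phi t0 (u t0) t) x,
        exists g, minimizer phi t0 (u t0) t x g &
        forall g, minimizer phi t0 (u t0) t x g ->
              (g t - g s) / (t - s) @[s --> t^'-] --> u t x /\
              transported psi t0 (v t0) t g (v t x)].
  by apply: off => //; rewrite /= in_itv/= x0.
have [p [C [p0 _ _ Vge]]] := Uspace_potential_gt t0.
have [[nz gl vE lb]|[a [b [vis _ gl vE lb]]]] :=
  minimizer_cases rphi (u t0) t0t p0 Vge _ _ x0 mg; [left|right].
  exists (g t0); split; last by rewrite -vE.
    by have [[_ g0 _] _] := mg; apply: g0; rewrite lexx ltW.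
  exact: (affine_terminal_slope g t0 t x _ _ t0t gl gu).
exists (g t0), a, b; split => //; last by rewrite -vE.
have [_ _ bt _ _] := vis.
exact: (affine_terminal_slope g b t x _ _ bt gl gu).
Qed.

(** The points that are shocks for none of the initial times t - 1, t - 2, ...
    These initial times serve to let the past recede. *)
Definition regular_point (t x : R) : Prop :=
  0 < x /\ forall n, ~ shocks phi (t - n.+1%:R) (u (t - n.+1%:R)) t x.

Lemma regular_point_co_countable t :
  countable (`]0, +oo[%classic `&` [set x | ~ regular_point t x]).
Proof.
have c : countable (\bigcup_n (`]0, +oo[%classic `&`
    shocks phi (t - n.+1%:R) (u (t - n.+1%:R)) t)).
  apply: bigcup_countable => // n _.
  by have [] := sol (t - n.+1%:R) t ltac:(by rewrite ltrBlDr ltrDl ltr0n).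
apply: sub_countable c; apply: subset_card_le => x [x0 nr].
apply: contrapT => h; apply: nr; split.
  by move: x0; rewrite /= in_itv/= andbT.
by move=> n sh; apply: h; exists n.
Qed.

(** A path that leaves the boundary has positive velocity. *)
Lemma nonpositive_velocity t x n : regular_point t x -> u t x <= 0 ->
  let y := x - u t x * n.+1%:R in x <= y /\
  cost_lower_bound phi (u (t - n.+1%:R)) (t - n.+1%:R) t x
    (direct_cost (u (t - n.+1%:R)) (t - n.+1%:R) t x y).
Proof.
move=> [x0 nsh] u0 y; have n0 : 0 < n.+1%:R :> R by rewrite ltr0n.
have t0t : t - n.+1%:R < t by rewrite ltrBlDr ltrDl.
split; first by rewrite /y lerBrDr gerDl mulr_le0_ge0// ltW.
have [[z [z0 uE lb]]|[z [a [b [[_ _ bt _ _] uE _]]]]] := arrival_velocity _ _ _ t0t x0 (nsh n).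
  suff -> : y = z by [].
  by rewrite /y uE opprB addrCA subrr addr0 divfK ?lt0r_neq0// opprB addrCA subrr addr0.
by move: u0; rewrite uE leNgt divr_gt0// subr_gt0.
Qed.

(** Optimal paths that end to the right of a straight one start to the right of
    it; as the duration is arbitrarily large, they are not faster. *)
Lemma nonpositive_velocity_antitone t x x' : regular_point t x -> u t x <= 0 ->
  regular_point t x' -> x < x' -> u t x' <= u t x.
Proof.
move=> rx u0 [x'0 nsh'] xx'; have [x0 _] := rx.
apply/ler_addgt0Pr => e e0.
have [n en] := exists_nat_gt ((x' - x) / e).
have n0 : 0 < n.+1%:R :> R by rewrite ltr0n.
have {}en : x' - x <= n.+1%:R * e by rewrite -ler_pdivrMr// ltW.
have t0t : t - n.+1%:R < t by rewrite ltrBlDr ltrDl.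
have [xy [lbd lbb]] := nonpositive_velocity t x n rx u0.
set y := x - u t x * n.+1%:R in xy lbd lbb.
have tn : t - (t - n.+1%:R) = n.+1%:R by rewrite opprB addrCA subrr addr0.
have [[z [z0 uE [lbd' _]]]|[z [a [b [vis uE [lbd' _]]]]]] := arrival_velocity _ _ _ t0t x'0 (nsh' n).
  have yz : y <= z.
    have := lbd z z0; have := lbd' y (le_trans (ltW x0) xy); rewrite /direct_cost tn.
    have n2 : 0 < (2 * n.+1%:R)^-1 :> R by rewrite invr_gt0 mulr_gt0.
    move: (V _ z) (V _ y) (2 * _)^-1 n2 => a b k k0 h1 h2.
    have h : 0 <= ((x' - x) * (z - y)) * k by lra.
    by move: h; rewrite pmulr_lge0// pmulr_rge0 ?subr_gt0// subr_ge0.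
  rewrite uE tn ler_pdivrMr// mulrDl (mulrC e).
  by move: yz en; rewrite /y; move: (u t x * _) (_ * e) => *; lra.
have [ta ab bt z0 _] := vis.
have tb : 0 < t - b by rewrite subr_gt0.
have tbn : t - b <= n.+1%:R by rewrite -tn lerD2l lerN2 (le_trans ta ab).
have := lbb z a b vis; have := lbd' y (le_trans (ltW x0) xy).
rewrite /direct_cost /boundary_cost tn => h1 h2.
have h : (x' ^+ 2 - x ^+ 2) / (2 * (t - b)) <= ((x' - y) ^+ 2 - (x - y) ^+ 2) / (2 * n.+1%:R).
  move: h1 h2; rewrite !mulrBl.
  move: (_ ^+ 2 / (2 * (t - b))) (x ^+ 2 / (2 * (t - b))) ((x' - y) ^+ 2 / _) ((x - y) ^+ 2 / _).
  by move: (V _ _) (V _ _) (z ^+ 2 / _) (Phi _) (Phi _) => *; lra.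
have h3 : (x' ^+ 2 - x ^+ 2) / (2 * n.+1%:R) <= (x' ^+ 2 - x ^+ 2) / (2 * (t - b)).
  rewrite ler_wpM2l//; first by rewrite subr_ge0 ler_sqr ?nnegrE ltW.
  by rewrite lef_pV2 ?posrE ?mulr_gt0// ler_pM2l.
have := le_trans h3 h; rewrite ler_pM2r ?invr_gt0 ?mulr_gt0//.
have : 0 < (x' - x) * y by rewrite mulr_gt0 ?(lt_le_trans x0 xy)// subr_gt0.
rewrite !expr2; move: y {xy lbd lbb lbd' h1 h2 h} => y ? ?; lra.
Qed.

(** Otherwise, velocities beyond z would be smaller than u t x, and the direct cost
    would decrease to the right of its minimum point. *)
Lemma velocity_ge_upstream t x n z : regular_point t x -> u t x <= 0 ->
  z < x - u t x * n.+1%:R -> regular_point (t - n.+1%:R) z ->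
  u t x <= u (t - n.+1%:R) z.
Proof.
move=> rx u0 zy rz; rewrite leNgt; apply/negP => uz.
have [z0 _] := rz; have n0 : 0 < n.+1%:R :> R by rewrite ltr0n.
have [xy [lbd _]] := nonpositive_velocity t x n rx u0.
set t0 := t - n.+1%:R in rz uz lbd; set w := u t x in u0 uz xy zy lbd.
set y := x - w * n.+1%:R in xy zy lbd.
have y0 : 0 < y := lt_trans z0 zy.
(* the shift of the starting point that saves most *)
pose h := n.+1%:R * (w - u t0 z).
have h0 : 0 < h by rewrite mulr_gt0// subr_gt0.
have := potential_slope_le (u t0) _ y (y + h) (u t0 z) (uL1 t0)
  (regular_point_co_countable t0) (ltW y0) ltac:(by rewrite lerDl ltW) _.
have tn : t - t0 = n.+1%:R by rewrite opprB addrCA subrr addr0.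
have := lbd (y + h) ltac:(by rewrite addr_ge0 ?ltW).
rewrite /direct_cost tn => h1 h2.
have {}h2 : V t0 (y + h) - V t0 y <= u t0 z * (y + h - y).
  apply: h2 => z' yz' _ nr.
  apply: (nonpositive_velocity_antitone t0 z z' rz (le_trans (ltW uz) u0) _ (lt_trans zy yz')).
  apply: contrapT => nr'; apply: nr; split; last exact: nr'.
  by rewrite /= in_itv/= (lt_trans y0 yz').
have e : (x - (y + h)) ^+ 2 / (2 * n.+1%:R) - (x - y) ^+ 2 / (2 * n.+1%:R) =
    - w * h + h * (w - u t0 z) / 2.
  by rewrite /y /h; field; rewrite lt0r_neq0.
have : 0 < h * (w - u t0 z) by rewrite mulr_gt0// subr_gt0.
move: h1 h2 e; rewrite (addrC y) addrK.
move: (_ ^+ 2 / _) (_ ^+ 2 / _) (V _ _) (V _ _) (u t0 z) => a b c d e.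
move: w h {uz u0 xy zy lbd y y0 h0} => w h ? ? ? ?; lra.
Qed.

(** Let w = u t x <= 0 and let n be large. The path to x starts at distance about
    - w n and its cost is at least about - w^2 n / 2, as the data are at least w
    below its starting point. Waiting at the boundary until time t - 1 costs about
    - q^2 n / 2, which is less. *)
Lemma slow_velocity_gt0 t x : regular_point t x -> - q < u t x -> 0 < u t x.
Proof.
have contra (a b c d e f g h : R) : g - e <= a -> f - c + h - 2 * g < d - e ->
    a + e / 2 <= 0 + 0 - (c - b) / 2 + h / 2 -> b <= f - d -> False by lra.
move=> rx uq; rewrite ltNge; apply/negP => u0; have [x0 _] := rx.
have := velocity_ge_upstream t x; have := nonpositive_velocity t x.
set w := u t x in u0 uq * => straight upstream.
have wq : w ^+ 2 < q ^+ 2.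
  by rewrite -sqrrN ltr_sqr ?nnegrE ?oppr_ge0 ?(ltW q0)// ltrNl.
pose p := (w ^+ 2 + q ^+ 2) / 2.
have pq : p < q ^+ 2 by rewrite /p; lra.
have wp : 0 < p - w ^+ 2 by rewrite /p; lra.
have [T hT] := growth p pq.
pose K := p * t - Phi (t - 1) + x ^+ 2 - 2 * (w * x).
have [n] := exists_nat_gt (Num.max (K / (p - w ^+ 2)) (t - T)).
rewrite gt_max ltr_pdivrMr// => /andP[nK nT].
have [xy [_ /(_ 0 (t - n.+1%:R) (t - 1))lb]] := straight n rx u0.
have {}upstream z := upstream n z rx u0.
set t0 := t - n.+1%:R in lb upstream.
set y := x - w * n.+1%:R in xy lb upstream.
have tn : t - t0 = n.+1%:R by rewrite opprB addrCA subrr addr0.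
have Vy : w * y <= V t0 y.
  have := potential_slope_ge (u t0) _ 0 y w (uL1 t0)
    (regular_point_co_countable t0) (lexx 0) (le_trans (ltW x0) xy).
  rewrite potential0 !subr0; apply => z z0 zy nr; apply: upstream zy _.
  apply: contrapT => nr'; apply: nr; split; last exact: nr'.
  by rewrite /= in_itv/= z0.
have := hT t0 ltac:(by rewrite /t0; lra).
have : boundary_visit t0 t 0 t0 (t - 1).
  by split => //; rewrite ?ltrBlDr ?ltrDl// /t0 lerD2l lerN2 ler1n.
move=> /lb; rewrite /direct_cost /boundary_cost potential0 expr0n/= mul0r tn.
rewrite (_ : t - (t - 1) = 1) ?mulr1; last by rewrite opprB addrCA subrr addr0.
have -> : (x - y) ^+ 2 / (2 * n.+1%:R) = w ^+ 2 * n.+1%:R / 2.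
  by rewrite /y; field; rewrite lt0r_neq0.
have wy : w * y = w * x - w ^+ 2 * n.+1%:R by rewrite /y; ring.
have pt : p * t0 = p * t - p * n.+1%:R by rewrite /t0 mulrBr.
move: Vy nK; rewrite wy pt /K mulrBr (mulrC _ p) (mulrC _ (w ^+ 2)).
move: (V t0 y) (Phi t0) (Phi (t - 1)) (p * n.+1%:R) (w ^+ 2 * n.+1%:R) (p * t) (w * x) (x ^+ 2).
exact: contra.
Qed.

(** A velocity of at most - q would not be exceeded to the right of x, and
    u t would not belong to U_(-q). *)
Lemma global_velocity_gt0 t x : regular_point t x -> 0 < u t x.
Proof.
move=> rx; have [wq|wq] := ltP (- q) (u t x); first exact: slow_velocity_gt0.
have u0 : u t x <= 0 by rewrite (le_trans wq)// oppr_le0 ltW.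
have [x0 _] := rx; have [p [C [p0 pq C0 Vge]]] := Uspace_potential_gt t.
have qp : 0 < q - p by rewrite subr_gt0.
pose K := V t x + q * x + C.
pose y := Num.max x ((K + 1) / (q - p)).
have xy : x <= y by rewrite le_max lexx.
have Ky : K + 1 <= y * (q - p) by rewrite -ler_pdivrMr// le_max lexx orbT.
have := potential_slope_le (u t) _ x y (- q) (uL1 t)
  (regular_point_co_countable t) (ltW x0) xy.
have Vy := Vge y (le_trans (ltW x0) xy).
move=> h; suff : V t y - V t x <= - q * (y - x).
  move: Vy Ky; rewrite /K mulrBr mulrBr (mulrC y) (mulrC y) mulNr mulNr mulNr.
  by move: (V t y) (V t x) (q * y) (p * y) (q * x) => *; lra.
apply: h => z xz _ nr; apply: le_trans wq.
apply: (nonpositive_velocity_antitone t x z rx u0 _ xz).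
apply: contrapT => nr'; apply: nr; split; last exact: nr'.
by rewrite /= in_itv/= (lt_trans x0 xz).
Qed.

Lemma global_potential_ge0 t y : 0 <= y -> 0 <= V t y.
Proof.
move=> y0; have := potential_slope_ge (u t) _ 0 y 0 (uL1 t)
    (regular_point_co_countable t) (lexx 0) y0.
rewrite potential0 !subr0 mul0r; apply => z z0 _ nr; apply: ltW.
apply: global_velocity_gt0; apply: contrapT => nr'; apply: nr; split; last exact: nr'.
by rewrite /= in_itv/= z0.
Qed.

(** Since velocities are positive, the potentials at all times are bounded
    below by 0. The attraction to the explicit solution is then uniform in the
    initial time, which may recede to -oo. *)
Lemma global_solution_uniq t :
  (forall x, 0 < x -> u t x = usol phi t x) /\
  exists2 B : set R, countable B & forall x, 0 < x -> ~ B x -> v t x = vsol phi psi t x.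
Proof.
have attract n : exists t0, t0 < t /\
    solution_on phi psi t0 (u t0) (v t0) `]0, n.+1%:R[ t (usol phi t) (vsol phi psi t).
  have [//|T hT] := pullback_attraction psi rphi q0 growth t n.+1%:R 0 0 (lexx 0) q0 (lexx 0).
  exists (Num.min T t - 1); split.
    by rewrite ltrBlDr (le_lt_trans (_ : _ <= t))// ?ge_min ?lexx ?orbT// ltrDl.
  apply: solution_onS (hT _ _ _ _ (uL1 _) _); first exact: subset_itv_oo_oc.
    by rewrite ltrBlDr (le_lt_trans (_ : _ <= T))// ?ge_min ?lexx// ltrDl.
  by move=> y y0; rewrite oppr0 mul0r addr0; exact: global_potential_ge0.
have [t0 ht0] := choice attract.
have same n : (forall x, `]0, n.+1%:R[%classic x -> u t x = usol phi t x) /\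
    (forall x, `]0, n.+1%:R[%classic x -> ~ shocks phi (t0 n) (u (t0 n)) t x ->
       v t x = vsol phi psi t x).
  have [t0t st] := ht0 n; apply: (solution_uniq _ _ _ _ _ _ _ st) => //.
  by apply: solution_onS (sol _ _ t0t) => x; rewrite /= !in_itv/= => /andP[->].
split=> [x x0|].
  have [n xn] := exists_nat_gt x; have [h _] := same n; apply: h.
  by rewrite /= in_itv/= x0.
exists (\bigcup_n (`]0, +oo[%classic `&` shocks phi (t0 n) (u (t0 n)) t)).
  by apply: bigcup_countable => // n _; have [t0t _] := ht0 n; have [] := sol _ _ t0t.
move=> x x0 nB; have [n xn] := exists_nat_gt x; have [_ h] := same n; apply: h.
  by rewrite /= in_itv/= x0.
by move=> sh; apply: nB; exists n => //; split => //; rewrite /= in_itv/= x0.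
Qed.

End global_velocity.

(** * A maximal ergodic inequality *)

Lemma ge0_integral_preserved {R : realType} {d : measure_display}
    {Omega : measurableType d} (P : probability Omega R) (T : Omega -> Omega)
    (f : Omega -> \bar R) :
  measurable_fun setT T ->
  (forall A, measurable A -> P (T @^-1` A) = P A) ->
  measurable_fun setT f -> (forall w, 0 <= f w)%E ->
  (\int[P]_w f (T w) = \int[P]_w f w)%E.
Proof.
move=> mT pT mf f0.
have := @ge0_integral_pushforward _ _ _ _ _ T mT P setT f measurableT mf
  (fun w _ => f0 w).
rewrite preimage_setT => <-.
by apply: eq_measure_integral => A mA _; exact: pT.
Qed.

Section maximal_ergodic.
Context {R : realType} {d : measure_display} {Omega : measurableType d}.
Context (P : probability Omega R) (T : Omega -> Omega) (Y : Omega -> R) (c : R).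
Hypotheses (mT : measurable_fun setT T)
  (pT : forall A, measurable A -> P (T @^-1` A) = P A)
  (mY : measurable_fun setT Y) (Y0 : forall w, 0 <= Y w) (c0 : 0 <= c).

(** The maximum of k * c - (Y + ... + Y \o T^(k-1)) over k <= n. *)
Fixpoint max_deficit (n : nat) (w : Omega) : R :=
  if n is n'.+1 then Num.max 0 (c - Y w + max_deficit n' (T w)) else 0.

Let M := max_deficit.

Let M_ge0 n w : 0 <= M n w.
Proof. by case: n => //= n; rewrite le_max lexx. Qed.

Let M_le n w : M n w <= n%:R * c.
Proof.
elim: n w => [|n IH] w /=; first by rewrite mul0r.
have := IH (T w); rewrite ge_max mulr_ge0 ?ler0n//= -natr1 mulrDl mul1r.
by move: (Y0 w) (n%:R * c) => + x; rewrite /M => *; lra.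
Qed.

Let M_mono n w : M n w <= M n.+1 w.
Proof.
elim: n w => [|n IH] w; first exact: M_ge0.
rewrite /M/= ge_max le_max lexx/= le_max; apply/orP; right.
by rewrite lerD2l; exact: IH.
Qed.

Let mM n : measurable_fun setT (M n).
Proof.
elim: n => [|n IH]; first exact: measurable_cst.
apply: measurable_maxr; first exact: measurable_cst.
apply: measurable_funD; first by apply: measurable_funB => //; exact: measurable_cst.
exact: measurableT_comp.
Qed.

Let M_sum n w : n%:R * c - \sum_(i < n) Y (iter i T w) <= M n w.
Proof.
elim: n w => [|n IH] w; first by rewrite big_ord0 mul0r subrr.
rewrite /M/= le_max; apply/orP; right; apply: le_trans (lerD (lexx _) (IH (T w))).
rewrite big_ord_recl/= -natr1 mulrDl mul1r.
rewrite (eq_bigr (fun i : 'I_n => Y (iter i T (T w)))) => [|i _]; last first.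
  by rewrite -iterSr.
by move: (\sum_(_ < _) _) => *; lra.
Qed.

Let E n := [set w | 0 < M n w].

Let mE n : measurable (E n).
Proof.
rewrite -[E n]setTI.
apply: (measurable_lte measurableT (f := cst 0%:E) (g := EFin \o M n)) => //.
exact/measurable_EFinP.
Qed.

Let E_integral n : (\int[P]_(w in E n.+1) (Y w)%:E <= c%:E)%E.
Proof.
have mMn k : measurable_fun setT (EFin \o M k) by exact/measurable_EFinP.
have mYE : measurable_fun setT ((EFin \o Y) \_ (E n.+1)).
  apply/(measurable_restrictT _ (mE n.+1)).
  by apply: measurable_funTS; exact/measurable_EFinP.
have Mfin k : (\int[P]_w (M k w)%:E \is a fin_num)%E.
  rewrite ge0_fin_numE; last by apply: integral_ge0 => w _; rewrite lee_fin.
  apply: (@le_lt_trans _ _ (\int[P]_w (cst (k%:R * c)%:E w))%E).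
    apply: (ge0_le_integral _ measurableT); [|exact: mMn|exact: measurable_cst|].
      by move=> w _; rewrite lee_fin.
    by move=> w _; rewrite lee_fin M_le.
  by rewrite integral_cst//= probability_setT mule1 ltry.
rewrite integral_mkcond -(leeD2rE _ _ (Mfin n.+1)).
have Y_ge0 w : (0 <= ((EFin \o Y) \_ (E n.+1)) w)%E.
  by apply: erestrict_ge0 => ? _; rewrite lee_fin.
have M_ge0' k w : (0 <= (EFin \o M k) w)%E by rewrite lee_fin.
rewrite -(ge0_integralD P measurableT (fun w _ => Y_ge0 w) mYE
  (fun w _ => M_ge0' _ w) (mMn _)).
have step : (\int[P]_w (M n (T w))%:E <= \int[P]_w (M n.+1 w)%:E)%E.
  rewrite (ge0_integral_preserved P T (EFin \o M n))//.
  apply: (ge0_le_integral _ measurableT); [|exact: mMn|exact: mMn|].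
    by move=> w _; rewrite lee_fin.
  by move=> w _; rewrite lee_fin.
apply: le_trans (leeD2l _ step).
rewrite (_ : c%:E = \int[P]_w (cst c%:E w))%E; last first.
  by rewrite integral_cst//= probability_setT mule1.
have mMT : measurable_fun setT (fun w => (M n (T w))%:E).
  by apply/measurable_EFinP; apply: measurableT_comp => //; exact: mM.
rewrite -(ge0_integralD P measurableT (fun w _ => c0 : 0 <= (cst c%:E w))%E
  (@measurable_cst _ _ _ _ _ _) (fun w _ => M_ge0' n (T w)) mMT).
apply: (ge0_le_integral _ measurableT).
- by move=> w _; rewrite adde_ge0.
- exact: emeasurable_funD.
- by apply: emeasurable_funD => //; exact: measurable_cst.
move=> w _; rewrite patchE; case: ifPn => [/set_mem wE|/negP wE].
  have : Y w + M n.+1 w <= c + M n (T w).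
    move: wE; rewrite /E /M/= maxElt; case: ifPn => [_ _|]; last by rewrite ltxx.
    by rewrite addrA [Y w + _]addrC subrK.
  by rewrite -lee_fin.
have M0 : M n.+1 w = 0.
  apply/eqP; rewrite eq_le M_ge0 andbT leNgt; apply/negP => h.
  by apply: wE; exact/mem_set.
have : 0 + M n.+1 w <= c + M n (T w) by rewrite M0 addr0 addr_ge0.
by rewrite -lee_fin.
Qed.

(** Where M_n > 0, the maximum is reached after a first step, so that
    Y + M_n <= c + M_n \o T there; as T preserves the integral of M_n, the
    integral of Y over that set is at most c. *)
Lemma maximal_ergodic (A : set Omega) : measurable A -> P A = 1%E ->
  (forall w, A w -> exists n, \sum_(i < n) Y (iter i T w) < n%:R * c) ->
  (\int[P]_w (Y w)%:E <= c%:E)%E.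
Proof.
move=> mA PA hA; have mYE : measurable_fun setT (EFin \o Y) by exact/measurable_EFinP.
have PA0 : P (~` A) = 0%E.
  by rewrite probability_setC// PA subee.
rewrite (@ge0_negligible_integral _ _ _ P setT (~` A))//; last 2 first.
- exact: measurableC.
- by move=> w _; rewrite lee_fin.
rewrite setTD setCK.
have sub : A `<=` \bigcup_n E n.+1.
  move=> w /hA[n hn]; exists n => //; apply: lt_le_trans (M_mono n w).
  by apply: lt_le_trans (M_sum n w); rewrite subr_gt0.
have mEE : measurable (\bigcup_n E n.+1) by exact: bigcup_measurable.
apply: (@le_trans _ _ (\int[P]_(w in \bigcup_n E n.+1) (Y w)%:E)%E).
  apply: ge0_subset_integral => //; first exact: measurable_funTS.
  by move=> w _; rewrite lee_fin.
have cv := @ge0_nondecreasing_set_cvg_integral _ _ _ (fun n => E n.+1) (EFin \o Y) P.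
apply: (cvge_to_le (cv _ _ _ _)) => //.
- apply/nondecreasing_seqP => n; apply/subsetPset => w /=.
  by move=> /lt_le_trans; apply; exact: M_mono.
- by move=> n; exact: measurable_funTS.
- by move=> n w _; rewrite lee_fin.
by near=> n; exact: E_integral.
Unshelve. all: by end_near. Qed.

End maximal_ergodic.

(** * Random boundary values *)

Section translation.
Context {R : realType}.
Notation mu := (@lebesgue_measure R).

Lemma measurable_shift (a : R) :
  measurable_fun setT (fun r : measurableTypeR R => (r + a : measurableTypeR R)).
Proof. by apply: measurable_funD => //; exact: measurable_cst. Qed.

Lemma shift_preimage_itv (a s t : R) (b b' : bool) :
  (fun r => r + a) @^-1` [set` Interval (BSide b (s + a)) (BSide b' (t + a))] =
  [set` Interval (BSide b s) (BSide b' t)].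
Proof.
apply/funext => x; apply/propext; rewrite /= !in_itv.
by case: b; case: b'; rewrite /= ?lerD2r ?ltrD2r.
Qed.

Lemma lebesgue_measure_shift (a : R) (A : set R) : measurable A ->
  pushforward mu (fun r : measurableTypeR R => (r + a : measurableTypeR R)) A = mu A.
Proof.
move=> mA; apply/esym.
have ms := measurable_shift a.
apply: lebesgue_measure_unique => //= _ [[s t]] _ <-.
rewrite /pushforward -[s in RHS](subrK a) -[t in RHS](subrK a).
rewrite shift_preimage_itv/= !lebesgue_measure_itv/= !lte_fin ltrD2r.
by case: ifP => // _; rewrite -!EFinB; congr EFin; ring.
Qed.

Lemma ge0_Rintegral_shift (f : R -> R) (a s t : R) : measurable_fun setT f ->
  (forall r, 0 <= f r) ->
  \int[mu]_(r in `[s, t]) f (r + a) = \int[mu]_(r in `[s + a, t + a]) f r.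
Proof.
move=> mf f0; rewrite /Rintegral; congr fine.
rewrite -(shift_preimage_itv a s t true false).
rewrite -(@ge0_integral_pushforward _ _ _ _ _ _ (measurable_shift a) mu _ (EFin \o f))//.
- apply: eq_measure_integral => [|? A mA _]; first exact: measurable_shift.
  exact: (lebesgue_measure_shift a A mA).
- by apply: measurable_funTS; exact/measurable_EFinP.
- by move=> r _; rewrite lee_fin.
Qed.

End translation.

Section random_boundary.
Context {R : realType} {d : measure_display} {Omega : measurableType d}.
Context {theta : R -> Omega -> Omega}.
Notation mu := (@lebesgue_measure R).
Hypothesis mtheta : measurable_fun [set: measurableTypeR R * Omega]
  (fun p : measurableTypeR R * Omega => theta p.1 p.2).
Hypothesis theta0 : theta 0 = id.
Hypothesis thetaD : forall s t, theta (s + t) = theta s \o theta t.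

Lemma measurable_theta t : measurable_fun setT (theta t).
Proof. exact: (measurable_fun_pair2 t mtheta). Qed.

Lemma trajectory_shift (X : Omega -> R) t w r :
  trajectory theta X (theta t w) r = trajectory theta X w (r + t).
Proof. by rewrite /trajectory thetaD. Qed.

Lemma measurable_trajectories (X : Omega -> R) : measurable_fun setT X ->
  measurable_fun setT
    (fun p : measurableTypeR R * Omega => trajectory theta X p.2 p.1).
Proof. by move=> mX; exact: (measurableT_comp mX mtheta). Qed.

Context {phi : Omega -> R} (mphi : measurable_fun setT phi).
Hypothesis phi_bounded : forall (w : Omega) (a b : R),
  [bounded trajectory theta phi w t | t in `[a, b]].
Notation J w := (inflow (trajectory theta phi w)).
Notation rate w := (inflow_rate (trajectory theta phi w)).

Lemma regular_trajectory w : regular_boundary (trajectory theta phi w).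
Proof.
split; last exact: phi_bounded.
exact: (measurable_fun_pair1 w (measurable_trajectories _ mphi)).
Qed.

Lemma rate_integral_shift t w a b :
  \int[mu]_(r in `[a, b]) rate (theta t w) r =
  \int[mu]_(r in `[a + t, b + t]) rate w r.
Proof.
rewrite -(ge0_Rintegral_shift (rate w) t a b
  (measurable_inflow_rate (regular_trajectory w) setT) inflow_rate_ge0).
by apply: eq_Rintegral => r _; rewrite /inflow_rate /funrpos trajectory_shift.
Qed.

Lemma Faction_shift t w x a s :
  Faction (trajectory theta phi (theta t w)) a x s =
  Faction (trajectory theta phi w) (a + t) x (s + t).
Proof.
by rewrite /Faction rate_integral_shift opprD addrACA subrr addr0.
Qed.

Lemma inflow_shift t w s : J (theta t w) s = J w (s + t) - J w t.
Proof.
have shift a b : a <= b -> J (theta t w) b - J (theta t w) a = J w (b + t) - J w (a + t).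
  move=> ab; rewrite -(inflowB (regular_trajectory w)) ?lerD2r//.
  by rewrite -(inflowB (regular_trajectory (theta t w)))// rate_integral_shift.
have [s0|s0] := leP 0 s.
  by have := shift _ _ s0; rewrite inflow0 subr0 add0r.
have := shift _ _ (ltW s0); rewrite inflow0 sub0r add0r => /(congr1 -%R).
by rewrite opprK opprB.
Qed.

Lemma measurable_rates : measurable_fun setT
  (fun p : measurableTypeR R * Omega => (rate p.2 p.1)%:E).
Proof.
apply/measurable_EFinP; apply: measurable_funX; apply: measurable_funrpos.
exact: measurable_trajectories.
Qed.

(** Integrals over a window of time become integrals over the line, to which
    the Fubini-Tonelli theorem applies. *)
Definition rate_window (s t : R) (p : measurableTypeR R * Omega) : \bar R :=
  ((rate p.2 p.1)%:E * (\1_(`[s, t] `*` setT) p)%:E)%E.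

Lemma measurable_rate_window s t : measurable_fun setT (rate_window s t).
Proof.
apply: emeasurable_funM; first exact: measurable_rates.
by apply/measurable_EFinP; apply: measurable_indic; exact: measurableX.
Qed.

Lemma rate_window_ge0 s t p : (0 <= rate_window s t p)%E.
Proof. by rewrite mule_ge0// lee_fin// inflow_rate_ge0. Qed.

Lemma rate_windowE s t r w :
  rate_window s t (r, w) = ((EFin \o rate w) \_ `[s, t]) r.
Proof.
rewrite /rate_window patchE /= indicE in_setX in_setT andbT.
by case: ifP => _; rewrite ?mule1 ?mule0.
Qed.

Lemma measurable_rate_integral (s t : R) :
  measurable_fun setT (fun w => \int[mu]_(r in `[s, t]) rate w r).
Proof.
apply: measurableT_comp; first exact: fine_measurable.
under eq_fun do rewrite integral_mkcond.
apply: (eq_measurable_fun _ _ (measurable_fun_fubini_tonelli_G (m1 := mu) _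
  (measurable_rate_window s t) (rate_window_ge0 s t))).
by move=> w _; apply: eq_integral => r _; rewrite rate_windowE.
Qed.

Lemma measurable_inflow s : measurable_fun setT (fun w => J w s).
Proof.
rewrite /inflow; case: (0 <= s); first exact: measurable_rate_integral.
apply: measurableT_comp; [exact: oppr_measurable|exact: measurable_rate_integral].
Qed.

End random_boundary.

(** * Growth of the boundary integral in the past *)

Section slow_growth.
Context {R : realType}.
Implicit Types (J : R -> R) (c : R).

(** J exceeds a line of slope less than c along a sequence that tends to -oo.
    The margin between the slopes makes the property insensitive to time shifts,
    which change J by a constant. *)
Definition slow (J : R -> R) (c : R) : Prop :=
  exists2 c', c' < c & forall T, exists2 s, s <= T & c' * s < J s.

Lemma slow_shift J J' c t K : (forall s, J' s = J (s + t) - K) ->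
  slow J c -> slow J' c.
Proof.
move=> JE [c' c'c h]; pose c2 := (c' + c) / 2.
have c'2 : 0 < c2 - c' by rewrite /c2; lra.
exists c2 => [|T]; first by rewrite /c2; lra.
have [s] := h (Num.min (T + t) ((c2 * t - K) / (c2 - c'))).
rewrite le_min => /andP[sT]; rewrite ler_pdivlMr// mulrBr => sK hs.
exists (s - t); first by rewrite lerBlDr.
rewrite JE subrK mulrBr; move: sK hs; rewrite (mulrC s) (mulrC s).
by move: (c2 * s) (c' * s) (c2 * t) (J s) => *; lra.
Qed.

(** By monotonicity integer times suffice, and the margin allows for rational
    slopes, so that the property is defined by countably many values of J. *)
Lemma slow_natP J c : {homo J : s t / s <= t} ->
  slow J c <-> exists2 c' : rat, ratr c' < c &
    forall N : nat, exists2 n : nat, (N <= n)%N & ratr c' * - n%:R < J (- n%:R).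
Proof.
move=> ndJ; split=> [[c' c'c h]|[c' c'c h]]; last first.
  exists (ratr c') => // T; have [N TN] := exists_nat_gt (- T).
  have [n Nn hn] := h N.+1; exists (- n%:R) => //.
  by rewrite lerNl (le_trans (ltW TN))// ler_nat.
have [c2] := rat_in_itvoo c'c; rewrite in_itv/= => /andP[c'2 c2c].
have d0 : 0 < ratr c2 - c' by rewrite subr_gt0.
exists c2 => // N.
have [s] := h (Num.min (- N.+1%:R) (- (`|c'| / (ratr c2 - c') + 1))).
rewrite le_min => /andP[]; rewrite lerNr => Ns; rewrite lerNr => cs hs.
have s0 : 0 <= - s := le_trans (ler0n _ _) Ns.
have /andP[] := truncn_itv s0; move: (Num.truncn _) => n ns sn.
have Nn : (N.+1 < n.+1)%N by rewrite -(ltr_nat R); exact: le_lt_trans Ns sn.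
exists n; first exact: ltnW.
have h1 : J s <= J (- n%:R) by apply: ndJ; rewrite lerNr.
apply: lt_le_trans h1; apply: le_lt_trans hs.
have h2 : `|c' * (s + n%:R)| <= `|c'|.
  rewrite normrM ler_piMr// ler_norml; move: ns sn; rewrite -natr1 => ns sn.
  by apply/andP; split; lra.
have h3 : `|c'| <= n%:R * (ratr c2 - c').
  by rewrite -ler_pdivrMr//; move: cs sn; rewrite -natr1; move: (_ / _) => *; lra.
have := le_trans (ler_norm _) h2; move: h2 h3; rewrite ler_norml => /andP[h2 _].
by rewrite mulrBr; move: h2; rewrite mulrDr mulrN (mulrC n%:R) (mulrC n%:R); move: (c' * s) (c' * _) (_ * _) => *; lra.
Qed.

Lemma inflow_growth_not_slow (phi : R -> R) (q : R) : 0 < q ->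
  (forall n, ~ slow (inflow phi) (q ^+ 2 - n.+1%:R^-1)) -> inflow_growth phi q.
Proof.
move=> q0 h p pq; apply: contrapT => nT.
have [n hn] := exists_nat_gt (q ^+ 2 - p)^-1.
apply: (h n); exists p.
  have qp : 0 < q ^+ 2 - p by rewrite subr_gt0.
  by rewrite ltrBrDr -ltrBrDl -[ltRHS]invrK ltf_pV2 ?posrE ?invr_gt0.
move=> T; apply: contrapT => hs; apply: nT; exists T => s sT.
by rewrite leNgt; apply/negP => ps; apply: hs; exists s.
Qed.

End slow_growth.

Section random_growth.
Context {R : realType} {d : measure_display} {Omega : measurableType d}.
Context {P : probability Omega R} {theta : R -> Omega -> Omega}.
Notation mu := (@lebesgue_measure R).
Hypothesis flow : ergodic_flow P theta.
Context {phi : Omega -> R} (mphi : measurable_fun setT phi).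
Hypothesis phi_bounded : forall (w : Omega) (a b : R),
  [bounded trajectory theta phi w t | t in `[a, b]].
Notation J w := (inflow (trajectory theta phi w)).
Notation rate w := (inflow_rate (trajectory theta phi w)).

Let mtheta : measurable_fun [set: measurableTypeR R * Omega]
  (fun p : measurableTypeR R * Omega => theta p.1 p.2).
Proof. by case: flow. Qed.

Let theta0 : theta 0 = id. Proof. by case: flow => _ []. Qed.

Let thetaD s t : theta (s + t) = theta s \o theta t.
Proof. by case: flow => _ []. Qed.

Let theta_preserves t A : measurable A -> P (theta t @^-1` A) = P A.
Proof. by case: flow => _ _ + _; exact. Qed.

(** The flow preserves the mean of phi_+^2 at each of the times between -1
    and 0. *)
Lemma mean_inflow :
  (\int[P]_w (- J w (-1))%:E =
   \int[P]_w (Num.max (phi w) 0 ^+ 2)%:E)%E.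
Proof.
transitivity (\int[P]_w \int[mu]_r rate_window (theta := theta) (phi := phi) (-1) 0 (r, w))%E.
  apply: eq_integral => w _; rewrite /inflow ler0N1 opprK.
  under [RHS]eq_integral do rewrite rate_windowE.
  rewrite -integral_mkcond /Rintegral fineK//.
  apply: integrable_fin_num => //; apply: inflow_rate_integrable.
  exact: regular_trajectory.
rewrite -(fubini_tonelli (m1 := mu) (m2 := P) _ (measurable_rate_window mtheta mphi (-1) 0)
  (rate_window_ge0 (-1) 0)).
transitivity (\int[mu]_r ((cst (\int[P]_w (Num.max (phi w) 0 ^+ 2)%:E)) \_ `[(-1)%R, 0%R]) r)%E.
  apply: eq_integral => r _ /=; under eq_integral do rewrite rate_windowE.
  have mphi2 : measurable_fun setT (fun w => (Num.max (phi w) 0 ^+ 2)%:E).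
    by apply/measurable_EFinP; apply: measurable_funX; exact: measurable_funrpos mphi.
  rewrite [RHS]patchE; case: ifPn => r1; last first.
    apply: integral0_eq => w _; by rewrite patchE (negbTE r1).
  rewrite -[RHS](ge0_integral_preserved P (theta r) _ (measurable_theta mtheta r)
    (theta_preserves r) mphi2).
    by apply: eq_integral => w _; rewrite patchE r1.
  by move=> w; rewrite lee_fin sqr_ge0.
rewrite -integral_mkcond integral_cst//= lebesgue_measure_itv/= lte_fin ltrN10.
by rewrite -EFinB opprK add0r mule1.
Qed.

Lemma slow_measurable c : measurable [set w | slow (J w) c].
Proof.
rewrite (_ : [set w | slow (J w) c] = \bigcup_(c' in [set c' : rat | ratr c' < c])
    \bigcap_N \bigcup_(n in [set n | (N <= n)%N])
      [set w | ratr c' * - n%:R < J w (- n%:R)]); last first.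
  apply/seteqP; split=> w /=.
    move=> /(slow_natP _ _ (inflow_le (regular_trajectory mtheta mphi phi_bounded w))).
    by move=> [c' c'c h]; exists c' => // N _; have [n Nn hn] := h N; exists n.
  move=> [c' c'c h]; apply/(slow_natP _ _ (inflow_le (regular_trajectory mtheta mphi phi_bounded w))).
  by exists c' => // N; have [n Nn hn] := h N Logic.I; exists n.
rewrite bigcup_mkcond; apply: bigcupT_measurable_rat => c'; case: ifP => // _.
apply: bigcapT_measurable => N; apply: bigcup_measurable => n _.
rewrite -[X in measurable X]setTI.
apply: (measurable_lte measurableT (f := cst (ratr c' * - n%:R)%:E) (g := fun w => (J w (- n%:R))%:E)) => //.
by apply/measurable_EFinP; exact: measurable_inflow.
Qed.

Lemma slow_invariant c t :
  theta t @^-1` [set w | slow (J w) c] = [set w | slow (J w) c].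
Proof.
have shift := inflow_shift mtheta thetaD mphi phi_bounded.
apply/seteqP; split=> w /=; last exact: slow_shift (shift t w).
have wE : theta (- t) (theta t w) = w.
  by rewrite -[LHS]/((theta (- t) \o theta t) w) -thetaD addNr theta0.
by rewrite -[in X in _ -> X]wE; exact: slow_shift (shift (- t) (theta t w)).
Qed.

Lemma inflow_sum n w :
  \sum_(i < n) - J (iter i (theta (-1)) w) (-1) = - J w (- n%:R).
Proof.
have iterE i : iter i (theta (-1)) w = theta (- i%:R) w.
  elim: i => [|i IH]; first by rewrite oppr0 theta0.
  by rewrite iterS IH -natr1 opprD addrC thetaD.
elim: n => [|n IH]; first by rewrite big_ord0 oppr0 inflow0 oppr0.
rewrite big_ord_recr/= IH iterE (inflow_shift mtheta thetaD mphi phi_bounded).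
have -> : - n.+1%:R = -1 - n%:R :> R by rewrite -natr1 opprD addrC.
by rewrite opprB addKr.
Qed.

(** By ergodicity the event has probability 0 or 1. In the latter case the
    maximal inequality for the time step -1 would bound the mean q ^+ 2 by c. *)
Lemma slow_null (q c : R) : 0 < q ->
  (\int[P]_w (Num.max (phi w) 0 ^+ 2)%:E = (q ^+ 2)%:E)%E -> c < q ^+ 2 ->
  P [set w | slow (J w) c] = 0%E.
Proof.
move=> q0 moment cq; have mA := slow_measurable c.
have [_ _ _ /(_ _ mA (slow_invariant c))[//|PA]] := flow.
pose c1 := Num.max c 0; have c10 : 0 <= c1 by rewrite le_max lexx orbT.
have c1q : c1 < q ^+ 2 by rewrite gt_max cq exprn_gt0.
have Y0 w : 0 <= - J w (-1).
  by rewrite oppr_ge0 -(inflow0 (trajectory theta phi w)) inflow_le// ?ler0N1//; exact: regular_trajectory.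
have mY : measurable_fun setT (fun w => - J w (-1)).
  by apply: measurableT_comp; [exact: oppr_measurable|exact: measurable_inflow].
have := maximal_ergodic P (theta (-1)) (fun w => - J w (-1)) c1
  (measurable_theta mtheta _) (theta_preserves _) mY Y0 c10 _ mA PA.
rewrite mean_inflow moment lee_fin leNgt c1q => /(_ _)/negP[]// w.
move=> /(slow_natP _ _ (inflow_le (regular_trajectory mtheta mphi phi_bounded w))).
move=> [c' c'c /(_ 1)[n n1 hn]]; exists n; rewrite inflow_sum ltrNl (le_lt_trans _ hn)//.
by rewrite mulrN lerN2 mulrC ler_wpM2l// (le_trans (ltW c'c))// le_max lexx.
Qed.

Lemma inflow_growth_ae (q : R) : 0 < q ->
  (\int[P]_w (Num.max (phi w) 0 ^+ 2)%:E = (q ^+ 2)%:E)%E ->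
  {ae P, forall w, inflow_growth (trajectory theta phi w) q}.
Proof.
move=> q0 moment.
have : {ae P, forall w, forall n, ~ slow (J w) (q ^+ 2 - n.+1%:R^-1)}.
  apply: ae_foralln => n; exists [set w | slow (J w) (q ^+ 2 - n.+1%:R^-1)]; split.
  - exact: slow_measurable.
  - by apply: (slow_null q) => //; rewrite gtrDl oppr_lt0 invr_gt0 ltr0n.
  - by move=> w /= /contrapT.
by apply: filterS => w; exact: inflow_growth_not_slow.
Qed.

End random_growth.

(** * Measurability and stationarity of the explicit solution *)

Lemma continuous_lt_rat {R : realType} (f : R -> R) (s y : R) : continuous f ->
  f s < y -> exists p : rat, f (ratr p) < y.
Proof.
move=> cf fsy; have oO : open (f @^-1` [set z | z < y]).
  by apply: open_comp; [move=> z _; exact: cf|exact: open_lt].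
have [z [fz [p _ pz]]] := dense_rat (ex_intro _ s fsy) oO.
by exists p; rewrite pz.
Qed.

Section argmin_events.
Context {R : realType} {phi : R -> R} (rphi : regular_boundary phi).
Notation F := (Faction phi).
Implicit Types (t x s r a b c : R).

(** Whether F has a minimum point in a segment can be seen on countably many
    values of F. *)
Lemma argmin_in_itvP t x a b : a <= b -> b < t ->
  (exists2 s, a <= s <= b & argmins phi t x s) <->
  (forall r : rat, ratr r < t -> forall k : nat, exists p : rat,
     F t x (clamp a b (ratr p)) < F t x (ratr r) + k.+1%:R^-1).
Proof.
move=> ab bt; split.
  move=> [s /andP[as_ sb] [st hs]] r rt k.
  apply: (@continuous_lt_rat _ (fun z => F t x (clamp a b z)) s).
    exact: Faction_continuous.
  rewrite /= clamp_id//; apply: (le_lt_trans (hs _ rt)).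
  by rewrite ltrDl invr_gt0 ltr0n.
move=> h; have [c cab hc] := Faction_min rphi t x a b ab bt.
have ct : c < t by case/andP: cab => _ /le_lt_trans; apply.
exists c => //; split => // r rt; rewrite leNgt; apply/negP => rc.
pose a' := r - 1; pose b' := (r + t) / 2.
have ra' : a' < r by rewrite /a' ltrBlDr ltrDl.
have rb' : r < b' by rewrite /b'; lra.
have b't : b' < t by rewrite /b'; lra.
have ab' : a' <= b' by apply: ltW; exact: lt_trans rb'.
pose O := `]a', b'[ `&` (fun z => F t x (clamp a' b' z)) @^-1` [set z | z < F t x c].
have oO : open O.
  apply: openI; first exact: interval_open.
  apply: open_comp; last exact: open_lt.
  by move=> z _; exact: Faction_continuous.
have rO : O r by split; rewrite /= ?in_itv/= ?ra'// clamp_id ?(ltW ra') ?(ltW rb').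
have [z [zO [p _ pz]]] := dense_rat (ex_intro _ r rO) oO.
rewrite -{z}pz in zO; case: zO.
rewrite /= in_itv/= => /andP[ap pb]; rewrite clamp_id ?(ltW ap) ?(ltW pb)// => pc.
have [k hk] := exists_nat_gt (F t x c - F t x (ratr p))^-1.
have [p' hp'] := h p (lt_trans pb b't) k.
have := hc _ (clamp_in ab (ratr p')).
rewrite leNgt (lt_le_trans hp')// -lerBrDl -[leRHS]invrK.
by rewrite lef_pV2 ?posrE ?invr_gt0 ?subr_gt0// ltW.
Qed.

Lemma tstar_le t x : tstar phi t x <= t.
Proof.
by rewrite /tstar; case: xgetP => [s _ [[/ltW]]|].
Qed.

(** A smallest minimum point exists if and only if there are minimum points and
    they are bounded below; otherwise tstar has the value t > c. *)
Lemma tstar_leP t x c : c < t -> tstar phi t x <= c <->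
  exists N : nat, (exists2 s, - N%:R <= s <= c & argmins phi t x s) /\
    forall s, argmins phi t x s -> - N.+1%:R < s.
Proof.
move=> ct; split.
  rewrite /tstar; case: xgetP => [s0 _ [hs lbs] s0c|_ tc]; last by move: tc; rewrite leNgt ct.
  have [N hN] := exists_nat_gt (- s0).
  exists N.+1; split.
    by exists s0 => //; rewrite s0c andbT lerNl ltW.
  move=> s /lbs; apply: lt_le_trans; rewrite ltrNl (lt_trans hN)//.
  by rewrite ltr_nat.
move=> [N [[s /andP[_ sc] hs] lbN]].
have [s1 hs1] := smallest_argmin_of_lbound rphi t x (- N.+1%:R) s hs
  (fun s' hs' => ltW (lbN s' hs')).
have [hs2 lb2] := xgetPex t (ex_intro _ s1 hs1).
exact: le_trans (lb2 _ hs) sc.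
Qed.

Lemma no_argmin_belowP t x a : (forall s, argmins phi t x s -> a < s) <->
  forall m : nat, ~ exists2 s, - m%:R <= s <= a & argmins phi t x s.
Proof.
split=> [h m [s /andP[_ sa] /h]|h s hs]; first by rewrite ltNge sa.
rewrite ltNge; apply/negP => sa.
have [m hm] := exists_nat_gt (- s); have ms : - m.+1%:R <= s by rewrite lerNl ltW.
by apply: (h m.+1); exists s => //; rewrite ms.
Qed.

End argmin_events.

Section stationarity.
Context {R : realType}.

(** The default value of tstar is the terminal time, which is shifted by t as
    well. *)
Lemma tstar_shift (phi phi' : R -> R) (t x : R) :
  (forall s, Faction phi' 0 x s = Faction phi t x (s + t)) ->
  tstar phi t x = tstar phi' 0 x + t.
Proof.
move=> FE; have arg s : argmins phi' 0 x s <-> argmins phi t x (s + t).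
  rewrite /argmins /= gtrDr; split=> -[s0 h]; split => // r rt.
    by have := h (r - t); rewrite subr_lt0 !FE subrK; apply.
  by rewrite !FE; apply: h; rewrite gtrDr.
have small s : smallest_argmin phi' 0 x s <-> smallest_argmin phi t x (s + t).
  split=> -[/arg hs lbs]; split => // r.
    by move=> hr; rewrite -lerBrDr; apply: lbs; apply/arg; rewrite subrK.
  by move=> /arg/lbs; rewrite lerD2r.
have uniq s s' : smallest_argmin phi t x s -> smallest_argmin phi t x s' -> s = s'.
  by move=> [hs lbs] [hs' lbs']; apply/eqP; rewrite eq_le lbs// lbs'.
rewrite {2}/tstar; case: xgetP => [s _ /small hs|nex].
  by apply: xget_unique => // s' hs'; exact: uniq hs' hs.
rewrite add0r /tstar; case: xgetP => // s _ hs; exfalso.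
by apply: (nex (s - t)); apply/small; rewrite subrK.
Qed.

End stationarity.

Section random_argmins.
Context {R : realType} {d : measure_display} {Omega : measurableType d}.
Context {theta : R -> Omega -> Omega}.
Hypothesis mtheta : measurable_fun [set: measurableTypeR R * Omega]
  (fun p : measurableTypeR R * Omega => theta p.1 p.2).
Context {phi : Omega -> R} (mphi : measurable_fun setT phi).
Hypothesis phi_bounded : forall (w : Omega) (a b : R),
  [bounded trajectory theta phi w t | t in `[a, b]].
Notation Phi w := (trajectory theta phi w).
Implicit Types (t x s a b c : R).

Let rphi w := regular_trajectory mtheta mphi phi_bounded w.

Lemma measurable_Faction t x s : measurable_fun setT (fun w => Faction (Phi w) t x s).
Proof.
apply: measurable_funD; first exact: measurable_cst.
apply: measurable_funM; first exact: measurable_cst.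
exact: (measurable_rate_integral mtheta mphi).
Qed.

Let argmin_in_itv t x a b : set Omega :=
  [set w | exists2 s, a <= s <= b & argmins (Phi w) t x s].

Lemma measurable_argmin_in_itv t x a b : b < t -> measurable (argmin_in_itv t x a b).
Proof.
move=> bt; have [ab|ba] := leP a b; last first.
  rewrite (_ : argmin_in_itv _ _ _ _ = set0)//; apply/seteqP; split=> // w [s /andP[as_ sb] _].
  by have := le_lt_trans (le_trans as_ sb) ba; rewrite ltxx.
rewrite (_ : argmin_in_itv _ _ _ _ =
    ~` \bigcup_(r in [set r : rat | ratr r < t]) \bigcup_k ~` \bigcup_(p : rat)
      [set w | Faction (Phi w) t x (clamp a b (ratr p)) <
               Faction (Phi w) t x (ratr r) + k.+1%:R^-1]); last first.
  apply/seteqP; split=> w /=.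
    move=> /(argmin_in_itvP (rphi w) t x a b ab bt) h [r rt [k _]]; apply.
    by have [p hp] := h r rt k; exists p.
  move=> h; apply/(argmin_in_itvP (rphi w) t x a b ab bt) => r rt k.
  apply: contrapT => np; apply: h; exists r => //; exists k => // -[p _ hp].
  by apply: np; exists p.
apply: measurableC; rewrite bigcup_mkcond; apply: bigcupT_measurable_rat => r.
case: ifP => // _; apply: bigcup_measurable => k _; apply: measurableC.
apply: bigcupT_measurable_rat => p; rewrite -[X in measurable X]setTI.
apply: (measurable_lte measurableT
  (f := fun w => (Faction (Phi w) t x (clamp a b (ratr p)))%:E)
  (g := fun w => (Faction (Phi w) t x (ratr r) + k.+1%:R^-1)%:E)).
  by apply/measurable_EFinP; exact: measurable_Faction.
apply/measurable_EFinP; apply: measurable_funD; first exact: measurable_Faction.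
exact: measurable_cst.
Qed.

Lemma measurable_tstar t x : measurable_fun setT (fun w => tstar (Phi w) t x).
Proof.
move=> mT; apply: (measurability _ (RGenOInfty.measurableE R)) => //.
move=> _ [_ [c ->] <-]; rewrite setTI.
have [ct|tc] := ltP c t; last first.
  rewrite (_ : _ @^-1` _ = set0)//; apply/seteqP; split=> // w /=.
  by rewrite in_itv/= andbT ltNge (le_trans (tstar_le _ _))//; exact: rphi.
rewrite (_ : _ @^-1` _ = ~` \bigcup_N (argmin_in_itv t x (- N%:R) c `&`
    [set w | forall s, argmins (Phi w) t x s -> - N.+1%:R < s])); last first.
  apply/seteqP; split=> w /=; rewrite in_itv/= andbT.
    rewrite ltNge => /negP h [N _ hN]; apply: h.
    by apply/(tstar_leP (rphi w) t x c ct); exists N.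
  move=> h; rewrite ltNge; apply/negP => /(tstar_leP (rphi w) t x c ct)[N hN].
  by apply: h; exists N.
apply: measurableC; apply: bigcup_measurable => N _.
have [Nc|cN] := leP (- N%:R) c; last first.
  rewrite (_ : _ `&` _ = set0)//; apply/seteqP; split=> // w [[s /andP[as_ sb] _] _].
  by have := le_lt_trans (le_trans as_ sb) cN; rewrite ltxx.
apply: measurableI; first exact: measurable_argmin_in_itv.
rewrite (_ : [set w | _] = \bigcap_m ~` argmin_in_itv t x (- m%:R) (- N.+1%:R)); last first.
  apply/seteqP; split=> w /=.
    by move=> /no_argmin_belowP h m _; exact: h.
  by move=> h; apply/no_argmin_belowP => m; exact: h.
apply: bigcapT_measurable => m; apply: measurableC; apply: measurable_argmin_in_itv.
by apply: le_lt_trans ct; apply: le_trans Nc; rewrite lerN2 ler_nat.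
Qed.

Lemma usol_is_process : is_process (fun w => usol (Phi w)).
Proof.
move=> t x x0; apply: measurable_funM; first exact: measurable_cst.
apply: measurableT_comp; first exact: inv_measurable.
by apply: measurable_funB; [exact: measurable_cst|exact: measurable_tstar].
Qed.

Lemma vsol_is_process (psi : Omega -> R) : measurable_fun setT psi ->
  is_process (fun w => vsol (Phi w) (trajectory theta psi w)).
Proof.
move=> mpsi t x x0.
have mp := measurable_trajectories mtheta psi mpsi.
have mts : measurable_fun setT (fun w => (tstar (Phi w) t x, w) : measurableTypeR R * Omega).
  by apply: measurable_fun_pair; [exact: measurable_tstar|exact: measurable_id].
exact: (measurableT_comp mp mts).
Qed.

End random_argmins.

(** * The random one-point attractor *)

Theorem theorem4p4 (R : realType) (d : measure_display)
    (Omega : measurableType d) (P : probability Omega R)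
    (theta : R -> Omega -> Omega) (phi psi : {RV P >-> R}) (q : R)
    (theta_ergodic : ergodic_flow P theta)
    (phi_bounded : forall (w : Omega) (a b : R),
       [bounded trajectory theta phi w t | t in `[a, b]])
    (psi_bounded : forall (w : Omega) (a b : R),
       [bounded trajectory theta psi w t | t in `[a, b]])
    (q_gt0 : 0 < q)
    (phi_moment :
       ('E_P[fun w => (Num.max (phi w) 0 ^+ 2)%R] = (q ^+ 2)%:E)%E) :
  let u := fun w : Omega => usol (trajectory theta phi w) in
  let v := fun w : Omega => vsol (trajectory theta phi w) (trajectory theta psi w) in
  [/\ (* existence *)
      [/\ {ae P, forall w, forall t x : R, 0 < x ->
             smallest_argmin (trajectory theta phi w) t x
               (tstar (trajectory theta phi w) t x)},
          global_solution P theta phi psi u v &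
          stationary theta u v],
      (* uniqueness *)
      forall u' v' : Omega -> R -> R -> R,
        global_solution P theta phi psi u' v' ->
        stationary theta u' v' ->
        {ae P, forall w, forall t : R, Uspace (- q)%:E (u' w t)} ->
        {ae P, forall w, forall t : R,
           (forall x : R, 0 < x -> u' w t x = u w t x) /\
           (exists2 B : set R, countable B &
              forall x : R, 0 < x -> ~ B x -> v' w t x = v w t x)} &
      (* pullback attraction *)
      {ae P, forall w, forall (z z' : R -> R) (r : R),
         Uspace (- q)%:E z -> 0 < r ->
         exists2 t0 : R, t0 < 0 &
           forall t : R, t < t0 ->
             solution_on (trajectory theta phi w) (trajectory theta psi w) t z z'
               `]0, r] 0 (u w 0) (v w 0)}].
Proof.
move=> u v.
have [mtheta [theta0 thetaD] _ _] := theta_ergodic.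
have mphi : measurable_fun setT phi by exact: measurable_funPT.
have mpsi : measurable_fun setT psi by exact: measurable_funPT.
have rphi w := regular_trajectory mtheta mphi phi_bounded w.
have growth : {ae P, forall w, inflow_growth (trajectory theta phi w) q}.
  by apply: (inflow_growth_ae theta_ergodic mphi phi_bounded q q_gt0); move: phi_moment; rewrite unlock.
split; first split.
- apply: filterS growth => w gr t x x0.
  exact: tstarP (rphi w) (growth_diverges _ _ q_gt0 gr) t x x0.
- split.
  + exact: (usol_is_process mtheta mphi phi_bounded).
  + exact: (vsol_is_process mtheta mphi phi_bounded psi mpsi).
  apply: filterS growth => w gr.
  have div := growth_diverges _ _ q_gt0 gr; split.
    by move=> t; exact: (usol_Uspace (rphi w) div).
  by move=> t0 t t0t; exact: (explicit_solution_global (rphi w) div t0t).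
- move=> t w x x0.
  have tE := tstar_shift (trajectory theta phi w) (trajectory theta phi (theta t w)) t x.
  rewrite /u /v /usol /vsol tE; last first.
    by move=> s; rewrite (Faction_shift mtheta thetaD mphi phi_bounded) add0r.
  by rewrite (trajectory_shift thetaD) opprD addrCA subrr addr0 sub0r.
- move=> u' v' [_ _ sol] _ uU.
  apply: filterS3 growth sol uU => w gr [_ sol] uU t.
  exact: (global_solution_uniq (rphi w) q_gt0 gr sol uU t).
apply: filterS growth => w gr z z' r zU r0; have [zL1 _] := zU.
have [p [C [qp C0 zge]]] := Uspace_potential_ge _ _ zU (ltry _).
have [||||T hT] := pullback_attraction (trajectory theta psi w) (rphi w) q_gt0 gr 0 r (- Num.min p 0) C.
- by rewrite oppr_ge0 ge_min lexx orbT.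
- by rewrite ltrNl lt_min -lte_fin qp oppr_lt0.
- exact: C0.
- exact: r0.
exists (Num.min T (- 1)) => [|t]; first by rewrite gt_min ltrN10 orbT.
rewrite lt_min => /andP[tT _]; apply: hT => // y y0.
by rewrite opprK; exact: zge.
Qed.
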